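(* Let $S$ be a simply connected analytic submanifold of $\mathbb{R}^{n-1}$ and let $P\in\mathbb{R}[\mathbf{x};x_n]$ have degree $d_n$ in $x_n$. Assume $P$ never nullifies on $S$, and that $\mathrm{Disc}^{d_n}_{x_n}(P)$ is not the zero polynomial and is order-invariant on $S$. Then $P$ is projectively delineable on $S$ and $H^{d_n}(P)$ is order-invariant on each projective $P$-section over $S$.
   Context: Write $\mathbf{x}=(x_1,\dots,x_{n-1})$; $E_{\mathbf{x}_0}P$ is the polynomial in $x_n$ obtained by substituting $\mathbf{x}_0$ for $\mathbf{x}$. ''$P$ never nullifies on $S$'' means $E_{\mathbf{x}}P\ne0$ for every $\mathbf{x}\in S$. $\mathrm{Disc}^{d}_{x_n}(P)\in\mathbb{R}[\mathbf{x}]$ is the discriminant with respect to $x_n$ for formal degree $d$, so that $E_{\mathbf{x}}\mathrm{Disc}^d_{x_n}(P)$ is the discriminant of $E_{\mathbf{x}}P$ regarded as a polynomial of formal degree $d$. For a polynomial $f$ in $m$ variables and $v\in\mathbb{R}^m$, $\mathrm{ord}(f,v)$ is the least total order of a partial derivative of $f$ nonzero at $v$; order-invariant on a set means $\mathrm{ord}(f,\cdot)$ is constant there. $\mathbb{RP}^1$ is the quotient of $\mathbb{R}^2\setminus\{(0,0)\}$ by proportionality with the quotient topology; $(u:v)$ is the class of $(u,v)$. $H^{d}(P)(\mathbf{x},x_n,y)=\sum_kc_k(\mathbf{x})x_n^ky^{d-k}$ for $P=\sum_kc_k(\mathbf{x})x_n^k$. A projective root of a binary form $g(u,v)$ is $(u_0:v_0)$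 with $g(u_0,v_0)=0$, of multiplicity (for $g\ne0$) the largest $m$ with $(v_0u-u_0v)^m\mid g$. $Z_{\mathbb{RP}^1}(P,S)=\{(\mathbf{x},(x_n:y))\in S\times\mathbb{RP}^1: H^{d_n}(P)(\mathbf{x},x_n,y)=0\}$. $P$ is projectively delineable on $S$ if there are $k\in\mathbb{N}$ and continuous $\theta_1,\dots,\theta_k:S\to\mathbb{RP}^1$ such that $Z_{\mathbb{RP}^1}(P,S)$ is the disjoint union of their graphs and, for each $l$, there is $m_l\ge1$ with $\theta_l(\mathbf{x})$ a projective root of $E_{\mathbf{x}}H^{d_n}(P)$ of multiplicity $m_l$ for all $\mathbf{x}\in S$; the graphs are the projective $P$-sections. Order-invariance of $H^{d_n}(P)$ on the section of $\theta_l$ means $\mathbf{x}\mapsto\mathrm{ord}(H^{d_n}(P),(\mathbf{x},u,v))$ is constant on $S$ for representatives $(u,v)$ of $\theta_l(\mathbf{x})$. *)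

(* Defs.v *)
From HB Require Import structures.
From mathcomp Require Import all_boot all_order all_algebra.
From mathcomp Require Import mpoly.
From mathcomp Require Import all_classical all_reals all_analysis.

Set Implicit Arguments.
Unset Strict Implicit.
Unset Printing Implicit Defensive.

Import Order.TTheory GRing.Theory Num.Theory.
Import numFieldNormedType.Exports.
Local Open Scope classical_set_scope.
Local Open Scope ring_scope.
Local Open Scope quotient_scope.

Section Defs.
Variable R : realType.

Definition coords (m : nat) (x : 'rV[R]_m) : 'I_m -> R := fun i => x ord0 i.

Definition monom_at (m : nat) (a : 'X_{1..m}) (y : 'rV[R]_m) : R :=
  \prod_(i < m) (y ord0 i) ^+ (a i).

Definition analytic_at (m : nat) (f : 'rV[R]_m -> R) (a : 'rV[R]_m) : Prop :=
  exists (c : 'X_{1..m} -> R) (r : R), 0 < r /\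
    forall y, ball a r y ->
      (exists M : R, forall N : nat,
          \sum_(al : 'X_{1..m < N}) `|c al * monom_at al (y - a)| <= M) /\
      ((fun N : nat => \sum_(al : 'X_{1..m < N}) c al * monom_at al (y - a))
         @ \oo --> f y).

(* Analytic (embedded) submanifold of R^m: locally (near each of its     *)
(* points) the graph of an analytic map expressing the coordinates       *)
(* outside some set J of coordinates as functions of those in J.        *)
Definition analytic_submanifold (m : nat) (S : set 'rV[R]_m) : Prop :=
  forall p, S p ->
    exists (J : {set 'I_m}) (U : set 'rV[R]_m) (g : 'I_m -> 'rV[R]_m -> R),
      [/\ open U, U p,
          (forall j (x : 'rV[R]_m), U x -> analytic_at (g j) x),
          (forall j (x y : 'rV[R]_m), (forall i, i \in J -> x ord0 i = y ord0 i) ->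
                         g j x = g j y) &
          S `&` U = [set x : 'rV[R]_m | U x /\ forall j, j \notin J -> x ord0 j = g j x]].

Definition unit_itv : set R := [set t | 0 <= t <= 1].
Definition unit_sq : set (R * R) := [set st | 0 <= st.1 <= 1 /\ 0 <= st.2 <= 1].

Definition path_in (m : nat) (S : set 'rV[R]_m) (g : R -> 'rV[R]_m) : Prop :=
  {within unit_itv, continuous g} /\ (forall t, unit_itv t -> S (g t)).

Definition simply_connected (m : nat) (S : set 'rV[R]_m) : Prop :=
  (forall a b, S a -> S b -> exists g, [/\ path_in S g, g 0 = a & g 1 = b]) /\
  (forall g, path_in S g -> g 0 = g 1 ->
     exists Hh : R * R -> 'rV[R]_m,
       [/\ {within unit_sq, continuous Hh},
           (forall st, unit_sq st -> S (Hh st)),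
           (forall t, unit_itv t -> Hh (t, 0) = g t /\ Hh (t, 1) = g 0) &
           (forall s, unit_itv s -> Hh (0, s) = g 0 /\ Hh (1, s) = g 0)]).

(* Polynomials in R[x; x_n] with x = (x_1,...,x_m), m = n-1, are      *)
(* represented as {poly {mpoly R[m]}}.                                 *)
Definition evalx (m : nat) (x : 'rV[R]_m) (P : {poly {mpoly R[m]}}) : {poly R} :=
  map_poly (meval (coords x)) P.

Definition never_nullifies (m : nat) (P : {poly {mpoly R[m]}}) (S : set 'rV[R]_m) :=
  forall x, S x -> evalx x P != 0.

Definition fsylvester (A : comNzRingType) (p q : {poly A}) (dp dq : nat)
  : 'M[A]_(dq + dp) :=
  \matrix_(i, j)
    if (i < dq)%N then
      (if (i <= j <= i + dp)%N then p`_(dp - (j - i)) else 0)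
    else
      (if (i - dq <= j <= i - dq + dq)%N then q`_(dq - (j - (i - dq))) else 0).

Definition fresultant (A : comNzRingType) (p q : {poly A}) (dp dq : nat) : A :=
  \det (fsylvester p q dp dq).

Definition generic_poly (d : nat) : {poly {mpoly R[d.+1]}} :=
  \poly_(k < d.+1) 'X_(inord k).

(* the generic discriminant: the (unique) D with
   a_d * D = (-1)^(d(d-1)/2) Res_{d,d-1}(P, P') for the generic P;
   for d = 0 we use the convention Disc = 1. *)
Definition generic_disc (d : nat) : {mpoly R[d.+1]} :=
  if d is 0 then 1 else
  let G := generic_poly d in
  let rhs := (-1) ^+ ((d * d.-1) %/ 2) * fresultant G G^`() d d.-1 in
  match pselect (exists D : {mpoly R[d.+1]}, 'X_(@ord_max d) * D = rhs) with
  | left h => projT1 (cid h)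
  | right _ => 0
  end.

Definition disc (m d : nat) (P : {poly {mpoly R[m]}}) : {mpoly R[m]} :=
  mmap (@mpolyC m R) (fun i : 'I_d.+1 => P`_i) (generic_disc d).

Definition has_ord (k : nat) (f : {mpoly R[k]}) (v : 'I_k -> R) (o : option nat) : Prop :=
  match o with
  | Some e => (exists a : 'X_{1..k}, mdeg a = e /\ meval v (mderivm a f) != 0) /\
              (forall a : 'X_{1..k}, (mdeg a < e)%N -> meval v (mderivm a f) = 0)
  | None => forall a : 'X_{1..k}, meval v (mderivm a f) = 0
  end.

Definition order_invariant (k : nat) (f : {mpoly R[k]}) (T : set ('I_k -> R)) : Prop :=
  exists o : option nat, forall v, T v -> has_ord f v o.

(* Homogenization H^d(P)(x, x_n, y) in R[x_1..x_m, x_n, y]: variables  *)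
(* 0..m-1 are x, variable m is x_n and variable m+1 is y.              *)
Definition liftx (m : nat) (c : {mpoly R[m]}) : {mpoly R[m.+2]} :=
  mmap (@mpolyC m.+2 R) (fun i : 'I_m => 'X_(widen_ord (leqW (leqnSn m)) i)) c.

Definition idx_xn (m : nat) : 'I_m.+2 := Ordinal (leqnSn m.+1).
Definition idx_y (m : nat) : 'I_m.+2 := ord_max.

Definition homogenize (m d : nat) (P : {poly {mpoly R[m]}}) : {mpoly R[m.+2]} :=
  \sum_(k < d.+1) liftx P`_k * 'X_(idx_xn m) ^+ k * 'X_(idx_y m) ^+ (d - k).

Definition pt3 (m : nat) (x : 'rV[R]_m) (u v : R) : 'I_m.+2 -> R :=
  fun i => if (insub (i : nat) : option 'I_m) is Some j then x ord0 j
          else if i == idx_xn m then u else v.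

Definition evalx_homog (m d : nat) (x : 'rV[R]_m) (P : {poly {mpoly R[m]}})
  : {mpoly R[2]} :=
  \sum_(k < d.+1) (meval (coords x) P`_k)%:MP * 'X_(0 : 'I_2) ^+ k * 'X_(1 : 'I_2) ^+ (d - k).

Definition mpdvd (k : nat) (a b : {mpoly R[k]}) : Prop := exists c, b = a * c.

Definition proj_root_mult (g : {mpoly R[2]}) (u0 v0 : R) (mu : nat) : Prop :=
  let l := v0 *: 'X_(0 : 'I_2) - u0 *: 'X_(1 : 'I_2) in
  [/\ meval (fun i : 'I_2 => if i == 0 then u0 else v0) g = 0, g != 0,
      mpdvd (l ^+ mu) g & ~ mpdvd (l ^+ mu.+1) g].

Definition nz2 : set (R * R) := [set p | p != (0, 0)].
Definition R2nz := set_type nz2.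

Definition proportional (p q : R2nz) : bool :=
  `[< exists l : R, l != 0 /\ \val p = (l * (\val q).1, l * (\val q).2) >].

Lemma proportional_refl : reflexive proportional.
Proof.
move=> p; apply/asboolP; exists 1; split; first exact: oner_neq0.
by rewrite !mul1r; case: (\val p).
Qed.

Lemma proportional_sym : ssrbool.symmetric proportional.
Proof.
move=> p q; apply/asboolP/asboolP => -[l [l0 e]]; exists l^-1;
  split; rewrite ?invr_eq0 //; rewrite e /= !mulrA mulVf ?mul1r //;
  by case: (\val _).
Qed.

Lemma proportional_trans : transitive proportional.
Proof.
move=> q p r /asboolP [l [l0 e1]] /asboolP [l' [l0' e2]]; apply/asboolP.
exists (l * l'); split; first by rewrite mulf_neq0.
by rewrite e1 e2 /= !mulrA.
Qed.

Definition proportional_equiv : equiv_rel R2nz :=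
  EquivRel proportional proportional_refl proportional_sym proportional_trans.

Definition RP1 := quotient_topology {eq_quot proportional_equiv}.

Definition repr_of (p : RP1) (u v : R) : Prop :=
  exists w : R2nz, \val w = (u, v) /\ (\pi_RP1 w : RP1) = p.

Definition proj_delineable_with (m : nat) (P : {poly {mpoly R[m]}})
    (S : set 'rV[R]_m) (k : nat) (theta : 'I_k -> 'rV[R]_m -> RP1) : Prop :=
  let d := (size P).-1 in
  [/\ (forall l, {within S, continuous (theta l)}),
      (forall x p, S x ->
         ((forall u v, repr_of p u v -> meval (pt3 x u v) (homogenize d P) = 0)
          <-> exists l, theta l x = p)),
      (forall x l l', S x -> theta l x = theta l' x -> l = l') &
      (forall l, exists mu : nat, (1 <= mu)%N /\
         forall x, S x -> forall u v, repr_of (theta l x) u v ->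
           proj_root_mult (evalx_homog d x P) u v mu)].

Definition proj_delineable (m : nat) (P : {poly {mpoly R[m]}}) (S : set 'rV[R]_m) : Prop :=
  exists (k : nat) (theta : 'I_k -> 'rV[R]_m -> RP1), proj_delineable_with P S theta.

Definition order_invariant_on_section (m : nat) (P : {poly {mpoly R[m]}})
    (S : set 'rV[R]_m) (th : 'rV[R]_m -> RP1) : Prop :=
  exists o : option nat, forall x, S x -> forall u v, repr_of (th x) u v ->
    has_ord (homogenize (size P).-1 P) (pt3 x u v) o.

End Defs.

(* Main.v *)
Require Import Defs.
From HB Require Import structures.
From mathcomp Require Import all_boot all_order all_algebra.
From mathcomp Require Import mpoly.
From mathcomp Require Import all_classical all_reals all_analysis.
From mathcomp Require Import complex.
From mathcomp Require Import ring lra zify.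
From mathcomp Require separable cyclotomic.

Set Implicit Arguments.
Unset Strict Implicit.
Unset Printing Implicit Defensive.

Import Order.TTheory GRing.Theory Num.Theory.
Import numFieldNormedType.Exports.
Local Open Scope classical_set_scope.
Local Open Scope quotient_scope.
Local Open Scope ring_scope.

(* Let e be the order of the discriminant on S.  Along a line p + t v with p in S on which the
   discriminant vanishes to order exactly e at t = 0, and along all nearby lines s + t v' with s in S,
   all projective roots are simple for small t != 0.

   A multiple root over p cannot split over a nearby s in S.  If it split into a and b, pull the
   punctured disc back by t = exp w and continue a and b to sections fa and fb over a long rectangle,
   and let ga, gb be the sections of the unperturbed family close to them on the right edge.
   The quotient (ga - gb) / (fa - fb) is holomorphic and bounded, close to 1 on the right edge and
   small towards the left; with a quadratic barrier this contradicts the maximum principle.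
   So every root extends to a continuous real root of the same multiplicity.

   The order along such a root is read off the Newton polygon of G(t, z), the form on the line, in a
   chart centered at the root.  Non-splitting applied to r^(-h) G(r^M, r^j z) with M = d! shows that
   passing from weight j to weight j + 1 changes the minimal weight h by an amount that does not
   depend on s; at j = M the minimal weight is M times the order.

   The roots, embedded in the unit circle by (u : v) |-> (u + i v) / (u - i v), thus form a covering
   of S, which is trivial because S is simply connected. *)

(** * Continuity of the roots of complex polynomials *)

(** Order-invariance of the discriminant enters as uniformity: along the lines [s + t v'] its
    coefficients below [e] vanish and the one at [e] stays away from 0, so one punctured disc free
    of its zeros serves all [s] near [p]. The families over [p] and over [s] can therefore be
    compared on one circle of positive radius; the difficulty is to carry the comparison to [t = 0].
    Monodromy permutes the roots over the punctured disc, hence the exponential pull-back. On the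
    long rectangle so obtained only a crude bound on the quotient is known on three of the four
    edges, and the barrier pays for it. Holomorphy is replaced by Taylor polynomials along the four
    axis directions, which already give [|f|^2] the sub-mean value property. The directions [v']
    vary with [s] because an order of vanishing is a minimum over all directions, while the
    neighbourhood of [p] that suits a fixed direction depends on it. The number [M = d!] is a common
    multiple of all differences between [z]-degrees. Rotated charts are used since roots may pass
    through infinity, where the leading coefficient of the fibre vanishes. *)

Section Cabs.
Variable R : rcfType.
Local Notation C := R[i].
Implicit Types z w : C.

(** Real-valued, unlike the norm of [R[i]], so that estimates are within reach of [lra] and
    [nra]. *)
Definition cabs z : R := Normc.normc z.
#[global] Arguments cabs : simpl never.

Lemma cabs_ge0 z : 0 <= cabs z.
Proof. by case: z => a b; rewrite /cabs /= sqrtr_ge0. Qed.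

Lemma cabs0 : cabs 0 = 0. Proof. exact: Normc.normc0. Qed.
Lemma cabs1 : cabs 1 = 1. Proof. exact: Normc.normc1. Qed.
Lemma cabsM : {morph cabs : z w / z * w}. Proof. exact: Normc.normcM. Qed.
Lemma cabsV z : cabs z^-1 = (cabs z)^-1. Proof. exact: Normc.normcV. Qed.
Lemma cabsN z : cabs (- z) = cabs z. Proof. exact: normcN. Qed.
Lemma cabsD z w : cabs (z + w) <= cabs z + cabs w. Proof. exact: le_normcD. Qed.

Lemma cabs_eq0 z : (cabs z == 0) = (z == 0).
Proof.
apply/eqP/eqP => [|->]; [exact: Normc.eq0_normc | exact: cabs0].
Qed.

Lemma cabs_gt0 z : (0 < cabs z) = (z != 0).
Proof. by rewrite lt0r cabs_eq0 cabs_ge0 andbT. Qed.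

Lemma cabsX z n : cabs (z ^+ n) = cabs z ^+ n.
Proof. by elim: n => [|n IHn]; rewrite ?expr0 ?cabs1 // !exprS cabsM IHn. Qed.

Lemma cabsC z w : cabs (z - w) = cabs (w - z).
Proof. by rewrite -cabsN opprB. Qed.

Lemma cabsB z w : cabs (z - w) <= cabs z + cabs w.
Proof. by rewrite (le_trans (cabsD _ _)) // cabsN. Qed.

Lemma cabs_trans w z u : cabs (z - u) <= cabs (z - w) + cabs (w - u).
Proof. by rewrite -[z - u](subrKA w) cabsD. Qed.

Lemma cabsBl z w : cabs z - cabs w <= cabs (z - w).
Proof. by rewrite lerBlDr -{1}[z](subrK w) cabsD. Qed.

Lemma cabs_real (x : R) : cabs x%:C%C = `|x|.
Proof. by rewrite /cabs /= expr0n /= addr0 sqrtr_sqr. Qed.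

Lemma cabs_conj z : cabs (z^*%C) = cabs z.
Proof. by case: z => a b; rewrite /cabs /= sqrrN. Qed.

Lemma sqr_cabs z : cabs z ^+ 2 = (complex.Re z) ^+ 2 + (complex.Im z) ^+ 2.
Proof. by case: z => a b; rewrite /cabs /= sqr_sqrtr // addr_ge0 ?sqr_ge0. Qed.

Lemma cabs_sum (I : Type) (r : seq I) (P : pred I) (F : I -> C) :
  cabs (\sum_(i <- r | P i) F i) <= \sum_(i <- r | P i) cabs (F i).
Proof.
elim/big_rec2: _ => [|i x y _ h]; first by rewrite cabs0.
by rewrite (le_trans (cabsD _ _)) // lerD2l.
Qed.

Lemma cabs_prod (I : Type) (r : seq I) (P : pred I) (F : I -> C) :
  cabs (\prod_(i <- r | P i) F i) = \prod_(i <- r | P i) cabs (F i).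
Proof. exact: (big_morph cabs cabsM cabs1). Qed.

End Cabs.
Arguments cabs {R} z : simpl never.

Section RootContinuity.
Variable R : rcfType.
Local Notation C := R[i].
Implicit Types (p q Q : {poly C}) (a z w : C) (s : seq C).

(** The [j]-th coefficient is a sum of at most [2 ^+ size s] products, each omitting [j] of the
    roots. Compared with the product of all roots, which is the constant term up to sign, every
    omission divides by at least [k]. *)
Lemma coef_prod_roots_bound s (k : R) : 0 < k ->
  all (fun w => k <= cabs w) s -> forall j,
  cabs (\prod_(w <- s) ('X - w%:P))`_j * k ^+ j
    <= 2 ^+ size s * cabs (\prod_(w <- s) ('X - w%:P))`_0.
Proof.
move=> k0; elim: s => [_ j|w s IHs /= /andP[hw hs] j].
  rewrite !big_nil expr0 mul1r !coef1 eqxx /= mulr1n cabs1.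
  by case: j => [|j]; rewrite /= ?mulr1n ?mulr0n ?expr0 ?mulr1 ?cabs1 ?cabs0 ?mul0r.
rewrite !big_cons; set q := \prod_(_ <- _) _ in IHs *.
have c0 : (('X - w%:P) * q)`_0 = - (w * q`_0).
  by rewrite mulrBl coefB coefXM coefCM sub0r.
rewrite c0 cabsN cabsM mulrBl coefB coefXM coefCM.
have IH := IHs hs; have w0 : 0 <= cabs w := cabs_ge0 w.
have q0 : 0 <= cabs q`_0 := cabs_ge0 _.
case: j => [|j] /=.
  rewrite sub0r cabsN cabsM expr0 mulr1 ler_peMl ?mulr_ge0 //.
  by rewrite exprn_ege1 // ler1n.
rewrite (le_trans (ler_wpM2r _ (cabsB _ _))) ?exprn_ge0 ?(ltW k0) //.
rewrite mulrDl exprS cabsM.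
have -> : 2 ^+ (size s).+1 * (cabs w * cabs q`_0)
   = cabs w * (2 ^+ size s * cabs q`_0) + cabs w * (2 ^+ size s * cabs q`_0) :> R.
  by rewrite exprS; ring.
apply: lerD; last by rewrite -mulrA ler_wpM2l // -exprS.
rewrite mulrCA; apply: ler_pM; rewrite ?mulr_ge0 ?cabs_ge0 ?exprn_ge0 ?(ltW k0) //.
Qed.

(** If all roots had modulus at least [k], [coef_prod_roots_bound] would bound every coefficient by
    the constant one. A small constant coefficient beside a large [j]-th one thus forces a small
    root, without any contour integral. *)
Lemma root_near0 p n (k : R) j : 0 < k -> (size p <= n.+1)%N ->
  2 ^+ n * cabs p`_0 < cabs p`_j * k ^+ j -> exists2 w, root p w & cabs w < k.
Proof.
move=> k0 sp hp.
have p0 : p != 0.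
  by apply: contraTneq hp => ->; rewrite !coef0 !cabs0 mulr0 mul0r ltxx.
have [s Ep] := closed_field_poly_normal p.
have lp : lead_coef p != 0 by rewrite lead_coef_eq0.
case: (boolP (all (fun w => k <= cabs w) s)) => [hs|/allPn[w ws]]; last first.
  rewrite -ltNge => wk; exists w => //.
  by rewrite Ep rootZ // root_prod_XsubC.
have := coef_prod_roots_bound k0 hs j.
set q := \prod_(_ <- _) _ in Ep *; move=> hq.
have ss : (size s <= n)%N.
  by move: sp; rewrite Ep size_scale // size_prod_XsubC.
move: hp; rewrite Ep !coefZ !cabsM ltNge.
have -> // : cabs (lead_coef p) * cabs q`_j * k ^+ j
     <= 2 ^+ n * (cabs (lead_coef p) * cabs q`_0).
rewrite -mulrA [leRHS]mulrCA ler_wpM2l ?cabs_ge0 // (le_trans hq) //.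
by rewrite ler_wpM2r ?cabs_ge0 // ler_weXn2l // ler1n.
Qed.

Definition pclose (e : R) p q := forall k, cabs (p`_k - q`_k) <= e.

Lemma horner_coef_bound p n (e b : R) z : (size p <= n)%N -> 0 <= e ->
  1 <= b -> cabs z <= b -> (forall k, cabs p`_k <= e) ->
  cabs p.[z] <= e * n%:R * b ^+ n.
Proof.
move=> sp e0 b1 zb hp; rewrite (horner_coef_wide z sp).
rewrite (le_trans (cabs_sum _ _ _)) //.
rewrite -[n in n%:R]card_ord -sum1_card natr_sum mulr_sumr mulr_suml.
apply: ler_sum => i _; rewrite mulr1 cabsM cabsX.
apply: ler_pM; rewrite ?cabs_ge0 ?exprn_ge0 ?cabs_ge0 //.
rewrite (@le_trans _ _ (b ^+ i)) ?lerXn2r ?nnegrE ?cabs_ge0 ?(le_trans ler01) //.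
by rewrite ler_weXn2l // ltnW.
Qed.

(** Synthetic division from the top: coefficient [k] of [p] is coefficient [k.+1] of the product
    plus [w] times coefficient [k.+1] of [p], so each step down enlarges the bound by a factor of at
    most [2 + cabs w]. *)
Lemma coef_divXsubC_bound p n (e : R) w : (size p <= n)%N -> 0 <= e ->
  (forall k, cabs ((('X - w%:P) * p)`_k) <= e) ->
  forall k, cabs p`_k <= e * (2 + cabs w) ^+ n.
Proof.
move=> sp e0 hp k; set b := 2 + cabs w.
have b1 : 1 <= b by rewrite /b -[2]/(1 + 1) -addrA lerDl addr_ge0 ?cabs_ge0.
have b0 : 0 <= b by rewrite (le_trans ler01).
suff H : forall m k, (n <= k + m)%N -> cabs p`_k <= e * b ^+ m.
  by apply: H; rewrite leq_addl.
elim=> [|m IHm] {}k hk.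
  by rewrite nth_default ?cabs0 ?expr0 ?mulr1 // (leq_trans sp) // -[k]addn0.
have := hp k.+1; rewrite mulrBl coefB coefXM coefCM /= => hk1.
have := IHm k.+1; rewrite addSnnS => /(_ hk) hk2.
rewrite -[p`_k](subrK (w * p`_k.+1)) (le_trans (cabsD _ _)) // cabsM.
rewrite (@le_trans _ _ (e * b ^+ m + cabs w * (e * b ^+ m))) //.
  rewrite lerD // ?ler_wpM2l ?cabs_ge0 //.
  by rewrite (le_trans hk1) // ler_peMr // exprn_ege1.
have X0 : 0 <= e * b ^+ m by rewrite mulr_ge0 ?exprn_ge0.
have -> : e * b ^+ m.+1 = 2 * (e * b ^+ m) + cabs w * (e * b ^+ m).
  by rewrite exprS mulrCA -mulrDl.
by rewrite lerD2r; lra.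
Qed.

Lemma size_XsubC_mul p w : p != 0 -> size (('X - w%:P) * p)%R = (size p).+1.
Proof. by move=> p0; rewrite size_monicM ?monicXsubC // size_XsubC. Qed.

(* Deflation: split off the mu roots near a one at a time. *)
Lemma roots_near_deflate n mu a Q0 (k : R) : Q0.[a] != 0 -> 0 < k ->
  exists2 e : R, 0 < e & forall Q, (size Q <= n)%N ->
    pclose e Q (('X - a%:P) ^+ mu * Q0) ->
    exists s Q1, [/\ size s = mu, all (fun w => cabs (w - a) < k) s,
      Q = \prod_(w <- s) ('X - w%:P) * Q1, (size Q1 <= n)%N & pclose k Q1 Q0].
Proof.
move=> Q0a; elim: mu k => [|mu IHmu] k k0.
  exists k => // Q sQ hQ; exists [::], Q; split=> //.
    by rewrite big_nil mul1r.
  by move=> j; have := hQ j; rewrite expr0 mul1r.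
have [e e0 He] := IHmu k k0.
pose P0 : {poly C} := ('X - a%:P) ^+ mu.+1 * Q0.
pose n' := maxn n (size P0).
have le_nn' : (n <= n')%N by apply: leq_maxl.
have sP0 : (size P0 <= n')%N by apply: leq_maxr.
pose P1 : {poly C} := ('X - a%:P) ^+ mu * Q0.
have EP0 : P0 = ('X - a%:P) * P1 by rewrite /P0 exprS mulrA.
have [B B0 hB] : exists2 B : R, 0 < B & forall j, cabs P1`_j <= B.
  exists (1 + \sum_(i < size P1) cabs P1`_i).
    by rewrite (lt_le_trans ltr01) // lerDl sumr_ge0 // => i _; apply: cabs_ge0.
  move=> j; have [lt|ge] := ltnP j (size P1); last first.
    by rewrite nth_default // cabs0 addr_ge0 // sumr_ge0 // => i _; apply: cabs_ge0.
  rewrite (bigD1 (Ordinal lt)) //= addrCA lerDl addr_ge0 // sumr_ge0 // => i _.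
  exact: cabs_ge0.
(* shift of the polynomial to a, whose coefficient mu.+1 is nonzero *)
pose sh (p : {poly C}) := p \Po ('X + a%:P).
have shB p q : sh (p - q) = sh p - sh q by rewrite /sh comp_polyB.
have [K K0 hK] : exists2 K : R, 0 < K & forall p (d : R), (size p <= n')%N -> 0 <= d ->
    (forall j, cabs p`_j <= d) -> forall j, cabs (sh p)`_j <= d * K.
  exists (1 + \sum_(i < n') \sum_(j < n') cabs (('X + a%:P) ^+ i)`_j).
    rewrite (lt_le_trans ltr01) // lerDl sumr_ge0 // => i _.
    by rewrite sumr_ge0 // => j _; apply: cabs_ge0.
  move=> p d sp d0 hp j.
  have ssh : (size (sh p) <= n')%N by rewrite size_comp_poly2 // size_XaddC.
  have [lt|ge] := ltnP j n'; last first.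
    rewrite nth_default ?(leq_trans ssh) // cabs0 mulr_ge0 // addr_ge0 //.
    by rewrite sumr_ge0 // => i _; rewrite sumr_ge0 // => l _; apply: cabs_ge0.
  have -> : sh p = \sum_(i < n') p`_i *: ('X + a%:P) ^+ i.
    rewrite /sh comp_polyE (big_ord_widen n' (fun i => p`_i *: ('X + a%:P) ^+ i)) //.
    rewrite big_mkcond /=; apply: eq_bigr => i _.
    by case: ltnP => // h; rewrite nth_default // scale0r.
  rewrite coef_sum (le_trans (cabs_sum _ _ _)) // mulrDr mulr1 mulr_sumr.
  apply: (@le_trans _ _ (\sum_(i < n') d * \sum_(j0 < n') cabs (('X + a%:P) ^+ i)`_j0)).
    apply: ler_sum => i _; rewrite coefZ cabsM.
    apply: ler_pM; rewrite ?cabs_ge0 // (bigD1 (Ordinal lt)) //= lerDl.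
    by rewrite sumr_ge0 // => l _; apply: cabs_ge0.
  by rewrite lerDr.
have shP0 : sh P0 = 'X ^+ mu.+1 * sh Q0.
  by rewrite /sh /P0 rmorphM rmorphXn /= comp_polyB comp_polyX comp_polyC addrK.
pose c := cabs Q0.[a].
have c0 : 0 < c by rewrite cabs_gt0.
have shP0c : cabs (sh P0)`_mu.+1 = c.
  rewrite shP0 coefXnM ltnn subnn /sh -horner_coef0 horner_comp.
  by rewrite hornerD hornerX hornerC add0r.
have shP00 : (sh P0)`_0 = 0 by rewrite shP0 coefXnM.
pose b := 2 + (cabs a + 1).
have b1 : 1 <= b by rewrite /b; have := cabs_ge0 a; lra.
pose M := b ^+ n'.
have M0 : 0 < M by rewrite exprn_gt0 // (lt_le_trans ltr01).
(* The root [x] found below is within [k1] of [a]. The last bound makes the cost of dividing by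
   ['X - x%:P] in place of ['X - a%:P] at most [e / (2 * M)] per coefficient; [M] is the loss in
   [coef_divXsubC_bound]. *)
pose k1 := Num.min (Num.min k 1) (e / (2 * B * M)).
have k10 : 0 < k1.
  by rewrite !lt_min k0 ltr01 divr_gt0 // !mulr_gt0.
(* The three bounds give the other half of [e / M], keep coefficient [mu.+1] of the shifted
   polynomial above [c / 2], and make its constant coefficient small enough for [root_near0]. *)
pose d := Num.min (e / (2 * M)) (Num.min (c / (2 * K)) (c * k1 ^+ mu.+1 / (4 * 2 ^+ n' * K))).
have d0 : 0 < d.
  have kk : 0 < k1 ^+ mu.+1 by rewrite exprn_gt0.
  have nn : 0 < 2 ^+ n' :> R by rewrite exprn_gt0.
  rewrite !lt_min !divr_gt0 //; do ?[apply: mulr_gt0 => //].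

exists d => // Q sQ hQ.
have sQ' : (size Q <= n')%N by apply: leq_trans le_nn'.
have hsh j : cabs ((sh Q)`_j - (sh P0)`_j) <= d * K.
  rewrite -coefB -shB; apply: hK => //; last by move=> l; rewrite coefB.
    by rewrite (leq_trans (size_polyD _ _)) // size_polyN geq_max sQ' sP0.
  exact: ltW.
have dK1 : d * K <= c / 2.
  have : d <= c / (2 * K) by rewrite /d !ge_min lexx !orbT.
  by rewrite ler_pdivlMr ?mulr_gt0 //; lra.
have dK2 : 2 ^+ n' * (d * K) <= c * k1 ^+ mu.+1 / 4.
  have : d <= c * k1 ^+ mu.+1 / (4 * 2 ^+ n' * K) by rewrite /d !ge_min lexx !orbT.
  have kk : 0 < k1 ^+ mu.+1 by rewrite exprn_gt0.
  have nn : 0 < 2 ^+ n' :> R by rewrite exprn_gt0.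
  clear -c0 K0 kk nn; clearbody d; move: (2 ^+ n') nn (k1 ^+ mu.+1) kk => Y Y0 X X0.
  have -> : Y * (d * K) = d * (Y * K) by ring.
  have -> : c * X / 4 = c * X / (4 * Y * K) * (Y * K).
    by field; rewrite !gt_eqF.
  by apply: ler_wpM2r; rewrite mulr_ge0 // ltW.
have [w] : exists2 w, root (sh Q) w & cabs w < k1.
  apply: (@root_near0 (sh Q) n' k1 mu.+1 k10).
    by rewrite size_comp_poly2 ?size_XaddC // (leq_trans sQ').
  have h0 := hsh 0%N; rewrite shP00 subr0 in h0.
  have h1 := hsh mu.+1.
  have h2 : c / 2 <= cabs (sh Q)`_mu.+1.
    have := cabsBl (sh P0)`_mu.+1 (sh Q)`_mu.+1; rewrite shP0c [leRHS]cabsC. 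
    by move: h1 dK1; move: (cabs (_ - _)) (d * K) (cabs (sh Q)`_mu.+1) => x y z; clear; lra.
  apply: (@le_lt_trans _ _ (c * k1 ^+ mu.+1 / 4)).
    by apply: le_trans dK2; rewrite ler_pM2l ?exprn_gt0.
  have kk : 0 < k1 ^+ mu.+1 by rewrite exprn_gt0.
  apply: (@lt_le_trans _ _ (c / 2 * k1 ^+ mu.+1)); last by rewrite ler_pM2r.
  clear -c0 kk; clearbody c; move: (k1 ^+ mu.+1) kk => X X0.
  have := mulr_gt0 c0 X0; have -> : c / 2 * X = c * X / 2 by rewrite mulrAC.
  by move: (c * X); clear => y; lra.
rewrite /sh rootE horner_comp hornerD hornerX hornerC -rootE => rw wk.
pose x := w + a.
have [Q1 EQ1] := factor_theorem _ _ rw.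
have EQ : Q = ('X - x%:P) * Q1 by rewrite EQ1 mulrC.
have xa : cabs (x - a) < k1 by rewrite /x addrK.
have xb : 2 + cabs x <= b.
  rewrite /b lerD2l; have := cabsD w a; rewrite -/x.
  have : k1 <= 1 by rewrite /k1 !ge_min lexx orbT.
  by move: wk; clear; move: (cabs w) (cabs a) (cabs x) k1; clear => ? ? ? ?; lra.
have sQ1 : (size Q1 <= n)%N.
  have [Q10|Q10] := eqVneq Q1 0; first by rewrite Q10 size_poly0.
  by move: sQ; rewrite EQ size_XsubC_mul // => /ltnW.
have hQ1 : pclose e Q1 P1.
  move=> j; rewrite -coefB.
  have dd : ('X - x%:P) * (Q1 - P1) = (Q - P0) + (x - a)%:P * P1.
    rewrite mulrBr -EQ EP0 rmorphB /=; ring.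
  have bb j0 : cabs (('X - x%:P) * (Q1 - P1))`_j0 <= e / M.
    rewrite dd coefD coefCM (le_trans (cabsD _ _)) // cabsM coefB.
    have h1 : cabs (Q`_j0 - P0`_j0) <= e / (2 * M).
      by rewrite (le_trans (hQ j0)) // /d !ge_min lexx.
    have h2 : cabs (x - a) * cabs P1`_j0 <= e / (2 * B * M) * B.
      apply: ler_pM; rewrite ?cabs_ge0 // ltW // (lt_le_trans xa) //.
      by rewrite /k1 !ge_min lexx orbT.
    have -> : e / M = e / (2 * M) + e / (2 * B * M) * B.
      by field; rewrite !gt_eqF.
    exact: lerD.
  have sD : (size (Q1 - P1)%R <= n')%N.
    rewrite (leq_trans (size_polyD _ _)) // size_polyN geq_max (leq_trans sQ1) //=.
    have [P10|P10] := eqVneq P1 0; first by rewrite P10 size_poly0.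
    by move: sP0; rewrite EP0 size_XsubC_mul // => /ltnW.
  have := coef_divXsubC_bound sD _ bb j; rewrite divr_ge0 ?(ltW e0) ?(ltW M0) //.
  move=> /(_ isT) h; apply: (le_trans h).
  rewrite -[leRHS](divfK (lt0r_neq0 M0)) ler_wpM2l ?divr_ge0 ?(ltW e0) ?(ltW M0) //.
  by rewrite /M lerXn2r ?nnegrE // ?addr_ge0 ?cabs_ge0 ?(le_trans ler01).
have [s [Q2 [ss hs EQ12 sQ2 cQ2]]] := He Q1 sQ1 hQ1.
exists (x :: s), Q2; split=> //=; first by rewrite ss.
  rewrite hs andbT (lt_le_trans xa) // /k1 !ge_min lexx //.
by rewrite big_cons EQ EQ12 mulrA.
Qed.

(** In the disc of radius [r] only [a] can be a root of [Q0], so the cofactor [T] of its full power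
    is bounded below there by the distances from the disc to the other roots, and half of that bound
    survives deflation. The bound [m] later shows that [Q] has no further roots in the disc. *)
Lemma root_continuity n a Q0 (r k : R) : Q0 != 0 -> 0 < k -> 0 <= r ->
  (forall z, root Q0 z -> cabs (z - a) <= r -> z = a) ->
  exists e m : R, [/\ 0 < e, 0 < m & forall Q, (size Q <= n)%N -> pclose e Q Q0 ->
    exists s Q1, [/\ size s = mup a Q0, all (fun w => cabs (w - a) < k) s,
      Q = \prod_(w <- s) ('X - w%:P) * Q1 &
      forall z, cabs (z - a) <= r -> m <= cabs Q1.[z]]].
Proof.
move=> Q00 k0 r0 hr; set mu := mup a Q0.
have [T ET] : exists T, Q0 = ('X - a%:P) ^+ mu * T.
  have : ('X - a%:P) ^+ mu %| Q0 by rewrite -mup_geq.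
  by case/dvdpP => T ->; exists T; rewrite mulrC.
have T0 : T != 0 by apply: contraNneq Q00 => T0; rewrite ET T0 mulr0.
have Ta : T.[a] != 0.
  apply/negP => /factor_theorem[T' ET'].
  have : (mu.+1 <= mu)%N by rewrite {2}/mu mup_geq // ET ET' exprSr mulrCA dvdp_mull.
  by rewrite ltnn.
have [s ES] := closed_field_poly_normal T.
have hs w : w \in s -> r < cabs (w - a).
  move=> ws; rewrite ltNge; apply/negP => wr.
  have rw : root T w by rewrite ES rootZ ?lead_coef_eq0 // root_prod_XsubC.
  have wa : w = a by apply: hr => //; rewrite ET rootM rw orbT.
  by move: rw; rewrite wa rootE (negPf Ta).
pose m := cabs (lead_coef T) * \prod_(w <- s) (cabs (w - a) - r).
have m0 : 0 < m.
  rewrite mulr_gt0 ?cabs_gt0 ?lead_coef_eq0 // big_seq prodr_gt0 // => w ws.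
  by rewrite subr_gt0 hs.
have Tlow z : cabs (z - a) <= r -> m <= cabs T.[z].
  move=> zr; rewrite ES hornerZ cabsM ler_wpM2l ?cabs_ge0 //.
  rewrite horner_prod cabs_prod big_seq [leRHS]big_seq.
  apply: ler_prod => w ws; rewrite subr_ge0 ltW ?hs //= !hornerE.
  have := cabs_trans z w a; rewrite [cabs (w - z)]cabsC; lra.
clearbody m; pose n1 := maxn n (size T).
pose b := 1 + (cabs a + r).
have b1 : 1 <= b by rewrite /b lerDl addr_ge0 ?cabs_ge0.
pose M := n1.+1%:R * b ^+ n1.+1.
have M0 : 0 < M by rewrite mulr_gt0 ?ltr0Sn // exprn_gt0 // (lt_le_trans ltr01).
pose k1 := Num.min k (m / (2 * M)).
have k10 : 0 < k1 by rewrite lt_min k0 divr_gt0 // mulr_gt0.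
have [e e0 He] := roots_near_deflate n mu Ta k10.
exists e, (m / 2); split=> //; first by rewrite divr_gt0.
move=> Q sQ; rewrite {1}ET => hQ.
have [s1 [Q1 [ss1 hs1 EQ sQ1 cQ1]]] := He Q sQ hQ.
exists s1, Q1; split=> //.
  by apply: sub_all hs1 => w /lt_le_trans; apply; rewrite /k1 ge_min lexx.
move=> z zr; have := Tlow z zr.
suff : cabs (T.[z] - Q1.[z]) <= m / 2.
  by have := cabsBl T.[z] Q1.[z]; lra.
rewrite cabsC -hornerN -hornerD.
have k1M : k1 * M <= m / 2.
  have : k1 <= m / (2 * M) by rewrite /k1 ge_min lexx orbT.
  have M2 : 0 < 2 * M by rewrite mulr_gt0.
  rewrite (ler_pdivlMr _ _ M2) => h; rewrite ler_pdivlMr // (le_trans _ h) //.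
  by rewrite -mulrA [M * _]mulrC.
apply: le_trans k1M; rewrite /M mulrA; apply: horner_coef_bound => //.
- rewrite (leq_trans (size_polyD _ _)) // size_polyN geq_max.
  by rewrite (leq_trans sQ1) ?leqW ?leq_maxl ?leq_maxr.
- exact: ltW.
- rewrite /b -[z](subrK a) (le_trans (cabsD _ _)) //; lra.
- by move=> j; rewrite coefB.
Qed.

End RootContinuity.

(** * Evenly covered families *)

(** Stands in for Lebesgue numbers and subdivisions: the supremum of the right endpoints that can be
    reached from [a] is itself reached, and it cannot lie below [b]. Only short intervals that
    contain [x] have to be treated locally. *)
Lemma cousin (R : realType) (P : R -> R -> Prop) (a b : R) : a <= b ->
  (forall x, a <= x <= b -> exists2 d, 0 < d & forall u v, a <= u -> u <= x ->
     x <= v -> v <= b -> x - d < u -> v < x + d -> P u v) ->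
  (forall u v w, a <= u -> u <= v -> v <= w -> w <= b -> P u v -> P v w -> P u w) ->
  P a b.
Proof.
move=> ab loc cat.
pose A := [set x | a <= x <= b /\ P a x].
have Aa : A a.
  split; first by rewrite lexx.
  have [|d d0] := loc a; first by rewrite lexx.
  by apply; rewrite ?lexx //; lra.
have ubA : ubound A b by move=> x [/andP[]].
have supA : has_sup A by split; [exists a | exists b].
set s := sup A.
have as_ : a <= s by apply: ub_le_sup => //; exists b.
have sb : s <= b by apply: ge_sup => //; exists a.
have [|d d0 Hd] := loc s; first by rewrite as_.
have [x Ax sx] := sup_adherent d0 supA; rewrite -/s in sx.
have [/andP[ax xb] Pax] := Ax.
have xs : x <= s by apply: ub_le_sup => //; exists b.
pose v := Num.min b (s + d / 2).
have vb : v <= b by rewrite /v ge_min lexx.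
have sv : s <= v by rewrite /v le_min sb /=; lra.
have vd : v < s + d by rewrite /v gt_min; apply/orP; right; lra.
have Pxv : P x v by apply: Hd.
have Pav : P a v by apply: cat Pax Pxv => //; apply: le_trans sv.
have Av : A v by split => //; rewrite vb (le_trans as_).
have vs : v <= s by apply: ub_le_sup => //; exists b.
have [bd|db] := leP b (s + d / 2).
  by have <- : v = b by rewrite /v min_l.
by move: vs; rewrite /v min_r; [lra|exact: ltW].
Qed.

Section Covering.
Variable R : realType.
Local Notation C := R[i].

Definition contC (T : topologicalType) (X : set T) (f : T -> C) (p : T) :=
  forall e : R, 0 < e -> \forall q \near p, X q -> cabs (f q - f p) < e.

Lemma contCS (T : topologicalType) (X Y : set T) f p :
  Y `<=` X -> contC X f p -> contC Y f p.
Proof. by move=> YX h e e0; apply: filterS (h e e0) => q hq /YX. Qed.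

(* A fibre E q is evenly covered near p: every point of the fibre at p persists in a
   unique nearby point of the fibre at q, and no other points appear. *)
Definition cov_at (T : topologicalType) (E : T -> C -> Prop) (X : set T) (p : T) :=
  exists2 s : R, 0 < s & forall e, 0 < e -> e <= s -> \forall q \near p, X q ->
   [/\ forall z, E p z -> exists2 w, E q w & cabs (w - z) < e,
       forall w, E q w -> exists2 z, E p z & cabs (w - z) < e &
       forall z w w', E p z -> E q w -> E q w' -> cabs (w - z) < s ->
         cabs (w' - z) < s -> w = w'].

Lemma cov_atS (T : topologicalType) (E : T -> C -> Prop) (X Y : set T) p :
  Y `<=` X -> cov_at E X p -> cov_at E Y p.
Proof.
move=> YX [s s0 h]; exists s => // e e0 es.
by apply: filterS (h e e0 es) => q hq Yq; apply: hq; apply: YX.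
Qed.

Lemma within_nearP (T U : topologicalType) (X : set T) (f : T -> U) (p : T) (P : set U) :
  f @ within X (nbhs p) --> f p -> (\forall u \near f p, P u) ->
  \forall q \near p, X q -> P (f q).
Proof. by move=> h hP; have := h _ hP. Qed.

Lemma cov_at_pull (T T' : topologicalType) (E : T -> C -> Prop) (X : set T)
    (X' : set T') (g : T' -> T) p :
  (forall q, X' q -> X (g q)) -> g @ within X' (nbhs p) --> g p ->
  cov_at E X (g p) -> cov_at (fun q => E (g q)) X' p.
Proof.
move=> gX gc [s s0 h]; exists s => // e e0 es.
have h' := within_nearP gc (h e e0 es).
by apply: filterS h' => q hq X'q; apply: hq => //; apply: gX.
Qed.

Definition sec (T : topologicalType) (E : T -> C -> Prop) (A : set T) (f : T -> C) :=
  forall q, A q -> E q (f q) /\ contC A f q.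

Lemma secS (T : topologicalType) E (A B : set T) f : B `<=` A -> sec E A f -> sec E B f.
Proof. by move=> BA h q /BA/h[h1 h2]; split=> //; apply: contCS h2. Qed.

(** Triviality is expressed by sections through every point of the total space; that they are
    disjoint over a path-connected base is [sec_unique]. *)
Definition triv (T : topologicalType) (E : T -> C -> Prop) (A : set T) :=
  forall q w, A q -> E q w -> exists2 f, sec E A f & f q = w.

(** Agreement spreads because the fibre point close to a given one is unique, and disagreement
    spreads by continuity. *)
Lemma sec_loc_const (T : topologicalType) E (A : set T) f g p : A p ->
  cov_at E A p -> sec E A f -> sec E A g ->
  \forall q \near p, A q -> (f q = g q <-> f p = g p).
Proof.
move=> Ap [s s0 h] sf sg.
have [Ef cf] := sf _ Ap; have [Eg cg] := sg _ Ap.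
have [fg|fg] := pselect (f p = g p).
  near=> q => Aq; split=> // _.
  have [_ _] : [/\ forall z, E p z -> exists2 w, E q w & cabs (w - z) < s,
       forall w, E q w -> exists2 z, E p z & cabs (w - z) < s &
       forall z w w', E p z -> E q w -> E q w' -> cabs (w - z) < s ->
         cabs (w' - z) < s -> w = w'].
    move: Aq; near: q; exact: h.
  apply; [exact: Ef|by case: (sf _ Aq)|by case: (sg _ Aq)| |rewrite fg].
    by move: Aq; near: q; apply: cf.
  by move: Aq; near: q; apply: cg.
have e0 : 0 < cabs (f p - g p) / 2.
  by rewrite divr_gt0 // cabs_gt0 subr_eq0; apply/eqP.
near=> q => Aq; split=> // fgq; exfalso.
have h1 : cabs (f q - f p) < cabs (f p - g p) / 2.
  by move: Aq; near: q; apply: cf.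
have h2 : cabs (g q - g p) < cabs (f p - g p) / 2.
  by move: Aq; near: q; apply: cg.
have := cabs_trans (f q) (f p) (g p).
by move: h1 h2; rewrite -fgq [cabs (f q - f p)]cabsC; lra.
Unshelve. all: by end_near.
Qed.

Definition wpath (T : topologicalType) (A : set T) (g : R -> T) :=
  (forall x : R, 0 <= x <= 1 -> g @ within `[0, 1] (nbhs x) --> g x) /\
  (forall x : R, 0 <= x <= 1 -> A (g x)).

Lemma itv01 (x : R) : `[0, 1]%classic x = (0 <= x <= 1) :> Prop.
Proof. by rewrite /= in_itv. Qed.

Lemma loc_const_itv (f : R -> Prop) :
  (forall x : R, 0 <= x <= 1 -> \forall y \near x, 0 <= y <= 1 -> (f y <-> f x)) ->
  f 0 <-> f 1.
Proof.
move=> loc; apply: (@cousin R (fun a b => f a <-> f b)); rewrite ?ler01 //; last first.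
  by move=> u v w _ _ _ _ -> ->.
move=> x x01; have /nbhs_ballP[d /= d0 hd] := loc x x01.
move/andP: (x01) => [x0 x1].
exists d => // u v u0 ux xv v1 xu vx.
rewrite (hd u) ?(hd v) //.
- rewrite /ball /= ler0_norm; lra.
- lra.
- rewrite /ball /= ger0_norm; lra.
- lra.
Qed.

Lemma loc_const_path (T : topologicalType) (A : set T) (f : T -> Prop) g :
  (forall p, A p -> \forall q \near p, A q -> (f q <-> f p)) -> wpath A g ->
  f (g 0) <-> f (g 1).
Proof.
move=> loc [cg Ag]; apply: (@loc_const_itv (f \o g)) => x x01 /=.
have h' := within_nearP (cg x x01) (loc _ (Ag x x01)).
apply: filterS h' => y; rewrite itv01 => h y01; exact: h y01 (Ag _ y01).
Qed.

Definition pconn (T : topologicalType) (A : set T) :=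
  forall p q, A p -> A q -> exists g, [/\ wpath A g, g 0 = p & g 1 = q].

Lemma sec_unique (T : topologicalType) E (A : set T) f g p q :
  (forall p, A p -> cov_at E A p) -> pconn A -> sec E A f -> sec E A g ->
  A p -> A q -> f p = g p -> f q = g q.
Proof.
move=> cE cA sf sg Ap Aq; have [h [hA <- <-]] := cA p q Ap Aq.
rewrite (loc_const_path (f := fun q => f q = g q) _ hA) // => r Ar.
exact: sec_loc_const (cE _ Ar) _ _.
Qed.

(** The sheet through a point consists of the unique fibre points within [s] of some [z] over [p].
    One neighbourhood [N] serves all subsets [A], which lets rectangles and pieces of [S] be cut to
    size afterwards. *)
Lemma triv_local (T : topologicalType) E (X : set T) p :
  (forall p, X p -> cov_at E X p) -> X p ->
  exists2 N, nbhs p N & forall A, A `<=` X -> A `<=` N -> triv E A.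
Proof.
move=> cE Xp; have [s s0 h] := cE p Xp.
exists [set q | X q -> [/\ forall z, E p z -> exists2 w, E q w & cabs (w - z) < s,
       forall w, E q w -> exists2 z, E p z & cabs (w - z) < s &
       forall z w w', E p z -> E q w -> E q w' -> cabs (w - z) < s ->
         cabs (w' - z) < s -> w = w']]; first exact: h.
move=> A AX AN q w Aq Eqw.
have [_ /(_ w Eqw)[z Epz wz] _] := AN q Aq (AX q Aq).
pose f r := xget 0 [set u | E r u /\ cabs (u - z) < s].
have fP r : A r -> E r (f r) /\ cabs (f r - z) < s.
  move=> Ar; have [/(_ z Epz)[u Eu us] _ _] := AN r Ar (AX r Ar).
  by rewrite /f; case: xgetP => [v _ //|/(_ u)]; case.
have fU r u : A r -> E r u -> cabs (u - z) < s -> u = f r.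
  move=> Ar Eu us; have [_ _ U] := AN r Ar (AX r Ar).
  by have [Ef fs] := fP r Ar; apply: (U z).
exists f; last by rewrite -(fU q w).
move=> r Ar; have [Ef fs] := fP r Ar; split=> // e e0.
have [s' s'0 h'] := cE r (AX r Ar).
(* The last bound keeps the point found near [f r] within [s] of [z], where uniqueness identifies it
   with [f r']. *)
pose e' := Num.min (Num.min e s') (s - cabs (f r - z)).
have e'0 : 0 < e' by rewrite !lt_min e0 s'0 subr_gt0.
have e's' : e' <= s' by rewrite /e' !ge_min lexx orbT.
apply: filterS (h' _ e'0 e's') => r' hr' Ar'.
have [/(_ _ Ef)[u Eu us] _ _] := hr' (AX _ Ar').
have h1 : cabs (u - f r) < s - cabs (f r - z).
  by apply: lt_le_trans us _; rewrite /e' ge_min lexx orbT.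
rewrite -(fU r' u Ar' Eu); first by apply: lt_le_trans us _; rewrite /e' !ge_min lexx.
by have := cabs_trans (f r) u z; lra.
Qed.

(** The section over [A] fixes a value at a point [r] of the overlap, the section over [B] starts
    there, and connectedness of the overlap makes the two agree. Closedness of the pieces gives
    continuity: a point outside one piece has a neighbourhood that misses it. *)
Lemma triv_glue1 (T : topologicalType) E (A B : set T) :
  (forall p, (A `|` B) p -> cov_at E (A `|` B) p) -> closed A -> closed B ->
  A `&` B !=set0 -> pconn (A `&` B) -> triv E A -> triv E B ->
  forall q w, A q -> E q w -> exists2 f, sec E (A `|` B) f & f q = w.
Proof.
move=> cE clA clB [r [Ar Br]] cAB tA tB q w Aq Eqw.
have [f sf fq] := tA q w Aq Eqw.
have [Efr _] := sf r Ar.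
have [g sg gr] := tB r (f r) Br Efr.
have fg u : A u -> B u -> f u = g u.
  move=> Au Bu; apply: (@sec_unique _ E (A `&` B) f g r) => //.
  - by move=> p [Ap Bp]; apply: cov_atS (cE p _); [move=> x []; left|left].
  - by apply: secS sf => x [].
  - by apply: secS sg => x [].
pose h u := if `[< A u >] then f u else g u.
have hA u : A u -> h u = f u by move=> Au; rewrite /h asboolT.
have hB u : B u -> h u = g u.
  by move=> Bu; rewrite /h; case: asboolP => // Au; apply: fg.
exists h; last by rewrite hA.
have cA u : A u -> contC A h u.
  move=> Au e e0; have [_ c] := sf u Au; have := c e e0.
  by apply: filterS => v hv Av; rewrite !hA //; apply: hv.
have cB u : B u -> contC B h u.
  move=> Bu e e0; have [_ c] := sg u Bu; have := c e e0.
  by apply: filterS => v hv Bv; rewrite !hB //; apply: hv.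
have far (D : set T) u : closed D -> ~ D u -> \forall v \near u, ~ D v.
  by move=> cD Du; apply: open_nbhs_nbhs; split=> //; apply: closed_openC.
move=> u ABu; split.
  case: ABu => [Au|Bu]; [rewrite hA //; exact: (sf u Au).1|].
  by rewrite hB //; exact: (sg u Bu).1.
move=> e e0.
have nA : \forall v \near u, A v -> cabs (h v - h u) < e.
  have [Au|Au] := pselect (A u); first exact: cA.
  by apply: filterS (far A u clA Au).
have nB : \forall v \near u, B v -> cabs (h v - h u) < e.
  have [Bu|Bu] := pselect (B u); first exact: cB.
  by apply: filterS (far B u clB Bu).
by near=> v => -[]; near: v.
Unshelve. all: by end_near.
Qed.

Lemma triv_glue (T : topologicalType) E (A B : set T) :
  (forall p, (A `|` B) p -> cov_at E (A `|` B) p) -> closed A -> closed B ->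
  A `&` B !=set0 -> pconn (A `&` B) -> triv E A -> triv E B -> triv E (A `|` B).
Proof.
move=> cE clA clB n0 cAB tA tB q w [Aq|Bq] Eqw.
  exact: triv_glue1.
rewrite setUC; apply: triv_glue1 => //; first by rewrite setUC.
  by rewrite setIC.
by rewrite setIC.
Qed.

Definition rect (a b c d : R) : set (R * R) :=
  [set q | a <= q.1 <= b /\ c <= q.2 <= d].

Lemma closed_rect a b c d : closed (rect a b c d).
Proof.
have -> : rect a b c d = (fst @^-1` `[a, b]) `&` (snd @^-1` `[c, d]).
  by apply/seteqP; split=> -[x y]; rewrite /= !in_itv.
apply: closedI; apply: preimage_closed; do ?exact: interval_closed.
  by move=> x _; apply: cvg_fst.
by move=> x _; apply: cvg_snd.
Qed.

Lemma seg_cvg (p q : R * R) (x : R) :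
  (fun t : R => (p.1 + t * (q.1 - p.1), p.2 + t * (q.2 - p.2))) @ x
    --> (p.1 + x * (q.1 - p.1), p.2 + x * (q.2 - p.2)).
Proof.
have h (a b : R) : (fun t : R => a + t * b) @ x --> a + x * b.
  by apply: cvgD; [exact: cvg_cst | apply: cvgMr_tmp; exact: cvg_id].
exact: (cvg_pair (h _ _) (h _ _)).
Qed.

Lemma convex_between (a b x y t : R) : a <= x <= b -> a <= y <= b -> 0 <= t <= 1 ->
  a <= x + t * (y - x) <= b.
Proof. by move=> /andP[? ?] /andP[? ?] /andP[? ?]; apply/andP; split; nra. Qed.

Lemma pconn_rect a b c d : pconn (rect a b c d).
Proof.
move=> p q [p1 p2] [q1 q2].
exists (fun t : R => (p.1 + t * (q.1 - p.1), p.2 + t * (q.2 - p.2))); split.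
- split=> x x01; first by apply: cvg_within_filter; exact: seg_cvg.
  by split; apply: convex_between.
- by rewrite !mul0r !addr0; case: p {p1 p2}.
- by rewrite !mul1r ![_ + (_ - _)]addrC !subrK; case: q {q1 q2}.
Qed.

(** Two nested applications of [cousin]: boxes are glued horizontally into thin strips, and strips
    vertically into the rectangle. The overlaps are degenerate rectangles, hence path-connected. *)
Lemma triv_rect (E : R * R -> C -> Prop) a b c d : a <= b -> c <= d ->
  (forall p, rect a b c d p -> cov_at E (rect a b c d) p) -> triv E (rect a b c d).
Proof.
move=> ab cd cE.
have sub a' b' c' d' : a <= a' -> b' <= b -> c <= c' -> d' <= d ->
   rect a' b' c' d' `<=` rect a b c d.
  move=> ? ? ? ? q [/andP[? ?] /andP[? ?]]; split; apply/andP; split; lra.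
have glue A B a' b' c' d' : a <= a' -> b' <= b -> c <= c' -> d' <= d ->
   A `|` B = rect a' b' c' d' -> closed A -> closed B -> A `&` B !=set0 ->
   pconn (A `&` B) -> triv E A -> triv E B -> triv E (rect a' b' c' d').
  move=> h1 h2 h3 h4 AB *; rewrite -AB; apply: triv_glue => // p; rewrite AB => hp.
  by apply: cov_atS (cE p (sub _ _ _ _ h1 h2 h3 h4 _ hp)); apply: sub.
apply: (@cousin R (fun c' d' => triv E (rect a b c' d'))) => //; last first.
  move=> u v w cu uv vw wd; apply: (glue) => //; try exact: closed_rect.
  - apply/seteqP; split=> [q [] [? ?]|q [? /andP[? ?]]].
    + split=> //; lra.
    + split=> //; lra.
    + by have [?|?] := leP q.2 v; [left|right]; split=> //; apply/andP; split=> //; apply: ltW.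
  - exists (a, v); split; split=> /=; rewrite ?lexx ?ab ?uv ?vw //.
  - have -> : rect a b u v `&` rect a b v w = rect a b v v; last exact: pconn_rect.
    apply/seteqP; split=> [q [[? ?] [_ ?]]|q [? ?]].
      by split=> //; lra.
    by split; split=> //; lra.
move=> y /andP[cy yd].
(* The height of a strip must be common to all boxes in it, so the inner induction carries the
   half-height [e] along and takes minima. *)
suff [e e0 He] : exists2 e : R, 0 < e & forall u v, c <= u -> u <= y -> y <= v -> v <= d ->
    y - e < u -> v < y + e -> triv E (rect a b u v) by exists e.
apply: (@cousin R (fun a' b' => exists2 e : R, 0 < e & forall u v, c <= u -> u <= y ->
    y <= v -> v <= d -> y - e < u -> v < y + e -> triv E (rect a' b' u v))) => //.
  move=> x /andP[ax xb].
  have pxy : rect a b c d (x, y) by split; apply/andP.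
  have [N Np HN] := triv_local cE pxy.
  have [e /= e0 He] := (nbhs_ballP _ _).1 Np.
  exists e => // a' b' aa a'x xb' bb xa' b'x.
  exists e => // u v cu uy yv vd yu vy; apply: HN; first exact: sub.
  move=> q [/andP[? ?] /andP[? ?]]; apply: He; split; rewrite /ball /= ltr_norml; lra.
move=> a' b' c' aa' ab' bc' cb [e1 e10 H1] [e2 e20 H2].
exists (Num.min e1 e2); first by rewrite lt_min e10.
move=> u v cu uy yv vd yu vy.
have m1 : Num.min e1 e2 <= e1 by rewrite ge_min lexx.
have m2 : Num.min e1 e2 <= e2 by rewrite ge_min lexx orbT.
apply: (glue (rect a' b' u v) (rect b' c' u v)) => //; try exact: closed_rect.
- apply/seteqP; split=> [q [] [? ?]|q [/andP[? ?] ?]].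
  + split=> //; lra.
  + split=> //; lra.
  + by have [?|?] := leP q.1 b'; [left|right]; split=> //; apply/andP; split=> //; apply: ltW.
- exists (b', y); split; split=> /=; rewrite ?lexx ?ab' ?uy ?bc' ?yv //.
- have -> : rect a' b' u v `&` rect b' c' u v = rect b' b' u v; last exact: pconn_rect.
  apply/seteqP; split=> [q [[? ?] [? _]]|q [? ?]].
    by split=> //; lra.
  by split; split=> //; lra.
- apply: H1 => //; lra.
- apply: H2 => //; lra.
Qed.

End Covering.

(** * A maximum principle *)

Section TaylorBounds.
Variable R : realType.
Implicit Types (f df : R -> R) (c x : R).

(** Each use raises the order of vanishing by one; iterated from a crude bound on a derivative it
    produces the Taylor remainders below. *)
Lemma mvt_pow_bound f df c n : (forall x, is_derive x 1 f (df x)) -> f 0 = 0 ->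
  0 <= c -> (forall x, `|x| <= 1 -> `|df x| <= c * `|x| ^+ n) ->
  forall x, `|x| <= 1 -> `|f x| <= c * `|x| ^+ n.+1.
Proof.
move=> fdf f0 c0 dfb x x1.
have cf a b : {within `[a, b], continuous f}.
  apply: continuous_subspaceT => y.
  by apply: differentiable_continuous; apply/derivable1_diffP; case: (fdf y).
have key y : `|y| <= `|x| -> `|df y * x| <= c * `|x| ^+ n.+1.
  move=> yx; rewrite normrM exprSr mulrA ler_wpM2r // (le_trans (dfb _ _)) //.
    exact: le_trans x1.
  by rewrite ler_wpM2l // lerXn2r // nnegrE.
have [x0|x0] := leP 0 x.
  have [y] := MVT_segment x0 (fun y _ => fdf y) (cf 0 x).
  rewrite in_itv /= => /andP[y0 yx]; rewrite f0 !subr0 => ->; apply: key.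
  by rewrite !ger0_norm.
have [y] := MVT_segment (ltW x0) (fun y _ => fdf y) (cf x 0).
rewrite in_itv /= => /andP[xy y0]; rewrite f0 !sub0r => h.
rewrite -normrN h mulrN normrN; apply: key.
by rewrite !ler0_norm ?(ltW x0) // lerN2.
Qed.

Lemma expR_taylor2 : exists2 c : R, 0 <= c & forall x, `|x| <= 1 ->
  `|expR x - 1 - x - x ^+ 2 / 2| <= c * `|x| ^+ 3.
Proof.
exists (expR 1); first exact: expR_ge0.
have e0 := expR_ge0 (1 : R).
apply: (@mvt_pow_bound (fun x => expR x - 1 - x - x ^+ 2 / 2)
  (fun x => expR x - 1 - x)) => //.
- by move=> x; apply: is_derive_eq; rewrite /GRing.scale /=; field.
- by rewrite expR0; lra.
apply: (@mvt_pow_bound (fun x => expR x - 1 - x) (fun x => expR x - 1)) => //.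
- by move=> x; apply: is_derive_eq; lra.
- by rewrite expR0; lra.
apply: (@mvt_pow_bound (fun x => expR x - 1) expR) => //.
- by move=> x; apply: is_derive_eq; lra.
- by rewrite expR0; lra.
move=> x x1; rewrite expr0 mulr1 ger0_norm ?expR_ge0 // ler_expR.
by apply: le_trans x1; exact: ler_norm.
Qed.

Lemma sin_cos_taylor2 : (forall x : R, `|x| <= 1 -> `|sin x - x| <= `|x| ^+ 3) /\
  (forall x : R, `|x| <= 1 -> `|cos x - 1 + x ^+ 2 / 2| <= `|x| ^+ 3).
Proof.
have s1 x : `|x| <= 1 -> `|sin x| <= 1 * `|x| ^+ 1.
  apply: (@mvt_pow_bound sin cos); rewrite ?sin0 // => y y1.
  by rewrite expr0 mul1r ler_norml cos_geN1 cos_le1.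
have c2 x : `|x| <= 1 -> `|cos x - 1| <= 1 * `|x| ^+ 2.
  apply: (@mvt_pow_bound (fun x => cos x - 1) (fun x => - sin x)); rewrite ?cos0 ?subrr //.
    by move=> y; apply: is_derive_eq; lra.
  by move=> y y1; rewrite normrN s1.
have s3 x : `|x| <= 1 -> `|sin x - x| <= 1 * `|x| ^+ 3.
  apply: (@mvt_pow_bound (fun x => sin x - x) (fun x => cos x - 1)); rewrite ?sin0 ?subr0 //.
have c4 x : `|x| <= 1 -> `|cos x - 1 + x ^+ 2 / 2| <= 1 * `|x| ^+ 4.
  apply: (@mvt_pow_bound (fun x => cos x - 1 + x ^+ 2 / 2) (fun x => x - sin x)).
  - by move=> y; apply: is_derive_eq; rewrite /GRing.scale /=; field.
  - by rewrite cos0; lra.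
  - by [].
  - by move=> y y1; rewrite distrC s3.
split=> x x1; first by rewrite -[leRHS]mul1r s3.
rewrite (le_trans (c4 x x1)) // mul1r exprS ler_piMl ?exprn_ge0 //.
Qed.

End TaylorBounds.

Section MaximumPrinciple.
Variable R : realType.

Definition dirR (j : nat) (h : R) : R * R :=
  match j with 0 => (h, 0) | 1 => (0, h) | 2 => (- h, 0) | _ => (0, - h) end.

(* Sub-mean value property on crosses, up to o(h^2). *)
Definition submean (u : R * R -> R) (p : R * R) :=
  forall k, 0 < k -> exists2 d, 0 < d & forall h, 0 < h -> h < d ->
    - (k * h ^+ 2) <= \sum_(j < 4) u (p + dirR j h) - 4 * u p.

(** Adding [k] times the squared distance to a corner makes the sub-mean inequality strict, since
    its sum over a cross exceeds four times its value at the centre by [4 * k * h ^+ 2]. The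
    perturbed function then has no interior maximum. *)
Lemma max_principle (u : R * R -> R) (a b c d : R) : a < b -> c < d ->
  {within rect a b c d, continuous u} ->
  (forall q, rect a b c d q ->
     [\/ q.1 = a, q.1 = b, q.2 = c | q.2 = d] -> u q <= 0) ->
  (forall q, a < q.1 < b -> c < q.2 < d -> submean u q) ->
  forall q, rect a b c d q -> u q <= 0.
Proof.
move=> ab cd cu bu su q0 q0r; rewrite leNgt; apply/negP => uq0.
(* [D] exceeds the squared diameter, so the perturbation is at most half of [u q0]; at the maximum
   point [u] is still positive, which places that point in the interior. *)
pose D := (b - a) ^+ 2 + (d - c) ^+ 2 + 1.
have D0 : 0 < D by rewrite /D; nra.
pose k := u q0 / (2 * D).
have k0 : 0 < k by rewrite divr_gt0 // mulr_gt0.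
have kD : k * D = u q0 / 2 by rewrite /k; field; rewrite gt_eqF.
clearbody k; pose v q := u q + k * ((q.1 - a) * (q.1 - a) + (q.2 - c) * (q.2 - c)).
have cv : {within rect a b c d, continuous v}.
  move=> q; apply: cvgD; first exact: cu.
  apply: (@continuous_subspaceT _ _ (rect a b c d)
    (fun q : R * R => k * ((q.1 - a) * (q.1 - a) + (q.2 - c) * (q.2 - c)))) => {}q.
  have c1 : (fun q : R * R => q.1 - a) @ q --> q.1 - a.
    by apply: cvgB; [exact: cvg_fst | exact: cvg_cst].
  have c2 : (fun q : R * R => q.2 - c) @ q --> q.2 - c.
    by apply: cvgB; [exact: cvg_snd | exact: cvg_cst].
  by apply: cvgM; [exact: cvg_cst | apply: cvgD; apply: cvgM].
have crect : compact (rect a b c d).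
  have -> : rect a b c d = `[a, b] `*` `[c, d].
    by apply/seteqP; split=> -[x y]; rewrite /= !in_itv.
  by apply: compact_setX; apply: segment_compact.
have [q] := compact_EVT_max (ex_intro _ q0 q0r) crect cv.
rewrite inE => qr qmax.
have qM r : rect a b c d r -> v r <= v q by move=> rr; apply: qmax; rewrite inE.
have vq0 : u q0 <= v q.
  apply: le_trans (qM _ q0r); rewrite /v lerDl mulr_ge0 ?(ltW k0) //.
  by rewrite addr_ge0 // -expr2 sqr_ge0.
have [qa qc] := qr.
have vle : v q <= u q + u q0 / 2.
  rewrite /v lerD2l -kD ler_wpM2l ?(ltW k0) // /D.
  by move/andP: qa => [? ?]; move/andP: qc => [? ?]; nra.
have uq : 0 < u q by lra.
have nb : ~ [\/ q.1 = a, q.1 = b, q.2 = c | q.2 = d].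
  by move=> /(bu q qr); rewrite leNgt uq.
have h1 : a < q.1 < b.
  move/andP: qa => [h1 h2]; rewrite !lt_neqAle h1 h2 !andbT; apply/andP; split.
    by apply/eqP => e; apply: nb; constructor 1.
  by apply/eqP => e; apply: nb; constructor 2.
have h2 : c < q.2 < d.
  move/andP: qc => [h2 h3]; rewrite !lt_neqAle h2 h3 !andbT; apply/andP; split.
    by apply/eqP => e; apply: nb; constructor 3.
  by apply/eqP => e; apply: nb; constructor 4.
have [d' d'0 Hd'] := su q h1 h2 k k0.
move/andP: h1 => [h1 h1']; move/andP: h2 => [h2 h2'].
pose h := Num.min (d' / 2) (Num.min (Num.min (q.1 - a) (b - q.1)) (Num.min (q.2 - c) (d - q.2))).
have hh : [/\ h <= d' / 2, h <= q.1 - a, h <= b - q.1, h <= q.2 - c & h <= d - q.2].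
  by rewrite /h !ge_min !lexx ?orbT.
have h0 : 0 < h by rewrite /h !lt_min !subr_gt0 divr_gt0 // h1 h1' h2 h2'.
case: hh => hd ha hb hc hdd.
clearbody h; have hd' : h < d' by lra.
have := Hd' h h0 hd'.
have rr j : (j < 4)%N -> rect a b c d (q + dirR j h).
  by clear -h0 ha hb hc hdd h1 h1' h2 h2' => j4; do 4?[case: j j4 => [|j] j4 //=]; split=> /=; apply/andP; split; lra.
have r0 := qM _ (rr 0%N isT); have r1 := qM _ (rr 1%N isT).
have r2 := qM _ (rr 2%N isT); have r3 := qM _ (rr 3%N isT).
rewrite !big_ord_recl big_ord0 /= /bump /=.
move: r0 r1 r2 r3; rewrite /v /=.
move: (u (q + _)) (u (q + _)) (u (q + _)) (u (q + _)) (u q) => U0 U1 U2 U3 U.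
have : 0 < k * h ^+ 2 by rewrite mulr_gt0 // exprn_gt0.
clear; case: q => x y /=; rewrite !expr2; nra.
Qed.

End MaximumPrinciple.

(** * Holomorphy through Taylor polynomials *)

Section Jets.
Variable R : realType.
Local Notation C := R[i].
Implicit Types (f g : R * R -> C) (p w : R * R) (q r : {poly C}).

Definition toC w : C := Complex w.1 w.2.

Lemma cabs_le_ReIm (z : C) : cabs z <= `|complex.Re z| + `|complex.Im z|.
Proof.
rewrite -(@ler_pXn2r _ 2) ?nnegrE ?cabs_ge0 ?addr_ge0 // sqr_cabs sqrrD.
rewrite !real_normK ?num_real // addrAC lerDl mulrn_wge0 // mulr_ge0 //.
Qed.

Lemma toCB w p : toC (w - p) = toC w - toC p. Proof. by []. Qed.

Definition dirC (j : nat) (h : R) : C := toC (dirR j h).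

Lemma cabs_dirC j h : 0 < h -> cabs (dirC j h) = h.
Proof.
move=> h0; rewrite /dirC /toC.
suff : cabs (toC (dirR j h)) ^+ 2 = h ^+ 2.
  by move/eqP; rewrite eqrXn2 ?cabs_ge0 ?(ltW h0) // => /eqP.
by rewrite sqr_cabs; do 3?[case: j => [|j] /=]; rewrite ?expr0n /= ?addr0 ?add0r ?sqrrN.
Qed.

(* q is the Taylor polynomial of f at p, up to third order, along the four axis directions *)
Definition jet f p q := f p = q.[0] /\ exists B d : R, [/\ 0 <= B, 0 < d &
  forall j h, 0 < h -> h < d -> cabs (f (p + dirR j h) - q.[dirC j h]) <= B * h ^+ 3].

Lemma horner_bounded q : exists2 M : R, 0 <= M & forall z : C, cabs z <= 1 -> cabs q.[z] <= M.
Proof.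
have sM : 0 <= \sum_(i < size q) cabs q`_i.
  by rewrite sumr_ge0 // => i _; apply: cabs_ge0.
exists (\sum_(i < size q) cabs q`_i) => // z z1.
rewrite horner_coef (le_trans (cabs_sum _ _ _)) //; apply: ler_sum => i _.
by rewrite cabsM cabsX ler_piMr ?cabs_ge0 // exprn_ile1 ?cabs_ge0.
Qed.

Lemma jet_cst (a : C) p : jet (fun=> a) p a%:P.
Proof.
split; first by rewrite hornerC.
exists 0, 1; split=> // j h _ _; by rewrite hornerC subrr cabs0 mul0r.
Qed.

Lemma jet_id p : jet (fun w => toC (w - p)) p 'X.
Proof.
split; first by rewrite subrr hornerX.
exists 0, 1; split=> // j h _ _.
by rewrite hornerX [p + _]addrC addrK subrr cabs0 mul0r.
Qed.

Lemma jet_add f g p q r : jet f p q -> jet g p r -> jet (fun w => f w + g w) p (q + r).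
Proof.
move=> [f0 [B [d [B0 d0 H]]]] [g0 [B' [d' [B'0 d'0 H']]]].
split; first by rewrite hornerD f0 g0.
exists (B + B'), (Num.min d d'); split; rewrite ?addr_ge0 ?lt_min ?d0 //.
move=> j h h0; rewrite lt_min => /andP[hd hd'].
rewrite hornerD opprD addrACA (le_trans (cabsD _ _)) // mulrDl.
by rewrite lerD ?H ?H'.
Qed.

Lemma jet_mul f g p q r : jet f p q -> jet g p r -> jet (fun w => f w * g w) p (q * r).
Proof.
move=> [f0 [B [d [B0 d0 H]]]] [g0 [B' [d' [B'0 d'0 H']]]].
split; first by rewrite hornerM f0 g0.
have [M M0 HM] := horner_bounded q; have [M' M'0 HM'] := horner_bounded r.
exists (B * (M' + B') + M * B'), (Num.min 1 (Num.min d d')).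
split; rewrite ?addr_ge0 ?mulr_ge0 ?addr_ge0 ?lt_min ?d0 ?ltr01 //.
move=> j h h0; rewrite !lt_min => /and3P[h1 hd hd'].
rewrite hornerM; set K := dirC j h; set w := p + _.
have K1 : cabs K <= 1 by rewrite cabs_dirC ?ltW.
have e1 := H j h h0 hd; have e2 := H' j h h0 hd'.
have h3 : 0 <= h ^+ 3 by rewrite exprn_ge0 ?ltW.
have h31 : h ^+ 3 <= 1 by rewrite exprn_ile1 ?ltW.
have -> : f w * g w - q.[K] * r.[K] = (f w - q.[K]) * g w + q.[K] * (g w - r.[K]) by ring.
rewrite (le_trans (cabsD _ _)) // !cabsM mulrDl; apply: lerD.
  rewrite mulrAC; apply: ler_pM; rewrite ?cabs_ge0 //.
  rewrite -[g w](subrK r.[K]) (le_trans (cabsD _ _)) // addrC lerD ?HM' //.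
  by rewrite (le_trans e2) // ler_piMr.
rewrite -mulrA; apply: ler_pM; rewrite ?cabs_ge0 ?HM //.
Qed.

Lemma jet_ext f g p q : f =1 g -> jet f p q -> jet g p q.
Proof. by move=> /funext ->. Qed.

Lemma jet_poly f p q (c : {poly C}) : jet f p q -> jet (fun w => c.[f w]) p (c \Po q).
Proof.
move=> fq; elim/poly_ind: c => [|c a IH].
  by rewrite comp_poly0; apply: jet_ext (jet_cst 0 p) => w; rewrite horner0.
rewrite comp_poly_MXaddC.
apply: jet_ext (jet_add (jet_mul IH fq) (jet_cst a p)) => w.
by rewrite hornerMXaddC.
Qed.

Lemma jet_sum (I : Type) (s : seq I) (F : I -> R * R -> C) p (Q : I -> {poly C}) :
  (forall i, jet (F i) p (Q i)) ->
  jet (fun w => \sum_(i <- s) F i w) p (\sum_(i <- s) Q i).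
Proof.
move=> FQ; elim: s => [|i s IHs].
  by rewrite big_nil; apply: jet_ext (jet_cst 0 p) => w; rewrite big_nil.
rewrite big_cons; apply: jet_ext (jet_add (FQ i) IHs) => w.
by rewrite big_cons.
Qed.

(** Terms from ['X^3] on are of the size of the error and go into the constant [B]. *)
Lemma jet_trunc f p q s : jet f p (q + 'X^3 * s) -> jet f p q.
Proof.
move=> [f0 [B [d [B0 d0 H]]]]; have [M M0 HM] := horner_bounded s.
split; first by rewrite f0 hornerD hornerM hornerXn expr0n mul0r addr0.
exists (B + M), (Num.min 1 d); split; rewrite ?addr_ge0 ?lt_min ?d0 ?ltr01 //.
move=> j h h0; rewrite lt_min => /andP[h1 hd].
set K := dirC j h; have K1 : cabs K <= 1 by rewrite cabs_dirC ?ltW.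
have := H j h h0 hd; rewrite -/K hornerD hornerM hornerXn => e.
have -> : f (p + dirR j h) - q.[K] = f (p + dirR j h) - (q.[K] + K ^+ 3 * s.[K]) + K ^+ 3 * s.[K].
  by ring.
rewrite (le_trans (cabsD _ _)) // mulrDl lerD // cabsM cabsX cabs_dirC // mulrC.
by rewrite ler_wpM2r ?HM // exprn_ge0 ?ltW.
Qed.

Lemma jet_small f p s : jet f p ('X^3 * s) -> exists B d : R, [/\ 0 <= B, 0 < d &
  forall j h, 0 < h -> h < d -> cabs (f (p + dirR j h)) <= B * h ^+ 3].
Proof.
rewrite -['X^3 * s]add0r => /jet_trunc[_ [B [d [B0 d0 H]]]].
exists B, d; split=> // j h h0 hd; have := H j h h0 hd.
by rewrite horner0 subr0.
Qed.

Lemma jet_bounded f p q : jet f p q -> exists M d : R, [/\ 0 <= M, 0 < d &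
  forall j h, 0 < h -> h < d -> cabs (f (p + dirR j h) - f p) <= M * h].
Proof.
move=> [f0 [B [d [B0 d0 H]]]].
have /factor_theorem[s Es] : root (q - q.[0]%:P) 0.
  by rewrite rootE hornerD hornerN hornerC subrr.
rewrite subr0 in Es.
have Eq : q = s * 'X + q.[0]%:P by rewrite -Es subrK.
have [M M0 HM] := horner_bounded s.
exists (M + B), (Num.min 1 d); split; rewrite ?addr_ge0 ?lt_min ?d0 ?ltr01 //.
move=> j h h0; rewrite lt_min => /andP[h1 hd].
set K := dirC j h; have K1 : cabs K <= 1 by rewrite cabs_dirC ?ltW.
have := H j h h0 hd; rewrite -/K {1}Eq hornerMXaddC -f0 => e.
have -> : f (p + dirR j h) - f p = s.[K] * K + (f (p + dirR j h) - (s.[K] * K + f p)) by ring.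
rewrite (le_trans (cabsD _ _)) // mulrDl lerD //.
  by rewrite cabsM (cabs_dirC _ h0) ler_wpM2r ?HM // ltW.
rewrite (le_trans e) // ler_wpM2l // exprS ler_piMr ?(ltW h0) //.
by rewrite exprn_ile1 ?ltW.
Qed.

Lemma poly_inv_trunc q : q.[0] != 0 -> exists r s, q * r = 1 + 'X^3 * s.
Proof.
move=> q0; pose a := q.[0]^-1.
have /factor_theorem[s Es] : root (1 - q * a%:P) 0.
  by rewrite rootE hornerD hornerN hornerM !hornerC mulfV // subrr.
rewrite subr0 in Es; set u := s * 'X in Es.
(* geometric series: with q a = 1 - u one has q a (1 + u + u^2) = 1 - u^3 *)
exists (a%:P * (1 + u + u ^+ 2)), (- s ^+ 3).
have qa : q * a%:P = 1 - u by rewrite -Es; ring.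
rewrite mulrA qa /u; ring.
Qed.

(** The candidate inverts [q] modulo ['X^3], so [f] times it differs from 1 by [O(h^3)]; dividing by
    [f], whose modulus stays above half of [cabs (f p)], keeps that order. *)
Lemma jet_inv f p q : jet f p q -> f p != 0 -> exists r, jet (fun w => (f w)^-1) p r.
Proof.
move=> fq fp; have q0 : q.[0] != 0 by rewrite -fq.1.
have [r [s qr]] := poly_inv_trunc q0.
exists r; have fp0 : 0 < cabs (f p) by rewrite cabs_gt0.
have [M [d [M0 d0 HM]]] := jet_bounded fq.
have jj : jet (fun w => f w * r.[toC (w - p)] - 1) p ('X^3 * s).
  have -> : 'X^3 * s = q * r + (-1)%:P by rewrite qr polyCN; ring.
  have := jet_add (jet_mul fq (jet_poly r (jet_id p))) (jet_cst (-1) p).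
  by rewrite comp_polyXr.
have [B [d' [B0 d'0 HB]]] := jet_small jj.
split.
  have := congr1 (fun q : {poly C} => q.[0]) qr.
  rewrite hornerM hornerD hornerM hornerXn hornerC expr0n mul0r addr0 -fq.1.
  by move=> e; apply: (mulfI fp); rewrite e mulfV.
pose d1 := cabs (f p) / (2 * (M + 1)).
have M1 : 0 < 2 * (M + 1) by lra.
exists (B * (2 / cabs (f p))), (Num.min d1 (Num.min d d')).
split; rewrite ?mulr_ge0 ?invr_ge0 ?cabs_ge0 // ?lt_min ?d0 ?d'0 ?divr_gt0 //.
move=> j h h0; rewrite !lt_min => /and3P[h1 hd hd'].
have := HB j h h0 hd'; have := HM j h h0 hd.
set w := p + dirR j h.
have -> : toC (w - p) = dirC j h by rewrite /w [p + _]addrC addrK.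
set K := dirC j h => e1 e2.
have fw : cabs (f p) / 2 <= cabs (f w).
  have := cabsBl (f p) (f w); rewrite cabsC.
  have : M * h <= cabs (f p) / 2.
    move: h1; rewrite /d1 ltr_pdivlMr // => h1.
    have : 0 <= h by exact: ltW.
    move: h1; clear; nra.
  lra.
have fw0 : f w != 0 by rewrite -cabs_gt0 (lt_le_trans _ fw) // divr_gt0.
have -> : (f w)^-1 - r.[K] = - ((f w * r.[K] - 1) / f w) by field.
rewrite cabsN cabsM cabsV mulrAC; apply: ler_pM; rewrite ?cabs_ge0 ?invr_ge0 ?cabs_ge0 //.
by rewrite -[2 / _]invf_div lef_pV2 ?posrE ?divr_gt0 ?(lt_le_trans _ fw) ?divr_gt0.
Qed.

(** Parseval on the four directions, which are [h] times the fourth roots of unity: the mixed terms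
    of degrees 0, 1, 2 cancel because these degrees differ modulo 4. *)
Lemma parseval4 (a b c : C) (h : R) : 4 * cabs a ^+ 2 <=
  \sum_(j < 4) cabs (a + b * dirC j h + c * dirC j h ^+ 2) ^+ 2.
Proof.
rewrite !big_ord_recl big_ord0 /= /bump /= !sqr_cabs.
case: a b c => [a1 a2] [b1 b2] [c1 c2] /=; simpc => /=.
have := sqr_ge0 (b1 * h); have := sqr_ge0 (b2 * h).
have := sqr_ge0 (c1 * h ^+ 2); have := sqr_ge0 (c2 * h ^+ 2).
rewrite !expr2; clear; nra.
Qed.

(** After truncation at degree 2 the inequality is exact by [parseval4], and the remainder is of
    order [h^3], below any [k h^2]. This is why third-order accuracy is demanded in [jet]. *)
Lemma jet_submean f p q : jet f p q -> submean (fun w => cabs (f w) ^+ 2) p.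
Proof.
move=> fq.
have [q' [s [Eq sq]]] : exists q' s, q = q' + 'X^3 * s /\ (size q' <= 3)%N.
  exists (take_poly 3 q), (drop_poly 3 q); split; last exact: size_take_poly.
  by rewrite mulrC poly_take_drop.
move: fq; rewrite Eq => /jet_trunc fq {q s Eq}.
have [M M0 HM] := horner_bounded q'.
move: (fq) => [f0 [B [d [B0 d0 H]]]] k k0.
(* Each of the four directions loses at most [2 * (M * B) * h ^+ 3], which accounts for the factor
   8. *)
exists (Num.min 1 (Num.min d (k / (8 * (M * B) + 1)))).
  rewrite !lt_min d0 ltr01 divr_gt0 //.
  by have := mulr_ge0 M0 B0; lra.
move=> h h0; rewrite !lt_min => /and3P[h1 hd hk].
have e j : cabs q'.[dirC j h] ^+ 2 - 2 * (M * B) * h ^+ 3 <= cabs (f (p + dirR j h)) ^+ 2.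
  have h3 : 0 <= h ^+ 3 by rewrite exprn_ge0 ?ltW.
  have := H j h h0 hd; have := HM (dirC j h); rewrite cabs_dirC // => /(_ (ltW h1)).
  have := cabsBl q'.[dirC j h] (f (p + dirR j h)); rewrite cabsC.
  have := cabs_ge0 q'.[dirC j h]; have := cabs_ge0 (f (p + dirR j h)).
  move: (cabs (f _)) (cabs q'.[_]) (cabs (_ - _)) (h ^+ 3) h3 => X Y D T; clear -M0 B0.
  move=> T0 X0 Y0 YX YM DB.
  have YXB : Y - X <= B * T by lra.
  have BT : 0 <= B * T by rewrite mulr_ge0.
  have : Y * (B * T) <= M * (B * T) by rewrite ler_wpM2r.
  have [XY|/ltW YX'] := leP X Y; last by rewrite !expr2; nra.
  have : (Y - X) * (Y + X) <= (B * T) * (2 * Y).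
    by apply: ler_pM; lra.
  rewrite !expr2; nra.
have pars := parseval4 q'`_0 q'`_1 q'`_2 h.
have Eq z : q'.[z] = q'`_0 + q'`_1 * z + q'`_2 * z ^+ 2.
  rewrite (horner_coef_wide z sq) !big_ord_recl big_ord0 /= /bump /=.
  by rewrite expr0 mulr1 expr1 addr0 addrA.
have fp : cabs (f p) ^+ 2 = cabs q'`_0 ^+ 2 by rewrite f0 Eq expr0n !mulr0 !addr0.
have : \sum_(j < 4) (cabs q'.[dirC j h] ^+ 2 - 2 * (M * B) * h ^+ 3)
   <= \sum_(j < 4) cabs (f (p + dirR j h)) ^+ 2 by apply: ler_sum => j _; apply: e.
rewrite sumrB big_const_ord; have -> : \sum_(j < 4) cabs q'.[dirC j h] ^+ 2 =
   \sum_(j < 4) cabs (q'`_0 + q'`_1 * dirC j h + q'`_2 * dirC j h ^+ 2) ^+ 2.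
  by apply: eq_bigr => j _; rewrite Eq.
rewrite fp; move: pars.
have : 8 * (M * B) * h ^+ 3 <= k * h ^+ 2.
  have -> : 8 * (M * B) * h ^+ 3 = (8 * (M * B) * h) * h ^+ 2 by rewrite !exprS expr0; ring.
  apply: ler_wpM2r; first exact: sqr_ge0.
  move: hk; have MB := mulr_ge0 M0 B0; rewrite ltr_pdivlMr; last by lra.
  by move: h0 MB; move: (M * B); clear => T; nra.
rewrite /= addr0.
move: (\sum_(_ < _) _) (\sum_(_ < _) _) (cabs _ ^+ 2) (h ^+ 3) (h ^+ 2) (M * B); clear.
by move=> X Y Z T U V; nra.
Qed.

End Jets.

(** * Roots of families of polynomials with simple roots *)

Section RootFamilies.
Variable R : realType.
Local Notation C := R[i].
Implicit Types (p w : R * R) (z : C).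

Definition cexp w : C := Complex (expR w.1 * cos w.2) (expR w.1 * sin w.2).

Lemma cexpD w p : cexp (w + p) = cexp w * cexp p.
Proof.
rewrite /cexp /= expRD cosD sinD; simpc; congr (Complex _ _); ring.
Qed.

Lemma cabs_cexp w : cabs (cexp w) = expR w.1.
Proof.
apply/eqP; rewrite -(@eqrXn2 _ 2) ?cabs_ge0 ?expR_ge0 // sqr_cabs /= !exprMn -mulrDr.
by rewrite cos2Dsin2 mulr1.
Qed.

(** The addition formula moves the point to 0; there the real Taylor bounds of [expR], [sin] and
    [cos] are combined along the four directions. *)
Lemma jet_cexp p : exists q, jet cexp p q.
Proof.
suff [B [d [B0 d0 H]]] : exists B d : R, [/\ 0 <= B, 0 < d & forall j h, 0 < h -> h < d ->
    cabs (cexp (dirR j h) - (1%:P + 'X + (2^-1)%:P * 'X^2).[dirC j h]) <= B * h ^+ 3].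
  exists ((cexp p)%:P * (1%:P + 'X + (2^-1)%:P * 'X^2)); split.
    by rewrite hornerM !hornerD hornerM !hornerC hornerX hornerXn; ring.
  exists (cabs (cexp p) * B), d; split; rewrite ?mulr_ge0 ?cabs_ge0 // => j h h0 hd.
  rewrite cexpD hornerM hornerC -mulrBr cabsM -mulrA ler_wpM2l ?cabs_ge0 //.
  exact: H.
have [c c0 He] := expR_taylor2 R; have [Hs Hc] := sin_cos_taylor2 R.
exists (c + 2), 1; split; rewrite ?addr_ge0 // => j h h0 h1.
have h3 : 0 <= h ^+ 3 by rewrite exprn_ge0 // ltW.
have E z : (1%:P + 'X + (2^-1)%:P * 'X^2).[z] = 1 + z + z ^+ 2 / 2.
  by rewrite !hornerD hornerM !hornerC hornerX hornerXn mulrC.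
rewrite E (le_trans (cabs_le_ReIm _)) //.
have hn : `|h| <= 1 by rewrite gtr0_norm // ltW.
have hnN : `|- h| <= 1 by rewrite normrN.
have twoE : (2^-1 : C) = Complex 2^-1 0 
  by rewrite -[RHS]/((2^-1 : R)%:C)%C fmorphV /= rmorph_nat.
have e1 := He h hn; have e2 := He (- h) hnN.
have e3 := Hs h hn; have e4 := Hs (- h) hnN.
have e5 := Hc h hn; have e6 := Hc (- h) hnN.
rewrite normrN in e2 e4 e6; rewrite (gtr0_norm h0) in e1 e2 e3 e4 e5 e6.
rewrite twoE expr2; do 3?[case: j => [|j]]; rewrite /cexp /= ?cos0 ?sin0 ?expR0;
  rewrite ?(mulr0, mul0r, mulr1, mul1r, addr0, add0r, subr0, oppr0, normr0, sub0r);
  rewrite mulrDl.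
- rewrite -[h * h]expr2 !opprD !addrA.
  by have := mulr_ge0 c0 h3; lra.
- rewrite mulNr -[h * h]expr2 opprD opprK addrA.
  by have := mulr_ge0 c0 h3; lra.
- rewrite -[- h * - h]expr2 !opprD !addrA.
  by have := mulr_ge0 c0 h3; lra.
- rewrite mulNr -[- h * - h]expr2 opprD [- - (_ / 2)]opprK addrA.
  by have := mulr_ge0 c0 h3; lra.
Qed.

Lemma horner_taylor1 (A : comNzRingType) (P : {poly A}) (x h : A) :
  exists T, P.[x + h] = P.[x] + P^`().[x] * h + h ^+ 2 * T.
Proof.
elim/poly_ind: P => [|P a [T ET]].
  by exists 0; rewrite derivC !horner0 mulr0 mul0r !addr0.
exists (T * (x + h) + P^`().[x]).
rewrite derivD derivM derivX derivC !hornerE ET; ring.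
Qed.

Lemma horner_map0 (P : {poly {poly C}}) (r : {poly C}) :
  (P.[r]).[0] = (map_poly (horner_eval 0) P).[r.[0]].
Proof. by rewrite -[LHS]/(horner_eval 0 _) -horner_map. Qed.

(** Newton iteration with the derivative frozen at its value [d] at 0: each correction gains one
    power of ['X] in the residue. *)
Lemma hensel_jet (P : {poly {poly C}}) z :
  (P.[z%:P]).[0] = 0 -> (P^`().[z%:P]).[0] != 0 ->
  forall k, exists q, q.[0] = z /\ exists s, P.[q] = 'X^(k.+1) * s.
Proof.
move=> P0 P1; elim=> [|k [q [q0 [s Es]]]].
  exists z%:P; split; first by rewrite hornerC.
  have /factor_theorem[s ->] : root (P.[z%:P]) 0 by rewrite rootE P0.
  by exists s; rewrite subr0 expr1 mulrC.
set d := (P^`().[z%:P]).[0] in P1.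
have dq : (P^`().[q]).[0] = d.
  by rewrite /d !horner_map0 q0 hornerC.
have /factor_theorem[u Eu] : root (1 - (d^-1)%:P * P^`().[q]) 0.
  by rewrite rootE !hornerE dq mulVf ?subrr.
rewrite subr0 in Eu.
pose h : {poly C} := - ((d^-1)%:P * P.[q]).
have [T ET] := horner_taylor1 P q h.
exists (q + h); split.
  by rewrite hornerD /h Es hornerN !hornerM hornerXn expr0n /= mul0r mulr0 oppr0 addr0.
exists (s * u + 'X^k * ((d^-1)%:P ^+ 2 * s ^+ 2 * T)).
rewrite ET.
have -> : P.[q] + P^`().[q] * h = P.[q] * (u * 'X) by rewrite -Eu /h; ring.
by rewrite /h Es !exprS; ring.
Qed.

Definition simple_roots (Q : {poly C}) := forall z, root Q z -> Q^`().[z] != 0.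

Lemma mup_simple (Q : {poly C}) z : Q^`().[z] != 0 -> root Q z -> mup z Q = 1%N.
Proof.
move=> dQ rQ; have Q0 : Q != 0 by apply: contraNneq dQ => ->; rewrite derivC horner0.
apply/eqP; rewrite eqn_leq mup_geq // expr1 dvdp_XsubCl rQ andbT -ltnS.
rewrite mup_ltn //; apply/negP => /dvdpP[T ET]; move/negP: dQ; apply.
by rewrite ET expr2 mulrA derivM derivXsubC mulr1 hornerD !hornerM !hornerXsubC subrr !mulr0 addr0.
Qed.

Lemma simple_neq0 (Q : {poly C}) : simple_roots Q -> Q != 0.
Proof.
move=> sQ; apply/eqP => Q0; have := sQ 0; rewrite Q0 root0 derivC horner0 eqxx.
by move=> /(_ isT).
Qed.

Definition Fam n (c : nat -> {poly C}) (t : C) : {poly C} := \poly_(i < n) (c i).[t].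

Lemma size_Fam n c t : (size (Fam n c t) <= n)%N. Proof. exact: size_poly. Qed.

Lemma poly_continuous (c : {poly C}) z0 (e : R) : 0 < e ->
  exists2 d : R, 0 < d & forall z, cabs (z - z0) < d -> cabs (c.[z] - c.[z0]) < e.
Proof.
move=> e0; pose c' := c \Po ('X + z0%:P).
have Ec z : c.[z] = c'.[z - z0] by rewrite horner_comp !hornerE subrK.
have /factor_theorem[s Es] : root (c' - c'.[0]%:P) 0 by rewrite rootE !hornerE subrr.
have [M M0 HM] := horner_bounded s.
exists (Num.min 1 (e / (M + 1))); first by rewrite lt_min ltr01 divr_gt0 // ltr_wpDl.
move=> z; rewrite lt_min => /andP[z1 zd].
rewrite !Ec subrr -[c'.[0]](hornerC _ (z - z0)) -hornerN -hornerD Es subr0 hornerM hornerX.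
rewrite cabsM; have := HM _ (ltW z1).
have := cabs_ge0 (z - z0); have := cabs_ge0 s.[z - z0].
move: zd; rewrite ltr_pdivlMr; last lra.
by move: M0; clear; nra.
Qed.

Lemma Fam_continuous n c z0 (e : R) : 0 < e -> exists2 d : R, 0 < d &
  forall z, cabs (z - z0) < d -> pclose e (Fam n c z) (Fam n c z0).
Proof.
move=> e0; suff [d d0 H] : exists2 d : R, 0 < d & forall z, cabs (z - z0) < d ->
    forall i, (i < n)%N -> cabs ((c i).[z] - (c i).[z0]) < e.
  exists d => // z zd i; rewrite !coef_poly; case: ltnP => hi; first exact/ltW/H.
  by rewrite subrr cabs0 ltW.
elim: n => [|n [d d0 H]]; first by exists 1.
have [d' d'0 H'] := poly_continuous (c n) z0 e0.
exists (Num.min d d'); first by rewrite lt_min d0.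
move=> z; rewrite lt_min => /andP[zd zd'] i; rewrite ltnS leq_eqVlt => /orP[/eqP->|hi].
  exact: H'.
exact: H.
Qed.

Lemma jet_exp (f : R * R -> C) p (q : {poly C}) i : jet f p q -> jet (fun w => f w ^+ i) p (q ^+ i).
Proof.
move=> fq; have := jet_poly 'X^i fq; rewrite comp_Xn_poly.
by apply: jet_ext => w; rewrite hornerXn.
Qed.

(** An implicit function theorem at the level of jets. [hensel_jet] gives a [q] with residue
    [O(h^3)]; near [p] the polynomial is ['X - zeta] times a cofactor bounded below, so dividing the
    residue by that bound estimates [q - zeta]. *)
Lemma jet_root n c p (zeta : R * R -> C) :
  root (Fam n c (cexp p)) (zeta p) -> (Fam n c (cexp p))^`().[zeta p] != 0 ->
  (forall e, 0 < e -> exists2 d, 0 < d & forall j h, 0 < h -> h < d ->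
     root (Fam n c (cexp (p + dirR j h))) (zeta (p + dirR j h)) /\
     cabs (zeta (p + dirR j h) - zeta p) < e) ->
  exists q, jet zeta p q.
Proof.
set a := zeta p; set Q0 := Fam n c (cexp p) => ra da cz.
have [T jT] := jet_cexp p.
pose P : {poly {poly C}} := \poly_(i < n) (c i \Po T).
have mapP : map_poly (horner_eval 0) P = Q0.
  apply/polyP => i; rewrite coef_map !coef_poly.
  case: ifP => _; last by rewrite -[LHS]/((0 : {poly C}).[0]) horner0.
  by rewrite -[LHS]/((c i \Po T).[0]) horner_comp -jT.1.
have [||q [q0 [s Es]]] := @hensel_jet P a _ _ 2.
- by rewrite horner_map0 mapP hornerC; exact/eqP.
- by rewrite horner_map0 -deriv_map mapP hornerC.
have jG : jet (fun w => (Fam n c (cexp w)).[q.[toC (w - p)]]) p ('X^3 * s).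
  rewrite -Es horner_poly.
  have := jet_sum (index_enum 'I_n) (fun i => jet_mul (jet_poly (c i) jT)
     (jet_exp i (jet_poly q (jet_id p)))).
  rewrite comp_polyXr; apply: jet_ext => w; by rewrite horner_poly.
have [B [d [B0 d0 HB]]] := jet_small jG.
have Q00 : Q0 != 0 by apply: contraNneq da => ->; rewrite derivC horner0.
have [r [r0 Hr]] : exists r : R, 0 < r /\ forall z, root Q0 z -> cabs (z - a) <= r -> z = a.
  have [T' ET'] := factor_theorem _ _ ra.
  have T'a : T'.[a] != 0.
    move: da; rewrite ET' derivM derivXsubC mulr1 hornerD hornerM hornerXsubC subrr.
    by rewrite mulr0 add0r.
  have T'a0 : 0 < cabs T'.[a] by rewrite cabs_gt0.
  have [d1 d10 H1] := poly_continuous T' a T'a0.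
  exists (d1 / 2); split; first by rewrite divr_gt0.
  move=> z; rewrite rootE ET' hornerM hornerXsubC mulf_eq0 subr_eq0 => /orP[/eqP z0|/eqP //] zd.
  have := H1 z; rewrite z0 sub0r cabsN ltxx => H1'.
  by suff : false by []; apply: H1'; lra.
have [e [m [e0 m0 He]]] := @root_continuity _ n a Q0 r r Q00 r0 (ltW r0) Hr.
rewrite mup_simple // in He.
have [M [d1 [M0 d10 HM]]] := jet_bounded jT.
have [d2 d20 Hd2] := Fam_continuous n c (cexp p) e0.
have [d3 d30 Hd3] := cz r r0.
have [d4 d40 Hd4] := poly_continuous q 0 r0.
exists q; split=> //; exists (B / m), (Num.min (Num.min d d1) (Num.min (d2 / (M + 1)) (Num.min d3 d4))).
split; rewrite ?divr_ge0 ?(ltW m0) //.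
  by rewrite !lt_min d0 d10 d30 d40 divr_gt0 // ltr_wpDl.
move=> j h h0; rewrite !lt_min => /and3P[/andP[hd hd1] hd2 /andP[hd3 hd4]].
have := HB j h h0 hd; set w := p + _.
have -> : toC (w - p) = dirC j h by rewrite /w [p + _]addrC addrK.
set K := dirC j h.
have [rw zw] := Hd3 j h h0 hd3; rewrite -/w in rw zw.
have close : pclose e (Fam n c (cexp w)) Q0.
  apply: Hd2; apply: le_lt_trans (HM j h h0 hd1) _.
  move: hd2; rewrite ltr_pdivlMr; last lra.
  by move: h0 M0; clear; nra.
have [s1 [Q1 [ss1 hs1 EQ HQ1]]] := He _ (size_Fam n c _) close.
case: s1 ss1 hs1 EQ => [|x [|? ?]] //= _ /andP[xa _]; rewrite big_seq1 => EQ.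
have zx : zeta w = x.
  move: rw; rewrite EQ rootM root_XsubC => /orP[/eqP //|].
  rewrite rootE => /eqP Q1z; have := HQ1 (zeta w) (ltW zw).
  by rewrite Q1z cabs0 leNgt m0.
rewrite EQ hornerM hornerXsubC cabsM => e1.
have qr : cabs (q.[K] - a) <= r.
  rewrite -q0 ltW // Hd4 // subr0 cabs_dirC //.
rewrite zx cabsC mulrAC ler_pdivlMr //; apply: le_trans e1.
by rewrite ler_wpM2l ?cabs_ge0 // HQ1.
Qed.

Lemma prod_cabs_lt (s : seq C) (w : C) (e : R) : 0 < e ->
  \prod_(x <- s) cabs (w - x) < e ^+ size s -> exists2 x, x \in s & cabs (w - x) < e.
Proof.
move=> e0; case: (boolP (all (fun x => e <= cabs (w - x)) s)) => [/allP h|].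
  rewrite ltNge => /negP[]; elim: s h => [|x s IHs] h; first by rewrite big_nil.
  rewrite big_cons exprS ler_pM ?exprn_ge0 ?(ltW e0) //; first by rewrite h // mem_head.
  by apply: IHs => y ys; rewrite h // in_cons ys orbT.
by move=> /allPn[x xs]; rewrite -ltNge => xe _; exists x.
Qed.

Lemma seq_separated (s rs : seq C) : exists2 d : R, 0 < d &
  forall z w : C, z \in s -> w \in rs -> cabs (w - z) <= d -> w = z.
Proof.
elim: s => [|z s [d d0 H]]; first by exists 1.
suff [d' d'0 H'] : exists2 d : R, 0 < d & forall w : C, w \in rs -> cabs (w - z) <= d -> w = z.
  exists (Num.min d d'); first by rewrite lt_min d0.
  move=> x w; rewrite in_cons le_min => /orP[/eqP->|xs] wr /andP[? ?]; [exact: H'|exact: H].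
elim: rs {H} => [|w rs [d' d'0 H']]; first by exists 1.
have [->|wz] := eqVneq w z.
  exists d' => // x; rewrite in_cons => /orP[/eqP //|]; exact: H'.
have wz0 : 0 < cabs (w - z) by rewrite cabs_gt0 subr_eq0.
exists (Num.min d' (cabs (w - z) / 2)); first by rewrite lt_min d'0 divr_gt0.
move=> x; rewrite in_cons le_min => /orP[/eqP->|xr] /andP[h1 h2]; first by exfalso; lra.
exact: H'.
Qed.

Lemma near_seq (T : topologicalType) (I : eqType) (s : seq I) (P : I -> T -> Prop) (p : T) :
  (forall i, i \in s -> \forall q \near p, P i q) ->
  \forall q \near p, forall i, i \in s -> P i q.
Proof.
elim: s => [|i s IHs] H; first by apply: nearW.
have H1 := H i (mem_head _ _).
have H2 : \forall q \near p, forall i, i \in s -> P i q.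
  by apply: IHs => j js; apply: H; rewrite in_cons js orbT.
near=> q => j; rewrite in_cons => /orP[/eqP->|js]; first by near: q.
by move: j js; near: q.
Unshelve. all: by end_near.
Qed.

(** Exactly [k] roots, with multiplicity, in the disc of radius [rho]. The numbers [n], [rho], [m],
    [k] are shared by a whole family, and estimates that depend on them alone are uniform in it. *)
Definition loc_split (n : nat) (rho m : R) (k : nat) (Q : {poly C}) := (size Q <= n)%N /\
  exists s Q1, [/\ size s = k, all (fun w : C => cabs w < rho) s,
    Q = \prod_(w <- s) ('X - w%:P) * Q1 & forall z, cabs z <= rho -> m <= cabs Q1.[z]].

Lemma loc_split_mem n (rho m : R) k (Q : {poly C}) s Q1 : 0 < m ->
  Q = \prod_(w <- s) ('X - w%:P) * Q1 -> (forall z, cabs z <= rho -> m <= cabs Q1.[z]) ->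
  loc_split n rho m k Q -> forall z, cabs z <= rho -> root Q z = (z \in s).
Proof.
move=> m0 -> HQ1 _ z zr; rewrite rootM root_prod_XsubC orbC.
case: (boolP (root Q1 z)) => // /eqP Q1z; have := HQ1 z zr.
by rewrite Q1z cabs0 leNgt m0.
Qed.

(** At a root [w] of [P] the value of [Q] is small. It is also the product of the differences
    between [w] and the [k] roots of [Q] times a factor of modulus at least [m], so one of the
    distances is below [e]. The choice of [d] does not involve [Q]. *)
Lemma loc_split_near_unif n (rho m : R) k : 0 < m -> forall e, 0 < e ->
  exists2 d : R, 0 < d & forall (Q P : {poly C}) (w : C), loc_split n rho m k Q ->
    (size P <= n)%N -> pclose d P Q -> root P w -> cabs w < rho ->
    exists2 x, root Q x /\ cabs x < rho & cabs (w - x) < e.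
Proof.
move=> m0 e e0.
pose b := 1 + `|rho|; have b1 : 1 <= b by rewrite /b lerDl.
pose N := n.+1%:R * b ^+ n.+1; have N0 : 0 < N.
  by rewrite mulr_gt0 ?ltr0Sn // exprn_gt0 // (lt_le_trans ltr01).
exists (m * e ^+ k / (2 * N)).
  by apply: divr_gt0; apply: mulr_gt0 => //; apply: exprn_gt0.
move=> Q P w [sQ [s [Q1 [ss hs EQ HQ1]]]] sP PQ rw wr.
have b2 : cabs Q.[w] <= m * e ^+ k / 2.
  have -> : Q.[w] = - (P - Q).[w] by rewrite hornerD hornerN (eqP rw) add0r opprK.
  have -> : m * e ^+ k / 2 = m * e ^+ k / (2 * N) * n.+1%:R * b ^+ n.+1.
    rewrite -[RHS]mulrA -/N; clearbody N; move: (m * e ^+ k) => X.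
    by field; rewrite gt_eqF.
  rewrite cabsN; apply: horner_coef_bound => //.
  - rewrite (leq_trans (size_polyD _ _)) // size_polyN geq_max; by rewrite !leqW.
  - by apply/ltW/divr_gt0; apply: mulr_gt0 => //; apply: exprn_gt0.
  - by rewrite /b (le_trans (ltW wr)) // (le_trans (ler_norm _)) // lerDr.
  - by move=> j; rewrite coefB PQ.
have me : 0 < m * e ^+ k by rewrite mulr_gt0 ?exprn_gt0.
have : \prod_(x <- s) cabs (w - x) < e ^+ size s.
  rewrite ss -(ltr_pM2l m0); apply: (@le_lt_trans _ _ (m * e ^+ k / 2)); last by lra.
  apply: le_trans b2; rewrite EQ hornerM cabsM mulrC horner_prod cabs_prod.
  under [X in _ <= X * _]eq_bigr do rewrite hornerXsubC.
  rewrite ler_wpM2l ?HQ1 ?(ltW wr) //; apply: prodr_ge0 => i _; exact: cabs_ge0.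
move=> /(prod_cabs_lt e0)[x xs xe]; exists x => //; split; last exact: (allP hs).
by rewrite EQ rootM root_prod_XsubC xs.
Qed.

Lemma loc_split_near n (rho m : R) k (Q : {poly C}) : 0 < m -> loc_split n rho m k Q ->
  forall e, 0 < e -> exists2 d : R, 0 < d & forall (P : {poly C}) (w : C), (size P <= n)%N ->
    pclose d P Q -> root P w -> cabs w < rho ->
    exists2 x, root Q x /\ cabs x < rho & cabs (w - x) < e.
Proof.
move=> m0 lQ e e0; have [d d0 H] := loc_split_near_unif n rho k m0 e0.
by exists d => // P w; apply: H.
Qed.

(** Each root of [F p] in the disc has multiplicity one and persists by [root_continuity];
    [loc_split_near] excludes newcomers. The margin [d'] to the boundary keeps the persisting roots
    inside the disc. *)
Lemma cov_roots (T : topologicalType) (X : set T) (F : T -> {poly C}) n (rho m : R) k (p : T) :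
  X p -> 0 < m -> (forall q, (size (F q) <= n)%N) ->
  (forall e, 0 < e -> \forall q \near p, X q -> pclose e (F q) (F p)) ->
  simple_roots (F p) -> loc_split n rho m k (F p) ->
  cov_at (fun q z => root (F q) z /\ cabs z < rho) X p.
Proof.
move=> Xp m0 sF cF simp ls.
have [_ [s [Q1 [ss hs EQ HQ1]]]] := ls.
have Fp0 := simple_neq0 simp.
have [rs Ers] := closed_field_poly_normal (F p).
have [d d0 Hd] := seq_separated s rs.
have [d' d'0 Hd'] : exists2 d : R, 0 < d & forall z, z \in s -> d <= rho - cabs z.
  elim: s hs {ss EQ Hd} => [|z s IHs] /=; first by exists 1.
  move=> /andP[zr /IHs[d' d'0 H]].
  exists (Num.min d' (rho - cabs z)); first by rewrite lt_min d'0 subr_gt0.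
  move=> x; rewrite in_cons ge_min => /orP[/eqP->|/H ->] //; by rewrite lexx orbT.
have Eps z : cabs z < rho -> root (F p) z = (z \in s).
  by move=> /ltW; exact: (loc_split_mem m0 EQ HQ1 ls).
pose r := Num.min d d'; have r0 : 0 < r by rewrite lt_min d0.
have Hr z (w : C) : z \in s -> root (F p) w -> cabs (w - z) <= r -> w = z.
  move=> zs rw; rewrite le_min => /andP[wd _]; apply: Hd wd => //.
  by move: rw; rewrite Ers rootZ ?lead_coef_eq0 // root_prod_XsubC.
exists r => // e e0 er.
have H1 : \forall q \near p, forall z, z \in s -> X q -> exists x Q2,
   [/\ cabs (x - z) < e, F q = ('X - x%:P) * Q2 &
       forall w : C, cabs (w - z) <= r -> Q2.[w] != 0].
  apply: near_seq => z zs.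
  have rz : root (F p) z by rewrite Eps ?(allP hs).
  have [e' [m' [e'0 m'0 He']]] := @root_continuity _ n z (F p) r e Fp0 e0 (ltW r0)
    (fun w : C => Hr z w zs).
  rewrite mup_simple ?simp // in He'.
  apply: filterS (cF e' e'0) => q hq Xq.
  have [s2 [Q2 [ss2 hs2 EQ2 HQ2]]] := He' (F q) (sF q) (hq Xq).
  case: s2 ss2 hs2 EQ2 => [|x [|? ?]] //= _ /andP[xa _]; rewrite big_seq1 => EQ2.
  exists x, Q2; split=> // w wr.
  by rewrite -cabs_gt0 (lt_le_trans m'0) // HQ2.
have [d2 d20 H2] := loc_split_near m0 ls e0.
have H3 := cF _ d20.
near=> q => Xq; split.
- move=> z [rz zr]; have zs : z \in s by rewrite -Eps.
  have [x [Q2 [xz EF _]]] : exists x Q2, [/\ cabs (x - z) < e, F q = ('X - x%:P) * Q2 &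
       forall w : C, cabs (w - z) <= r -> Q2.[w] != 0].
    by move: z zs Xq {rz zr}; near: q.
  exists x => //; split; first by rewrite EF rootM root_XsubC eqxx.
  have := Hd' z zs; have := cabsD (x - z) z; rewrite subrK.
  have : r <= d' by rewrite /r ge_min lexx orbT.
  lra.
- move=> w [rw wr]; apply: (H2 (F q)) => //.
  by move: Xq; near: q.
- move=> z w w' [rz zr] [rw wr] [rw' wr'] wz wz'.
  have zs : z \in s by rewrite -Eps.
  have [x [Q2 [xz EF HQ2]]] : exists x Q2, [/\ cabs (x - z) < e, F q = ('X - x%:P) * Q2 &
       forall w : C, cabs (w - z) <= r -> Q2.[w] != 0].
    by move: z zs Xq {rz zr wz wz'}; near: q.
  have U (u : C) : root (F q) u -> cabs (u - z) < r -> u = x.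
    move=> ru uz; move: ru; rewrite EF rootM root_XsubC => /orP[/eqP //|].
    by rewrite rootE (negPf (HQ2 u (ltW uz))).
  by rewrite (U w) // (U w').
Unshelve. all: by end_near.
Qed.

Lemma cov_separated (T : topologicalType) (E : T -> C -> Prop) (K : set T) :
  compact K -> (forall p : T, K p -> cov_at E K p) ->
  exists2 d : R, 0 < d & forall (q : T) (z w : C), K q -> E q z -> E q w -> cabs (z - w) < d -> z = w.
Proof.
move=> cK cE.
have nc := (compact_near_coveringP K).1 cK.
pose P (d : R) (q : T) := K q -> forall z w : C, E q z -> E q w -> cabs (z - w) < d -> z = w.
have : \forall d \near (0 : R)^'+, K `<=` P d.
  apply: nc => p Kp; have [s s0 H] := cE p Kp.
  (* Points of a fibre closer than [s / 4] lie within [s / 4] of points over [p]; these are then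
     closer than [s], hence equal. *)
  have s40 : 0 < s / 4 by rewrite divr_gt0.
  have s4s : s / 4 <= s by lra.
  have Hs4 := H _ s40 s4s.
  have [_ _ U] := nbhs_singleton Hs4 Kp.
  have Up z z' : E p z -> E p z' -> cabs (z - z') < s -> z = z'.
    by move=> Ez Ez' zz'; apply: (U z') => //; rewrite subrr cabs0.
  have ds : \forall d \near (0 : R)^'+, d < s / 4 by apply: nbhs_right_lt.
  near=> q d => /= Kq z w Ez Ew zw.
  have : K q -> [/\ forall z, E p z -> exists2 w : C, E q w & cabs (w - z) < s / 4,
       forall w : C, E q w -> exists2 z, E p z & cabs (w - z) < s / 4 &
       forall z w w' : C, E p z -> E q w -> E q w' -> cabs (w - z) < s ->
         cabs (w' - z) < s -> w = w'] by near: q.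
  move=> /(_ Kq)[_ cl U'].
  have [z' Ez' zz'] := cl z Ez; have [w' Ew' ww'] := cl w Ew.
  have dd : d < s / 4 by near: d.
  have zw' : z' = w'.
    apply: Up => //; have := cabs_trans z z' w'; have := cabs_trans w z w'.
    rewrite [cabs (z' - z)]cabsC; lra.
  apply: (U' z') => //; first lra.
  rewrite zw'; lra.
move=> H; have [d /= d0 Hd] : exists2 d : R, 0 < d & K `<=` P d.
  near (0 : R)^'+ => d; exists d; first by near: d; exact: nbhs_right_gt.
  by near: d.
by exists d => // q z w Kq; apply: Hd.
Unshelve. all: by end_near.
Qed.

End RootFamilies.

(** * Pulling a family over a punctured disc back along the exponential *)

Section NoSplit.
Variable R : realType.
Local Notation C := R[i].

Lemma near_toC (p : R * R) (d : R) : 0 < d ->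
  \forall q \near p, cabs (toC q - toC p) < d.
Proof.
move=> d0; have d20 : 0 < d / 2 by rewrite divr_gt0.
apply/nbhs_ballP; exists (d / 2) => //= q [h1 h2].
rewrite /ball /= in h1 h2.
have := cabs_le_ReIm (toC q - toC p); rewrite -toCB /=.
rewrite [`|q.1 - _|]distrC [`|q.2 - _|]distrC; lra.
Qed.

Lemma near_dirR (p : R * R) (P : R * R -> Prop) : (\forall q \near p, P q) ->
  exists2 d, 0 < d & forall j h, 0 < h -> h < d -> P (p + dirR j h).
Proof.
move=> /nbhs_ballP[d /= d0 H]; exists d => // j h h0 hd; apply: H.
have hn : `|h| < d by rewrite gtr0_norm.
split; rewrite /ball /= opprD addNKr normrN; do 3?[case: j => [|j]] => //=;
  by rewrite ?normrN ?normr0.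
Qed.

(** [cexp] with values in [R * R], the index type of [fib]. *)
Definition ceR (w : R * R) : R * R := (expR w.1 * cos w.2, expR w.1 * sin w.2).

Lemma ceR_cvg p : ceR @ p --> ceR p.
Proof.
have h1 : (fun w : R * R => expR w.1) @ p --> expR p.1.
  by apply: cvg_comp; [exact: cvg_fst | exact: continuous_expR].
have h2 : (fun w : R * R => cos w.2) @ p --> cos p.2.
  by apply: cvg_comp; [exact: cvg_snd | exact: continuous_cos].
have h3 : (fun w : R * R => sin w.2) @ p --> sin p.2.
  by apply: cvg_comp; [exact: cvg_snd | exact: continuous_sin].
exact: (cvg_pair (cvgM h1 h2) (cvgM h1 h3)).
Qed.

Definition annulus (r e : R) : set (R * R) := [set t | r <= cabs (toC t) <= e].
Definition pdisc (e : R) : set (R * R) := [set t | 0 < cabs (toC t) <= e].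

Lemma compact_annulus r e : 0 <= r -> compact (annulus r e).
Proof.
move=> r0; have [e0|e0] := ltP e 0.
  have -> : annulus r e = set0; last exact: compact0.
  apply/seteqP; split=> // t [/andP[_ te]].
  by move: (cabs_ge0 (toC t)); rewrite leNgt (le_lt_trans te).
have sq : annulus r e = (fun t : R * R => t.1 * t.1 + t.2 * t.2) @^-1` `[r ^+ 2, e ^+ 2].
  apply/seteqP; split=> t; rewrite /annulus /= in_itv /= -!expr2.
    rewrite -[t.1 ^+ 2 + _](sqr_cabs (toC t)) => /andP[h1 h2].
    by rewrite !lerXn2r ?nnegrE ?cabs_ge0.
  rewrite -[t.1 ^+ 2 + _](sqr_cabs (toC t)).
  by rewrite !ler_pXn2r ?nnegrE ?cabs_ge0.
apply: (@subclosed_compact _ _ (`[- e, e] `*` `[- e, e])).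
- rewrite sq; apply: preimage_closed; last exact: interval_closed.
  move=> t _.
  by apply: cvgD; apply: cvgM; do ?[exact: cvg_fst | exact: cvg_snd].
- by apply: compact_setX; apply: segment_compact.
- move=> t /andP[_ te]; have := sqr_cabs (toC t) => /= E.
  have := cabs_ge0 (toC t) => c0.
  by split; rewrite /= in_itv /=; apply/andP; split; nra.
Qed.

Section Family.
Variables (n : nat) (c : nat -> {poly C}) (eps rho m : R) (k : nat).
Hypothesis m0 : 0 < m.
Hypothesis sc : forall t : C, 0 < cabs t <= eps -> simple_roots (Fam n c t).
Hypothesis lc : forall t : C, cabs t <= eps -> loc_split n rho m k (Fam n c t).

Definition fib (t : R * R) (z : C) := root (Fam n c (toC t)) z /\ cabs z < rho.

Lemma cov_fib t : pdisc eps t -> cov_at fib (pdisc eps) t.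
Proof.
move=> ht; have /andP[t0 te] := ht.
apply: (@cov_roots _ _ _ (fun t => Fam n c (toC t)) n rho m k) => //.
- by move=> q; apply: size_Fam.
- move=> e e0; have [d d0 Hd] := Fam_continuous n c (toC t) e0.
  by apply: filterS (near_toC t d0) => q hq _; apply: Hd.
- exact: sc.
- exact: lc.
Qed.

Lemma fib_separated r : 0 < r -> exists2 d : R, 0 < d &
  forall t z w, annulus r eps t -> fib t z -> fib t w -> cabs (z - w) < d -> z = w.
Proof.
move=> r0; apply: cov_separated; first exact/compact_annulus/ltW.
have sub : annulus r eps `<=` pdisc eps.
  by move=> t /andP[rt te]; apply/andP; split=> //; apply: lt_le_trans rt.
by move=> t rt; apply: (cov_atS sub); apply/cov_fib/sub.
Qed.

Lemma cov_fib_exp a b x y : expR b <= eps ->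
  forall p, rect a b x y p -> cov_at (fun w z => fib (ceR w) z) (rect a b x y) p.
Proof.
move=> be p hp.
have sub q : rect a b x y q -> pdisc eps (ceR q).
  move=> [/andP[_ qb] _]; rewrite /pdisc /= -[toC (ceR q)]/(cexp q) cabs_cexp expR_gt0 /=.
  by apply: le_trans be; rewrite ler_expR.
apply: (cov_at_pull (X := pdisc eps)) => //; last exact/cov_fib/sub.
apply: cvg_within_filter; exact: ceR_cvg.
Qed.

(** Sections are holomorphic: over the punctured disc the roots are simple, so continuity of [f] is
    enough for [jet_root]. *)
Lemma sec_jet a b x y f p : expR b <= eps ->
  sec (fun w z => fib (ceR w) z) (rect a b x y) f -> a < p.1 < b -> x < p.2 < y ->
  exists q, jet f p q.
Proof.
move=> be sf pab pxy.
have pr : rect a b x y p.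
  by split; [case/andP: pab | case/andP: pxy] => ? ?; rewrite !ltW.
have [[rf fr] cf] := sf p pr.
apply: (@jet_root _ n c p f) => //.
  have /andP[pa pb] := pab.
  apply: (sc _ rf); rewrite cabs_cexp expR_gt0 (le_trans _ be) // ler_expR ltW //.
move=> e e0.
have nr : \forall q \near p, rect a b x y q.
  have n1 : \forall u \near p.1, a < u < b.
    near=> u; apply/andP; split; near: u.
      by apply: lt_nbhsr; case/andP: pab.
    by apply: lt_nbhsl; case/andP: pab.
  have n2 : \forall u \near p.2, x < u < y.
    near=> u; apply/andP; split; near: u.
      by apply: lt_nbhsr; case/andP: pxy.
    by apply: lt_nbhsl; case/andP: pxy.
  exists ([set u | a < u < b], [set u | x < u < y]); first by split.
  move=> q [/= /andP[? ?] /andP[? ?]]; split; rewrite !ltW //.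
have : \forall q \near p, root (Fam n c (cexp q)) (f q) /\ cabs (f q - f p) < e.
  near=> q; have rq : rect a b x y q by near: q.
  split; first by have [[]] := sf q rq.
  by move: rq; near: q; apply: cf.
exact: near_dirR.
Unshelve. all: by end_near.
Qed.

End Family.

Lemma contC_sub (T : topologicalType) (X : set T) (f g : T -> C) p :
  contC X f p -> contC X g p -> contC X (fun q => f q - g q) p.
Proof.
move=> cf cg e e0; have e20 : 0 < e / 2 by rewrite divr_gt0.
near=> q => Xq.
have h1 : cabs (f q - f p) < e / 2 by move: Xq; near: q; apply: cf.
have h2 : cabs (g q - g p) < e / 2 by move: Xq; near: q; apply: cg.
have -> : f q - g q - (f p - g p) = (f q - f p) - (g q - g p) by ring.
by apply: le_lt_trans (cabsB _ _) _; lra.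
Unshelve. all: by end_near.
Qed.

Lemma contC_cabs (T : topologicalType) (X : set T) (f : T -> C) :
  (forall p, X p -> contC X f p) -> {within X, continuous (fun q => cabs (f q))}.
Proof.
move=> cf; apply/subspace_continuousP => p Xp.
apply/cvgrPdist_lt => e e0; have := cf p Xp e e0.
apply: filterS => q hq Xq; apply: le_lt_trans (hq Xq).
have h1 := cabsBl (f p) (f q); have h2 := cabsBl (f q) (f p).
rewrite cabsC in h1; rewrite -[leLHS]/(`|cabs (f p) - cabs (f q)|) ler_norml.
by apply/andP; split; lra.
Qed.

Lemma loc_const_pconn (T : topologicalType) (A : set T) (P : T -> Prop) p q :
  (forall p, A p -> \forall r \near p, A r -> (P r <-> P p)) -> pconn R A ->
  A p -> A q -> P p -> P q.
Proof.
move=> loc cA Ap Aq; have [g [gA <- <-]] := cA p q Ap Aq.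
by rewrite (loc_const_path loc gA).
Qed.

(* By connectedness: the distance never lies in [e, 2 e]. *)
Lemma stay_close (T : topologicalType) (A : set T) (f g : T -> C) (e : R) p q :
  0 < e -> (forall r, A r -> contC A f r) -> (forall r, A r -> contC A g r) ->
  (forall r, A r -> e <= cabs (f r - g r) -> 2 * e < cabs (f r - g r)) ->
  pconn R A -> A p -> A q -> cabs (f p - g p) < e -> cabs (f q - g q) < e.
Proof.
move=> e0 cf cg gap cA Ap Aq; apply: (loc_const_pconn (A := A) (P := fun r => cabs (f r - g r) < e) _ cA Ap Aq).
move=> r Ar; have c := contC_sub (cf r Ar) (cg r Ar).
have [h|h] := ltP (cabs (f r - g r)) e.
  have d0 : 0 < e - cabs (f r - g r) by rewrite subr_gt0.
  apply: filterS (c _ d0) => s hs As; split=> // _.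
  have := hs As; have := cabsBl (f s - g s) (f r - g r); lra.
have h2 := gap r Ar h.
apply: filterS (c _ e0) => s hs As; split=> //.
have := hs As; have := cabsBl (f r - g r) (f s - g s).
rewrite [cabs (f r - g r - _)]cabsC; lra.
Qed.

End NoSplit.

(** * Multiple roots do not split *)

Section NoSplitMain.
Variable R : realType.
Local Notation C := R[i].

Lemma submean_sub (u g : R * R -> R) p : submean u p ->
  (forall h, \sum_(j < 4) g (p + dirR j h) = 4 * g p) -> submean (fun w => u w - g w) p.
Proof.
move=> su hg k k0; have [d d0 H] := su k k0; exists d => // h h0 hd.
rewrite sumrB hg; have := H h h0 hd; lra.
Qed.

(** A harmonic majorant on the rectangle, with all three summands nonnegative there: the constant
    suffices on the right edge, the linear term equals [K] on the left one, and the last term is at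
    least [K] on the other two, where [w.2 * w.2 = L * L]. *)
Definition barrier (x0 A L K : R) (w : R * R) : R :=
  4^-1 + K / A * (x0 - w.1) + K / (L * L) * (w.2 * w.2 - (w.1 - x0) * (w.1 - x0) + A * A).

Lemma barrier_harmonic x0 A L K p h :
  \sum_(j < 4) barrier x0 A L K (p + dirR j h) = 4 * barrier x0 A L K p.
Proof.
rewrite !big_ord_recl big_ord0 /barrier /= /bump /=.
move: (K / A) (K / (L * L)); case: p => x y /= k l; ring.
Qed.

Lemma barrier_cvg x0 A L K p : barrier x0 A L K @ p --> barrier x0 A L K p.
Proof.
have c1 : (fun w : R * R => w.1) @ p --> p.1 by exact: cvg_fst.
have c2 : (fun w : R * R => w.2) @ p --> p.2 by exact: cvg_snd.
apply: cvgD; first apply: cvgD; try exact: cvg_cst.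
  by apply: cvgM; [exact: cvg_cst | apply: cvgB => //; exact: cvg_cst].
apply: cvgM; first exact: cvg_cst.
apply: cvgD; last exact: cvg_cst.
apply: cvgB; first exact: cvgM.
by apply: cvgM; apply: cvgB => //; exact: cvg_cst.
Qed.

(* If the gap |g| between two sections is a small fraction of the gap |f| near the left end
   while g is close to f on the right end, the maximum principle for g/f - 1 is violated. *)
Lemma barrier_argument (N D : R * R -> C) (x0 x1 A L K : R) :
  x1 <= x0 -> x0 - x1 < A -> 0 < L -> 0 < K ->
  8 * K * (x0 - x1) <= A -> 8 * K * (A * A) <= L * L ->
  let X := rect (x0 - A) x0 (- L) L in
  (forall p, X p -> contC X N p) -> (forall p, X p -> contC X D p) ->
  (forall p, X p -> D p != 0) ->
  (forall p, x0 - A < p.1 < x0 -> - L < p.2 < L -> exists q, jet (fun w => N w / D w) p q) ->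
  (forall p, X p -> cabs (N p / D p) ^+ 2 <= K) ->
  (forall p, X p -> p.1 = x0 -> cabs (N p / D p) ^+ 2 <= 4^-1) ->
  cabs (N (x1, 0) / D (x1, 0)) ^+ 2 <= 2^-1.
Proof.
move=> x10 xA L0 K0 HA HL X cN cD Dn0 jND bK bR.
have A0 : 0 < A by lra.
pose U w := cabs (N w / D w) ^+ 2 - barrier x0 A L K w.
have AA : 0 < A * A by rewrite mulr_gt0.
have LL : 0 < L * L by rewrite mulr_gt0.
have KA : 0 < K / A by rewrite divr_gt0.
have KL : 0 < K / (L * L) by rewrite divr_gt0.
have Xp : X (x1, 0) by split; rewrite /=; apply/andP; split; lra.
have cont : {within X, continuous U}.
  apply/subspace_continuousP => p Xp'.
  have cN' : (fun w => cabs (N w)) @ within X (nbhs p) --> cabs (N p).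
    by have /subspace_continuousP := contC_cabs cN; apply.
  have cD' : (fun w => cabs (D w)) @ within X (nbhs p) --> cabs (D p).
    by have /subspace_continuousP := contC_cabs cD; apply.
  have dp : cabs (D p) != 0 by rewrite cabs_eq0 Dn0.
  have cq : (fun w => cabs (N w) * (cabs (D w))^-1) @ within X (nbhs p)
      --> cabs (N p) * (cabs (D p))^-1 by apply: cvgM => //; apply: cvgV.
  have -> : U = (fun w => cabs (N w) * (cabs (D w))^-1 * (cabs (N w) * (cabs (D w))^-1)
       - barrier x0 A L K w).
    by apply/funext => w; rewrite /U cabsM cabsV expr2.
  apply: cvgB; first exact: cvgM.
  by apply: cvg_within_filter; exact: barrier_cvg.
have U0 : U (x1, 0) <= 0.
  apply: (max_principle (a := x0 - A) (b := x0) (c := - L) (d := L)) => //; try lra.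
  - move=> q Xq bq; have [/andP[q1 q2] /andP[q3 q4]] := Xq.
    rewrite /U subr_le0; have bKq := bK q Xq; have bRq := bR q Xq.
    have xs : (q.1 - x0) * (q.1 - x0) <= A * A by nra.
    have ys : 0 <= q.2 * q.2 by rewrite -expr2 sqr_ge0.
    have b0 : 0 <= K / A * (x0 - q.1) by rewrite mulr_ge0 ?(ltW KA) //; lra.
    have b1 : 0 <= K / (L * L) * (q.2 * q.2 - (q.1 - x0) * (q.1 - x0) + A * A).
      by rewrite mulr_ge0 ?(ltW KL) //; lra.
    rewrite /barrier; case: bq => E.
    + have : K / A * (x0 - q.1) = K by rewrite E; field; rewrite gt_eqF.
      by move: bKq b1; clear; lra.
    + by have := bRq E; move: b0 b1; clear; lra.
    + have : K <= K / (L * L) * (q.2 * q.2 - (q.1 - x0) * (q.1 - x0) + A * A).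
        rewrite -[leLHS](divfK (lt0r_neq0 LL)) ler_wpM2l ?(ltW KL) // E.
        by move: xs; clear; lra.
      by move: bKq b0; clear; lra.
    + have : K <= K / (L * L) * (q.2 * q.2 - (q.1 - x0) * (q.1 - x0) + A * A).
        rewrite -[leLHS](divfK (lt0r_neq0 LL)) ler_wpM2l ?(ltW KL) // E.
        by move: xs; clear; lra.
      by move: bKq b0; clear; lra.
  - move=> q q1 q2; have [j jq] := jND q q1 q2.
    apply: submean_sub; first exact: jet_submean jq.
    exact: barrier_harmonic.
move: U0; rewrite /U /barrier /= mul0r sub0r.
(* At [(x1, 0)] the barrier is at most 1/4 + 1/8 + 1/8, by the assumptions on [A] and [L]. *)
have h1 : K / A * (x0 - x1) <= 8^-1.
  rewrite mulrAC ler_pdivrMr //; move: HA; clear; lra.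
have h2 : K / (L * L) * (- ((x1 - x0) * (x1 - x0)) + A * A) <= 8^-1.
  rewrite mulrAC ler_pdivrMr //.
  have : 0 <= K * ((x1 - x0) * (x1 - x0)) by rewrite mulr_ge0 ?(ltW K0) // -expr2 sqr_ge0.
  move: HL; clear; lra.
move: h1 h2; clear; lra.
Qed.

Lemma Fam_near0 n (c' : nat -> {poly C}) (d : R) : 0 < d -> exists2 r : R, 0 < r &
  forall t, cabs t <= r -> pclose d (Fam n c' t) (Fam n c' 0).
Proof.
move=> d0; have [r r0 H] := Fam_continuous n c' 0 d0.
exists (r / 2); first by rewrite divr_gt0.
by move=> t tr; apply: H; rewrite subr0; lra.
Qed.

Lemma root_persists n c (eps rho m : R) k a (s : R) : 0 < eps -> 0 < rho -> 0 < m ->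
  (forall t : C, cabs t <= eps -> loc_split n rho m k (Fam n c t)) -> root (Fam n c 0) a -> cabs a < rho -> 0 < s ->
  exists2 r : R, 0 < r & forall t, cabs t <= r ->
    exists w, [/\ root (Fam n c t) w, cabs w < rho & cabs (w - a) < s].
Proof.
move=> eps0 rho0 m0 lc ra ar s0; set Q := Fam n c 0.
have Q0 : Q != 0.
  have le0 : cabs (0 : C) <= eps by rewrite cabs0 ltW.
  have [_ [l [Q1 [_ _ EQ HQ1]]]] := lc _ le0.
  apply/eqP => Q0; have := HQ1 0; rewrite cabs0 => /(_ (ltW rho0)).
  have : Q1 = 0.
    move/eqP: Q0; rewrite /Q EQ mulf_eq0 => /orP[|/eqP //].
    by rewrite (negPf (monic_neq0 (monic_prod_XsubC _ _ _))).
  by move=> ->; rewrite horner0 cabs0 leNgt m0.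
pose e := Num.min s (rho - cabs a).
have e0 : 0 < e by rewrite lt_min s0 subr_gt0.
(* Radius 0 makes isolation automatic; only the roots near [a] are wanted here. *)
have h0 z : root Q z -> cabs (z - a) <= 0 -> z = a.
  by move=> _; rewrite le_eqVlt ltNge cabs_ge0 orbF cabs_eq0 subr_eq0 => /eqP.
have [d [m' [d0 _ H]]] := @root_continuity _ n a Q 0 e Q0 e0 (lexx 0) h0.
have [r r0 Hr] := Fam_near0 n c d0.
exists r => // t tr.
have [l [Q1 [sl hl EQ _]]] := H _ (size_Fam n c t) (Hr t tr).
have : (0 < mup a Q)%N by rewrite -XsubC_dvd // dvdp_XsubCl.
rewrite -sl; case: l hl EQ {sl} => [//|w l] /= /andP[wa _] EQ _.
exists w; split.
- by rewrite EQ big_cons !rootM root_XsubC eqxx.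
- have : cabs (w - a) < rho - cabs a by apply: lt_le_trans wa _; rewrite ge_min lexx orbT.
  have := cabsBl w a; lra.
- by apply: lt_le_trans wa _; rewrite ge_min lexx.
Qed.

(** Here [c0] is the family over [p], whose roots in the disc merge at 0, and [c] the one over a
    nearby point. On the circle of radius [eps] distinct roots of [c0] are at least [8 * kap] apart
    and each root of [c] is within [kap] of one of them, at most one root for each, so the gaps of
    matched pairs nearly agree there. *)
Lemma no_split n c0 c (eps rho m kap : R) k : 0 < eps -> 0 < rho -> 0 < m -> 0 < kap ->
  (forall t : C, 0 < cabs t <= eps -> simple_roots (Fam n c0 t)) ->
  (forall t : C, 0 < cabs t <= eps -> simple_roots (Fam n c t)) ->
  (forall t : C, cabs t <= eps -> loc_split n rho m k (Fam n c0 t)) ->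
  (forall t : C, cabs t <= eps -> loc_split n rho m k (Fam n c t)) ->
  (forall z, cabs z < rho -> root (Fam n c0 0) z -> z = 0) ->
  (forall t z w, cabs (toC t) = eps -> fib n c0 rho t z -> fib n c0 rho t w ->
     cabs (z - w) < 8 * kap -> z = w) ->
  (forall t z, cabs (toC t) = eps -> fib n c rho t z ->
     exists2 g, fib n c0 rho t g & cabs (z - g) < kap) ->
  (forall t z w g, cabs (toC t) = eps -> fib n c rho t z -> fib n c rho t w ->
     fib n c0 rho t g -> cabs (z - g) < kap -> cabs (w - g) < kap -> z = w) ->
  forall a b, root (Fam n c 0) a -> root (Fam n c 0) b ->
  cabs a < rho -> cabs b < rho -> a = b.
Proof.
move=> eps0 rho0 m0 kap0 sc0 sc lc0 lc c00 sep0 match1 match2 a b ra rb ar br.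
apply/eqP; case: eqVneq => // ab; exfalso.
have D0 : 0 < cabs (a - b) by rewrite cabs_gt0 subr_eq0.
set D := cabs (a - b) in D0.
have le0 : cabs (0 : C) <= eps by rewrite cabs0 ltW.
have [_ [l [Q1 [_ _ EQ HQ1]]]] := lc _ le0.
have lP z : cabs z < rho -> root (Fam n c 0) z = (z \in l).
  by move=> /ltW; exact: (loc_split_mem m0 EQ HQ1 (lc _ le0)).
have [d d0 Hd] := seq_separated l l.
(* The bound [d / 4] prevents a section near one root of [Fam n c 0] from passing to another one;
   [D / 32] keeps the gap of [fa] and [fb] above [15 / 16 * D] at [(x1, 0)]. *)
pose s := Num.min (d / 4) (D / 32).
have s0 : 0 < s by rewrite lt_min !divr_gt0.
have sd : s <= d / 4 by rewrite /s ge_min lexx.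
have sD : s <= D / 32 by rewrite /s ge_min lexx orbT.
clearbody s.
have D320 : 0 < D / 32 by rewrite divr_gt0.
have [e1 e10 H1] := loc_split_near m0 (lc _ le0) s0.
have [e2 e20 H2] := loc_split_near m0 (lc0 _ le0) D320.
have [r1 r10 Hr1] := Fam_near0 n c e10.
have [r2 r20 Hr2] := Fam_near0 n c0 e20.
have [r3 r30 Hr3] := root_persists eps0 rho0 m0 lc ra ar s0.
have [r4 r40 Hr4] := root_persists eps0 rho0 m0 lc rb br s0.
pose r := Num.min (eps / 2) (Num.min (Num.min r1 r2) (Num.min r3 r4)).
have r0 : 0 < r by rewrite !lt_min r10 r20 r30 r40 divr_gt0.
have [rr1 rr2 rr3 rr4 rre] : [/\ r <= r1, r <= r2, r <= r3, r <= r4 & r <= eps / 2].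
  by rewrite /r !ge_min !lexx ?orbT.
clearbody r.
have near_c (t : R * R) z : cabs (toC t) <= r -> fib n c rho t z ->
    exists2 x, x \in l & cabs (z - x) < s.
  move=> tr [rz zr]; have [x [rx xr] zx] := H1 _ z (size_Fam n c _) (Hr1 _ (le_trans tr rr1)) rz zr.
  by exists x => //; rewrite -lP.
have near_c0 (t : R * R) z : cabs (toC t) <= r -> fib n c0 rho t z -> cabs z < D / 32.
  move=> tr [rz zr]; have [x [rx xr]] := H2 _ z (size_Fam n c0 _) (Hr2 _ (le_trans tr rr2)) rz zr.
  by rewrite (c00 _ xr rx) subr0.
have [sp sp0 Hsp] := fib_separated m0 sc lc r0.
(* A lower bound for the gap of [fa] and [fb] on the whole rectangle: [sp] where [cabs t] is at
   least [r], [D / 2] where it is at most [r]. *)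
pose md := Num.min sp (D / 2).
have md0 : 0 < md by rewrite lt_min sp0 divr_gt0.
have mdsp : md <= sp by rewrite /md ge_min lexx.
have mdD : md <= D / 2 by rewrite /md ge_min lexx orbT.
clearbody md.
(* The numerator [N] below has four terms of modulus less than [rho] and the denominator is at least
   [md], so this bounds the squared quotient. *)
pose K := (4 * rho / md) ^+ 2.
have K0 : 0 < K by rewrite exprn_gt0 // divr_gt0 // mulr_gt0.
pose x0 := ln eps; pose x1 := ln r.
have Ex0 : expR x0 = eps by rewrite /x0 lnK.
have Ex1 : expR x1 = r by rewrite /x1 lnK.
have x10 : x1 <= x0 by rewrite -ler_expR Ex0 Ex1; move: rre eps0; clear; lra.
clearbody x0 x1.
(* Large enough for the linear term of the barrier to be at most 1/8 at [x1]; [L] below does the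
   same for the quadratic one. *)
pose A := (8 * K + 1) * (x0 - x1) + 1.
have Kx : 0 <= K * (x0 - x1) by apply: mulr_ge0; [exact: ltW | rewrite subr_ge0].
have A0 : 0 < A by rewrite /A; move: Kx x10; clear; lra.
have xA : x0 - x1 < A by rewrite /A; move: Kx; clear; lra.
have HA : 8 * K * (x0 - x1) <= A by rewrite /A; move: x10; clear; lra.
clearbody A.
pose L := (8 * K + 1) * A.
have L0 : 0 < L by rewrite mulr_gt0 //; move: K0; clear; lra.
have HL : 8 * K * (A * A) <= L * L.
  have -> : L * L = (8 * K + 1) * (8 * K + 1) * (A * A) by rewrite /L; ring.
  rewrite ler_wpM2r ?mulr_ge0 ?(ltW A0) //; move: K0; clear; nra.
clearbody L.
pose X := rect (x0 - A) x0 (- L) L.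
have covc p : X p -> cov_at (fun w z => fib n c rho (ceR w) z) X p.
  by apply: (cov_fib_exp m0 sc lc); rewrite Ex0.
have covc0 p : X p -> cov_at (fun w z => fib n c0 rho (ceR w) z) X p.
  by apply: (cov_fib_exp m0 sc0 lc0); rewrite Ex0.
have cX : pconn R X by apply: pconn_rect.
have x0A : x0 - A <= x0 by move: A0; clear; lra.
have LL : - L <= L by move: L0; clear; lra.
have tc : triv (fun w z => fib n c rho (ceR w) z) X by apply: triv_rect.
have tc0 : triv (fun w z => fib n c0 rho (ceR w) z) X by apply: triv_rect.
have absE w : cabs (toC (ceR w)) = expR w.1 by exact: cabs_cexp.
have XL : X (x1, 0).
  by split; rewrite /=; apply/andP; split; move: x10 xA L0; clear; lra.
have XR : X (x0, 0).
  by split; rewrite /=; apply/andP; split; move: A0 L0; clear; lra.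
have absL : cabs (toC (ceR (x1, 0))) = r by rewrite absE.
have [za [rza zar zaa]] := Hr3 (toC (ceR (x1, 0))) (eq_ind_r (fun x => x <= r3) rr3 absL).
have [zb [rzb zbr zbb]] := Hr4 (toC (ceR (x1, 0))) (eq_ind_r (fun x => x <= r4) rr4 absL).
have [fa sfa faL] := tc (x1, 0) za XL (conj rza zar).
have [fb sfb fbL] := tc (x1, 0) zb XL (conj rzb zbr).
have zab : za <> zb.
  move=> E; move: zbb; rewrite -E => zab'.
  have := cabs_trans za a b; rewrite [cabs (a - za)]cabsC -/D.
  by move: zaa zab' sD D0; clear; lra.
have fab p : X p -> fa p <> fb p.
  by move=> Xp E; apply: zab; rewrite -faL -fbL; apply: (sec_unique covc cX sfa sfb Xp XL E).
(* on the right-hand side, the sections of c are matched with sections of c0 *)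
have absR p : p.1 = x0 -> cabs (toC (ceR p)) = eps by move=> E; rewrite absE E.
have [wa Ewa wfa] := match1 _ _ (absR (x0, 0) erefl) (sfa _ XR).1.
have [wb Ewb wfb] := match1 _ _ (absR (x0, 0) erefl) (sfb _ XR).1.
have [ga sga gaR] := tc0 (x0, 0) wa XR Ewa.
have [gb sgb gbR] := tc0 (x0, 0) wb XR Ewb.
have wab : wa <> wb.
  move=> E; apply: (fab _ XR); apply: (match2 _ _ _ _ (absR (x0, 0) erefl) (sfa _ XR).1 (sfb _ XR).1 Ewa) => //.
  by rewrite E.
have gab p : X p -> ga p <> gb p.
  by move=> Xp E; apply: wab; rewrite -gaR -gbR; apply: (sec_unique covc0 cX sga sgb Xp XR E).
pose XE := rect x0 x0 (- L) L.
have XEX : XE `<=` X.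
  by move=> q [/andP[h1 h2] h3]; split=> //; apply/andP; split; move: h1 h2 A0; clear; lra.
have XE1 q : XE q -> q.1 = x0 by move=> [/andP[? ?] _]; apply/eqP; rewrite eq_le; apply/andP.
have stay f g : sec (fun w z => fib n c rho (ceR w) z) X f ->
    sec (fun w z => fib n c0 rho (ceR w) z) X g -> cabs (f (x0, 0) - g (x0, 0)) < kap ->
    forall q, XE q -> cabs (f q - g q) < kap.
  move=> sf sg fg q XEq.
  have cf p : XE p -> contC XE f p by move=> Ep; exact: (secS XEX sf Ep).2.
  have cg p : XE p -> contC XE g p by move=> Ep; exact: (secS XEX sg Ep).2.
  apply: (stay_close kap0 cf cg _ (@pconn_rect _ _ _ _ _) _ XEq fg).
    move=> p Ep fgp; have [Ef _] := sf p (XEX _ Ep); have [Eg _] := sg p (XEX _ Ep).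
    have [w Ew fw] := match1 _ _ (absR p (XE1 p Ep)) Ef.
    have [h|h] := ltP (cabs (w - g p)) (8 * kap).
      by move: fgp; rewrite -(sep0 _ _ _ (absR p (XE1 p Ep)) Ew Eg h) leNgt fw.
    have := cabs_trans (f p) w (g p); rewrite [cabs (w - f p)]cabsC.
    by move: fw h kap0; clear; lra.
  by split; rewrite /= ?lexx //; apply/andP; split; move: L0; clear; lra.
(* on the left-hand side, fa stays near a and fb stays near b *)
pose XW := rect (x0 - A) x1 (- L) L.
have XWX : XW `<=` X.
  by move=> q [/andP[h1 h2] h3]; split=> //; apply/andP; split; move: h1 h2 x10; clear; lra.
have XWr q : XW q -> cabs (toC (ceR q)) <= r.
  by move=> [/andP[_ h] _]; rewrite absE -Ex1 ler_expR.
have XWL : XW (x1, 0).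
  by split; rewrite /=; apply/andP; split; move: xA L0; clear; lra.
have stayL f z q : root (Fam n c 0) z -> cabs z < rho ->
    sec (fun w z => fib n c rho (ceR w) z) X f -> cabs (f (x1, 0) - z) < s ->
    XW q -> cabs (f q - z) < s.
  move=> rz zr sf fz Wq.
  have cf p : XW p -> contC XW f p by move=> Wp; exact: (secS XWX sf Wp).2.
  have cz p : XW p -> contC XW (fun=> z) p.
    by move=> _ e e0; apply: (@filterE _ (nbhs p)) => u _; rewrite subrr cabs0.
  apply: (stay_close s0 cf cz _ (@pconn_rect _ _ _ _ _) XWL Wq fz) => p Wp fzp.
  have [x xl fx] := near_c _ _ (XWr p Wp) (sf p (XWX _ Wp)).1.
  have zl : z \in l by rewrite -lP.
  have [h|h] := leP (cabs (x - z)) d; first by move: fzp; rewrite -(Hd z x zl xl h) leNgt fx.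
  have := cabs_trans (f p) x z; rewrite [cabs (x - f p)]cabsC.
  by move: fx h sd d0; clear; lra.
have Dlow p : X p -> md <= cabs (fa p - fb p).
  move=> Xp; have [Efa _] := sfa p Xp; have [Efb _] := sfb p Xp.
  have [h|h] := leP p.1 x1.
    have Wp : XW p by case: Xp => /andP[? ?] ?; split=> //; apply/andP.
    have h1 := stayL fa a p ra ar sfa (eq_ind_r (fun x => cabs (x - a) < s) zaa faL) Wp.
    have h2 := stayL fb b p rb br sfb (eq_ind_r (fun x => cabs (x - b) < s) zbb fbL) Wp.
    have := cabs_trans (fa p) a b; have := cabs_trans (fb p) (fa p) b.
    rewrite -/D [cabs (a - fa p)]cabsC; move: h1 h2 sD mdD D0; clear; lra.
  rewrite leNgt; apply/negP => h'; apply: (fab p Xp).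
  apply: (Hsp (ceR p)) => //; last exact: lt_le_trans mdsp.
  rewrite /annulus /= absE -Ex1 -Ex0 !ler_expR (ltW h) /=.
  by case: Xp => /andP[].
have fr p f : X p -> sec (fun w z => fib n c rho (ceR w) z) X f -> cabs (f p) < rho.
  by move=> Xp /(_ p Xp)[[]].
have gr p g : X p -> sec (fun w z => fib n c0 rho (ceR w) z) X g -> cabs (g p) < rho.
  by move=> Xp /(_ p Xp)[[]].
pose DD w := fa w - fb w; pose N w := ga w - gb w - DD w.
have cDD p : X p -> contC X DD p.
  by move=> Xp; apply: contC_sub; [exact: (sfa p Xp).2 | exact: (sfb p Xp).2].
have cN p : X p -> contC X N p.
  move=> Xp; apply: contC_sub; last exact: cDD.
  by apply: contC_sub; [exact: (sga p Xp).2 | exact: (sgb p Xp).2].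
have DD0 p : X p -> DD p != 0 by move=> Xp; rewrite subr_eq0; apply/eqP/fab.
have dpos p : X p -> 0 < cabs (DD p) by move=> Xp; rewrite cabs_gt0 DD0.
have bound p : X p -> cabs (N p / DD p) ^+ 2 <= K.
  move=> Xp; rewrite cabsM cabsV /K lerXn2r ?nnegrE ?mulr_ge0 ?invr_ge0 ?cabs_ge0 ?(ltW rho0) ?(ltW md0) //.
  apply: ler_pM; rewrite ?invr_ge0 ?cabs_ge0 //; last first.
    by rewrite lef_pV2 ?posrE ?Dlow ?dpos.
  have := cabsB (ga p - gb p) (DD p); have := cabsB (ga p) (gb p).
  have := cabsB (fa p) (fb p); rewrite -/(DD p) -/(N p).
  have := fr p fa Xp sfa; have := fr p fb Xp sfb.
  have := gr p ga Xp sga; have := gr p gb Xp sgb.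
  clear; lra.
have boundR p : X p -> p.1 = x0 -> cabs (N p / DD p) ^+ 2 <= 4^-1.
  move=> Xp E; have Ep : XE p by case: Xp => [_ ?]; split=> //; rewrite E lexx.
  have h1 := stay fa ga sfa sga (eq_ind_r (fun x => cabs (fa (x0, 0) - x) < kap) wfa gaR) p Ep.
  have h2 := stay fb gb sfb sgb (eq_ind_r (fun x => cabs (fb (x0, 0) - x) < kap) wfb gbR) p Ep.
  have h3 : 8 * kap <= cabs (ga p - gb p).
    rewrite leNgt; apply/negP => h; apply: (gab p Xp).
    exact: (sep0 _ _ _ (absR p E) (sga p Xp).1 (sgb p Xp).1 h).
  (* On the right edge the quotient is at most [2 * kap / (6 * kap)], below 1/2. *)
  have hN : cabs (N p) <= 2 * kap.
    have -> : N p = (fb p - gb p) - (fa p - ga p) by rewrite /N /DD; ring.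
    by have := cabsB (fb p - gb p) (fa p - ga p); move: h1 h2; clear; lra.
  have hD : 6 * kap <= cabs (DD p).
    have := cabsBl (ga p - gb p) (DD p); rewrite -/(N p); move: h3 hN; clear; lra.
  have -> : 4^-1 = (2^-1) ^+ 2 :> R by rewrite expr2; field.
  rewrite cabsM cabsV lerXn2r ?nnegrE ?mulr_ge0 ?invr_ge0 ?cabs_ge0 //.
  rewrite ler_pdivrMr ?dpos //; move: hN hD kap0; clear; lra.
have jets p : x0 - A < p.1 < x0 -> - L < p.2 < L -> exists q, jet (fun w => N w / DD w) p q.
  move=> p1 p2; have Xp : X p.
    by split; [case/andP: p1 | case/andP: p2] => ? ?; rewrite !ltW.
  have e0 : expR x0 <= eps by rewrite Ex0.
  have [qa ja] := sec_jet sc e0 sfa p1 p2; have [qb jb] := sec_jet sc e0 sfb p1 p2.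
  have [qa' ja'] := sec_jet sc0 e0 sga p1 p2; have [qb' jb'] := sec_jet sc0 e0 sgb p1 p2.
  have jsub (f g : R * R -> C) q q' : jet f p q -> jet g p q' ->
      jet (fun w => f w - g w) p (q + (-1)%:P * q').
    move=> jf jg; apply: jet_ext (jet_add jf (jet_mul (jet_cst (-1) p) jg)) => w.
    by rewrite mulN1r.
  have jD := jsub _ _ _ _ ja jb.
  have [r' jr'] := jet_inv jD (DD0 p Xp).
  by have := jet_mul (jsub _ _ _ _ (jsub _ _ _ _ ja' jb') jD) jr'; eexists; eauto.
have := barrier_argument x10 xA L0 K0 HA HL cN cDD DD0 jets bound boundR.
have hga := near_c0 _ _ (XWr _ XWL) (sga _ XL).1.
have hgb := near_c0 _ _ (XWr _ XWL) (sgb _ XL).1.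
have hD : 15 / 16 * D <= cabs (DD (x1, 0)).
  rewrite /DD faL fbL; have := cabs_trans za a b; have := cabs_trans zb za b.
  rewrite -/D [cabs (a - za)]cabsC; move: zaa zbb sD; clear; lra.
(* Here [ga - gb] is at most [D / 16] in modulus while [fa - fb] is at least [15 / 16 * D], so
   [N / DD] is near -1; its squared modulus is at least 9/16, above the bound 1/2 of
   [barrier_argument]. *)
have hN : 3 / 4 * cabs (DD (x1, 0)) <= cabs (N (x1, 0)).
  have := cabsBl (DD (x1, 0)) (ga (x1, 0) - gb (x1, 0)); rewrite [leRHS]cabsC -[ga _ - gb _ - _]/(N (x1, 0)).
  have := cabsB (ga (x1, 0)) (gb (x1, 0)); move: hga hgb hD D0; clear; lra.
rewrite leNgt => /negP; apply.
have h34 : 3 / 4 <= cabs (N (x1, 0) / DD (x1, 0)).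
  by rewrite cabsM cabsV ler_pdivlMr ?dpos.
move: h34; move: (cabs _) => y; rewrite expr2; clear; nra.
Qed.

End NoSplitMain.

Section NonSplitting.
Variable R : realType.
Local Notation C := R[i].

Lemma simple_prod_uniq (s : seq C) (Q : {poly C}) :
  simple_roots (\prod_(w <- s) ('X - w%:P) * Q) -> uniq s.
Proof.
elim: s Q => [//|z s IHs] Q; rewrite big_cons /= => h.
apply/andP; split; last first.
  by apply: (IHs (('X - z%:P) * Q)); rewrite mulrCA -mulrA mulrCA mulrA in h *.
apply/negP => zs; have := h z; rewrite -mulrA rootM root_XsubC eqxx => /(_ isT)/negP; apply.
rewrite derivM derivXsubC mul1r hornerD !hornerM hornerXsubC subrr mul0r addr0.
have : root (\prod_(w <- s) ('X - w%:P)) z by rewrite root_prod_XsubC.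
by rewrite rootE => /eqP ->; rewrite mul0r.
Qed.

Lemma uniq_map_inj (T U : eqType) (f : T -> U) (s : seq T) :
  uniq (map f s) -> {in s &, injective f}.
Proof.
elim: s => [//|x s IHs] /= /andP[fx us] y z; rewrite !in_cons.
move=> /orP[/eqP->|ys] /orP[/eqP->|zs] //= E.
- by move: fx; rewrite E map_f.
- by move: fx; rewrite -E map_f.
- exact: IHs.
Qed.

(* Pigeonhole: a second point of s near g would leave a point of s0 unmatched. *)
Lemma match_inj (s s0 : seq C) (kap : R) : uniq s0 -> size s = size s0 -> 0 < kap ->
  (forall x y, x \in s0 -> y \in s0 -> cabs (x - y) < 8 * kap -> x = y) ->
  (forall z, z \in s -> exists2 x, x \in s0 & cabs (z - x) < kap) ->
  (forall x, x \in s0 -> exists2 z, z \in s & cabs (x - z) < kap) ->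
  forall z w g, z \in s -> w \in s -> g \in s0 -> cabs (z - g) < kap -> cabs (w - g) < kap ->
    z = w.
Proof.
move=> us0 ss kap0 sep m1 m2 z w g zs ws gs zg wg.
pose f z := xget 0 [set x | x \in s0 /\ cabs (z - x) < kap].
have fP u : u \in s -> f u \in s0 /\ cabs (u - f u) < kap.
  move=> us; have [x xs ux] := m1 u us.
  by rewrite /f; case: xgetP => [v _ //|/(_ x)]; case.
have fE u x : u \in s -> x \in s0 -> cabs (u - x) < kap -> f u = x.
  move=> us xs ux; have [fs fu] := fP u us; apply: sep => //.
  have := cabs_trans u (f u) x; rewrite [cabs (f u - u)]cabsC.
  by move: fu ux kap0; clear; lra.
have umap : uniq (map f s).
  apply: (leq_size_uniq us0); last by rewrite size_map ss.
  move=> x xs; have [u us xu] := m2 x xs; apply/mapP; exists u => //.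
  by rewrite (fE u x) // cabsC.
by apply: (uniq_map_inj umap) => //; rewrite (fE z g) // (fE w g).
Qed.

(** Closeness of coefficients keeps the number [k] of roots in the disc, and [no_split] makes them
    equal, so the multiplicity is [k] again. The freedom to shrink [rho] below [rho0] gives
    continuity of the root later on. *)
Theorem nonsplitting n (c0 : nat -> {poly C}) (eps : R) : 0 < eps ->
  (forall t : C, 0 < cabs t <= eps -> simple_roots (Fam n c0 t)) ->
  Fam n c0 0 != 0 -> root (Fam n c0 0) 0 ->
  exists2 rho0 : R, 0 < rho0 & forall rho, 0 < rho -> rho <= rho0 ->
  exists2 eta : R, 0 < eta & forall c : nat -> {poly C},
    (forall i t, (i < n)%N -> cabs t <= eps -> cabs ((c i).[t] - (c0 i).[t]) <= eta) ->
    (forall t : C, 0 < cabs t <= eps -> simple_roots (Fam n c t)) ->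
    exists z, [/\ cabs z < rho, root (Fam n c 0) z,
      mup z (Fam n c 0) = mup 0 (Fam n c0 0) &
      forall w, cabs w <= rho -> root (Fam n c 0) w -> w = z].
Proof.
move=> eps0 sc0 Q00 rQ0; set Q0 := Fam n c0 0 in Q00 rQ0 *.
have [rs Ers] := closed_field_poly_normal Q0.
have [rho0 rho00 Hrho] := seq_separated [:: 0] rs.
exists rho0 => // rho rho_0 rho_le.
have iso z : root Q0 z -> cabs (z - 0) <= rho -> z = 0.
  move=> rz zr; apply: (Hrho 0) => //; rewrite ?mem_head ?(le_trans zr) //.
  by move: rz; rewrite Ers rootZ ?lead_coef_eq0 // root_prod_XsubC.
have [e [m [e0 m0 He]]] := @root_continuity _ n 0 Q0 rho rho Q00 rho_0 (ltW rho_0) iso.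
set k := mup 0 Q0 in He *.
have k0 : (0 < k)%N by rewrite -XsubC_dvd // dvdp_XsubCl.
have ls (P : {poly C}) : (size P <= n)%N -> pclose e P Q0 -> loc_split n rho m k P.
  move=> sP cP; have [s [Q1 [ss hs EQ HQ1]]] := He P sP cP.
  split=> //; exists s, Q1; split=> //.
    by apply: sub_all hs => w; rewrite subr0.
  by move=> z zr; apply: HQ1; rewrite subr0.
have e20 : 0 < e / 2 by rewrite divr_gt0.
have [r r0 Hr] := Fam_near0 n c0 e20.
pose ep := Num.min eps r.
have ep0 : 0 < ep by rewrite lt_min eps0.
have epe : ep <= eps by rewrite ge_min lexx.
have epr : ep <= r by rewrite ge_min lexx orbT.
clearbody ep.
have sc0' t : 0 < cabs t <= ep -> simple_roots (Fam n c0 t).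
  by move=> /andP[t0 te]; apply: sc0; rewrite t0 (le_trans te).
have lc0 t : cabs t <= ep -> loc_split n rho m k (Fam n c0 t).
  move=> te; apply: ls; first exact: size_Fam.
  move=> j; apply: (le_trans (Hr t (le_trans te epr) j)).
  by move: e0; clear; lra.
have [d d0 Hd] := fib_separated m0 sc0' lc0 ep0.
(* The separation [d] on the circle becomes the [8 * kap] of [no_split]. *)
pose kap := d / 8; have kap0 : 0 < kap by rewrite divr_gt0.
have kapE : 8 * kap = d by rewrite /kap; field.
have [eta1 eta10 Heta] := loc_split_near_unif n rho k m0 kap0.
(* [e / 2] leaves the other half of [e] to the variation of the family in [t]; [eta1] matches roots
   within [kap]. *)
exists (Num.min (e / 2) eta1); first by rewrite lt_min e20.
move=> c cc0 sc.
have close t : cabs t <= ep -> pclose (Num.min (e / 2) eta1) (Fam n c t) (Fam n c0 t).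
  move=> te j; rewrite !coef_poly; case: ifP => hj.
    by apply: cc0 => //; apply: le_trans epe.
  by rewrite subrr cabs0 le_min ltW // ltW.
have close1 t : cabs t <= ep -> pclose eta1 (Fam n c t) (Fam n c0 t).
  by move=> te j; apply: le_trans (close t te j) _; rewrite ge_min lexx orbT.
have close1' t : cabs t <= ep -> pclose eta1 (Fam n c0 t) (Fam n c t).
  by move=> te j; rewrite cabsC close1.
have sc' t : 0 < cabs t <= ep -> simple_roots (Fam n c t).
  by move=> /andP[t0 te]; apply: sc; rewrite t0 (le_trans te).
have lc t : cabs t <= ep -> loc_split n rho m k (Fam n c t).
  move=> te; apply: ls; first exact: size_Fam.
  move=> j; have h1 := Hr t (le_trans te epr) j.
  have h2 : cabs ((Fam n c t)`_j - (Fam n c0 t)`_j) <= e / 2.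
    by apply: le_trans (close t te j) _; rewrite ge_min lexx.
  have := cabs_trans (Fam n c0 t)`_j (Fam n c t)`_j Q0`_j.
  by move: h1 h2; rewrite /Q0; clear; lra.
have le0 : cabs (0 : C) <= ep by rewrite cabs0 ltW.
have sep0 t z w : cabs (toC t) = ep -> fib n c0 rho t z -> fib n c0 rho t w ->
    cabs (z - w) < 8 * kap -> z = w.
  by move=> te hz hw; rewrite kapE; apply: (Hd t); rewrite /annulus /= ?te ?lexx.
have match1 t z : cabs (toC t) = ep -> fib n c rho t z ->
    exists2 g, fib n c0 rho t g & cabs (z - g) < kap.
  move=> te [rz zr]; have te' : cabs (toC t) <= ep by rewrite te.
  exact: Heta (lc0 _ te') (size_Fam n c _) (close1 _ te') rz zr.
have match1' t z : cabs (toC t) = ep -> fib n c0 rho t z ->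
    exists2 g, fib n c rho t g & cabs (z - g) < kap.
  move=> te [rz zr]; have te' : cabs (toC t) <= ep by rewrite te.
  exact: Heta (lc _ te') (size_Fam n c0 _) (close1' _ te') rz zr.
have match2 t z w g : cabs (toC t) = ep -> fib n c rho t z -> fib n c rho t w ->
    fib n c0 rho t g -> cabs (z - g) < kap -> cabs (w - g) < kap -> z = w.
  move=> te hz hw hg; have te' : cabs (toC t) <= ep by rewrite te.
  have [_ [s [Q1 [ss hs EQ HQ1]]]] := lc _ te'.
  have [_ [s0 [Q2 [ss0 hs0 EQ2 HQ2]]]] := lc0 _ te'.
  have t0 : 0 < cabs (toC t) <= ep by rewrite te lexx ep0.
  have us0 : uniq s0 by apply: (@simple_prod_uniq _ Q2); rewrite -EQ2; exact: sc0'.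
  have inS u : fib n c rho t u <-> u \in s.
    split=> [[ru ur]|us]; first by rewrite -(loc_split_mem m0 EQ HQ1 (lc _ te') (ltW ur)).
    have ur : cabs u < rho by exact: (allP hs).
    by split=> //; rewrite (loc_split_mem m0 EQ HQ1 (lc _ te') (ltW ur)).
  have inS0 u : fib n c0 rho t u <-> u \in s0.
    split=> [[ru ur]|us]; first by rewrite -(loc_split_mem m0 EQ2 HQ2 (lc0 _ te') (ltW ur)).
    have ur : cabs u < rho by exact: (allP hs0).
    by split=> //; rewrite (loc_split_mem m0 EQ2 HQ2 (lc0 _ te') (ltW ur)).
  apply: (@match_inj s s0 kap) => //; rewrite ?ss ?ss0 //; try by [apply/inS|apply/inS0].
  - by move=> x y /inS0 hx /inS0 hy; apply: sep0 te hx hy.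
  - by move=> u /inS hu; have [x /inS0 xs ux] := match1 t u te hu; exists x.
  - by move=> u /inS0 hu; have [x /inS xs ux] := match1' t u te hu; exists x.
have c00 z : cabs z < rho -> root (Fam n c0 0) z -> z = 0.
  by move=> zr rz; apply: iso => //; rewrite subr0 ltW.
have nos := no_split ep0 rho_0 m0 kap0 sc0' sc' lc0 lc c00 sep0 match1 match2.
have [_ [s [Q1 [ss hs EQ HQ1]]]] := lc _ le0.
have inS u : cabs u <= rho -> root (Fam n c 0) u = (u \in s).
  exact: (loc_split_mem m0 EQ HQ1 (lc _ le0)).
case: s ss hs EQ inS => [|z s] ss hs EQ inS; first by move: k0; rewrite -ss.
have [zr _] := andP hs.
have rz : root (Fam n c 0) z by rewrite inS ?mem_head // ltW.
have allz w : w \in z :: s -> w = z.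
  move=> ws; have wr : cabs w < rho by exact: (allP hs).
  by apply: nos => //; rewrite inS // ltW.
exists z; split=> //; last by move=> w wr; rewrite inS // => /allz.
have -> : Fam n c 0 = ('X - z%:P) ^+ k * Q1.
  rewrite EQ; congr (_ * _); rewrite -ss; elim: (z :: s) allz => [|w l IHl] h.
    by rewrite big_nil.
  rewrite big_cons exprS (h w (mem_head _ _)) IHl // => u ul.
  by apply: h; rewrite in_cons ul orbT.
rewrite mupMl; first by rewrite mup_XsubCX eqxx.
apply/negP; rewrite rootE => /eqP Q1z; have := HQ1 z (ltW zr).
by rewrite Q1z cabs0 leNgt m0.
Qed.

End NonSplitting.

(** * Binary forms and discriminants *)

Section Homogenization.
Variables (K : comNzRingType) (T : comAlgType K).
Implicit Types (A B : T) (p q U V : {poly K}).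

(* The binary form of degree d that dehomogenizes to p, evaluated at (A, B). *)
Definition bhom (d : nat) A B p : T := \sum_(k < d.+1) p`_k *: (A ^+ k * B ^+ (d - k)).

Lemma hom_sum (I : Type) (r : seq I) (F : I -> {poly K}) d A B :
  bhom d A B (\sum_(i <- r) F i) = \sum_(i <- r) bhom d A B (F i).
Proof.
rewrite /bhom exchange_big /=; apply: eq_bigr => k _.
by rewrite coef_sum scaler_suml.
Qed.

Lemma homZ d A B c p : bhom d A B (c *: p) = c *: bhom d A B p.
Proof. by rewrite /bhom scaler_sumr; apply: eq_bigr => k _; rewrite coefZ scalerA. Qed.

Lemma hom_Xn d A B k : (k <= d)%N -> bhom d A B 'X^k = A ^+ k * B ^+ (d - k).
Proof.
rewrite -ltnS => kd; rewrite /bhom (bigD1 (Ordinal kd)) //= coefXn eqxx scale1r big1 ?addr0 //.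
move=> i ik; rewrite coefXn; case: eqVneq => [e|_]; last by rewrite scale0r.
by move: ik; rewrite -val_eqE /= e eqxx.
Qed.

Lemma hom_mul a b A B p q : (size p <= a.+1)%N -> (size q <= b.+1)%N ->
  bhom (a + b) A B (p * q) = bhom a A B p * bhom b A B q.
Proof.
move=> sp sq.
have expand (r : {poly K}) n : (size r <= n)%N -> r = \sum_(i < n) r`_i *: 'X^i.
  move=> sr; rewrite -poly_def; apply/polyP => i; rewrite coef_poly.
  by case: ltnP => // ni; rewrite nth_default // (leq_trans sr).
rewrite {1}(expand p _ sp) {1}(expand q _ sq) mulr_suml hom_sum [RHS]mulr_suml.
apply: eq_bigr => i _; rewrite mulr_sumr hom_sum [RHS]mulr_sumr.
apply: eq_bigr => j _.
have ia : (i <= a)%N by rewrite -ltnS.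
have jb : (j <= b)%N by rewrite -ltnS.
rewrite -scalerAl -scalerAr scalerA -exprD homZ hom_Xn ?leq_add //.
rewrite -scalerAl -scalerAr scalerA; congr (_ *: _).
have -> : (a + b - (i + j))%N = ((a - i) + (b - j))%N by lia.
by rewrite !exprD; ring.
Qed.

Lemma size_exp_le2 U k : (size U <= 2)%N -> (size (U ^+ k)%R <= k.+1)%N.
Proof.
move=> sU; apply: leq_trans (size_poly_exp_leq _ _) _; rewrite ltnS.
by have := leq_mul (leqnn k) (_ : (size U).-1 <= 1)%N; rewrite muln1 mulnC; apply; case: (size U) sU => [|[|[]]].
Qed.

Lemma hom_exp k A B U : (size U <= 2)%N -> bhom k A B (U ^+ k) = bhom 1 A B U ^+ k.
Proof.
move=> sU; elim: k => [|k IHk].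
  by rewrite /bhom big_ord_recl big_ord0 !expr0 coef1 scale1r mulr1 addr0.
by rewrite !exprS -IHk -hom_mul // size_exp_le2.
Qed.

End Homogenization.

(** Substitution of linear forms commutes with homogenization. It serves to invert [mob] and to
    express lines in a chart. *)
Lemma hom_comp (K : comNzRingType) (T : comAlgType K) d (A B : T) (U V p : {poly K}) :
  (size U <= 2)%N -> (size V <= 2)%N ->
  bhom d A B (bhom d U V p) = bhom d (bhom 1 A B U) (bhom 1 A B V) p.
Proof.
move=> sU sV; rewrite {2}/bhom hom_sum [RHS]/bhom; apply: eq_bigr => k _.
rewrite homZ; congr (_ *: _).
have kd : (k <= d)%N by rewrite -ltnS.
have := hom_mul A B (size_exp_le2 k sU) (size_exp_le2 (d - k) sV).
by rewrite (subnKC kd) (hom_exp k A B sU) (hom_exp (d - k) A B sV).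
Qed.

Lemma hom1E (K : comNzRingType) (T : comAlgType K) (A B : T) (U : {poly K}) :
  bhom 1 A B U = U`_0 *: B + U`_1 *: A.
Proof.
by rewrite /bhom !big_ord_recl big_ord0 /= /bump /= !expr0 !expr1 mul1r mulr1 addr0.
Qed.

Section Reflection.
Variable K : comNzRingType.
Implicit Types (a b : K) (p q : {poly K}).

(* The substitution (u : v) -> (a - z b : b + z a) in a binary form, dehomogenized; it is an
   involution up to scaling. *)
Definition mob d a b p : {poly K} := bhom d (a%:P - b *: 'X) (b%:P + a *: 'X) p.

Lemma size_lin a b : (size (a%:P + b *: 'X)%R <= 2)%N.
Proof.
rewrite (leq_trans (size_polyD _ _)) // geq_max (leq_trans (size_polyC_leq1 _)) //.
by rewrite (leq_trans (size_scale_leq _ _)) // size_polyX.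
Qed.

Lemma size_linN a b : (size (a%:P - b *: 'X)%R <= 2)%N.
Proof. by rewrite -scaleNr size_lin. Qed.

Lemma size_mob d a b p : (size (mob d a b p) <= d.+1)%N.
Proof.
rewrite /mob /bhom (leq_trans (size_sum _ _ _)) //; apply/bigmax_leqP => k _.
have kd : (k <= d)%N by rewrite -ltnS.
rewrite (leq_trans (size_scale_leq _ _)) // (leq_trans (size_polyMleq _ _)) //.
have := size_exp_le2 k (size_linN a b); have := size_exp_le2 (d - k) (size_lin b a).
by move: (size _) (size _) => x y; lia.
Qed.

Lemma mobK d a b p : (size p <= d.+1)%N -> mob d a b (mob d a b p) = (a ^+ 2 + b ^+ 2) ^+ d *: p.
Proof.
move=> sp; rewrite {1}/mob hom_comp ?size_lin ?size_linN // !hom1E.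
rewrite !coefD !coefN !coefZ !coefC !coefX /=.
set s := a ^+ 2 + b ^+ 2.
have -> : (a - b * 0) *: (b%:P + a *: 'X) + (0 - b * 1) *: (a%:P - b *: 'X) = s%:P * 'X :> {poly K}.
  by rewrite -!mul_polyC /s; rewrite !(rmorphD, rmorphB, rmorphM, rmorphXn, rmorph0, rmorph1) /=; ring.
have -> : (b + a * 0) *: (b%:P + a *: 'X) + (0 + a * 1) *: (a%:P - b *: 'X) = s%:P :> {poly K}.
  by rewrite -!mul_polyC /s; rewrite !(rmorphD, rmorphB, rmorphM, rmorphXn, rmorph0, rmorph1) /=; ring.
have Ep : p = \sum_(k < d.+1) p`_k *: 'X^k.
  rewrite -poly_def; apply/polyP => i; rewrite coef_poly.
  by case: ltnP => // ni; rewrite nth_default // (leq_trans sp).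
rewrite [X in _ = _ *: X]Ep /bhom scaler_sumr; apply: eq_bigr => k _.
have kd : (k <= d)%N by rewrite -ltnS.
rewrite exprMn mulrAC -exprD subnKC // -rmorphXn /= mul_polyC !scalerA mulrC //.
Qed.

Lemma mob_mul c d a b p q : (size p <= c.+1)%N -> (size q <= d.+1)%N ->
  mob (c + d) a b (p * q) = mob c a b p * mob d a b q.
Proof. exact: hom_mul. Qed.

Lemma horner_mob d a b p z : (mob d a b p).[z] = bhom d (a - b * z : K^o) (b + a * z : K^o) p.
Proof.
rewrite /mob /bhom horner_sum; apply: eq_bigr => k _.
by rewrite hornerZ hornerM !horner_exp !hornerD hornerN !hornerZ !hornerC hornerX.
Qed.

End Reflection.

(** * Discriminants for a formal degree *)

Section FormalResultant.
Variable F : fieldType.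
Implicit Types (p q : {poly F}) (z : F).

Lemma sylvester_row_sum p z dp i N : (size p <= dp.+1)%N -> (i + dp < N)%N ->
  \sum_(j < N) (if (i <= j <= i + dp)%N then p`_(dp - (j - i)) else 0) * z ^+ (N.-1 - j)
   = z ^+ (N.-1 - i - dp) * p.[z].
Proof.
move=> sp iN.
rewrite -(big_mkord xpredT (fun j => (if (i <= j <= i + dp)%N then p`_(dp - (j - i)) else 0)
   * z ^+ (N.-1 - j))).
rewrite (@big_cat_nat _ _ _ i) //=; last by rewrite ltnW // (leq_ltn_trans (leq_addr dp i)).
rewrite big_nat_cond big1 ?add0r; last first.
  by move=> j; rewrite andbT => /andP[_ ji]; rewrite leqNgt ji /= mul0r.
rewrite (@big_cat_nat _ _ _ (i + dp.+1)) //=; try by rewrite ?leq_addr ?addnS.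
rewrite [X in _ + X]big_nat_cond [X in _ + X]big1 ?addr0; last first.
  by move=> j; rewrite andbT => /andP[ji _]; rewrite [(j <= _)%N]leqNgt -addnS ji andbF mul0r.
rewrite -{1}(add0n i) [(i + dp.+1)%N]addnC big_addn addnK big_nat_rev /= add0n.
rewrite (horner_coef_wide z sp) mulr_sumr -(big_mkord xpredT
  (fun k => z ^+ (N.-1 - i - dp) * (p`_k * z ^+ k))).
rewrite big_nat_cond [RHS]big_nat_cond; apply: eq_bigr => k; rewrite andbT => /andP[_ kd].
have -> : (i <= dp.+1 - k.+1 + i <= i + dp)%N by lia.
have -> : (dp - (dp.+1 - k.+1 + i - i))%N = k by lia.
have -> : (N.-1 - (dp.+1 - k.+1 + i))%N = ((N.-1 - i - dp) + k)%N by lia.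
by rewrite exprD; ring.
Qed.

(** The vector of powers of [z] lies in the kernel of the Sylvester matrix; its last entry is
    [z ^+ 0], so it is nonzero even for [z = 0]. *)
Lemma fresultant_common_root p q z dp dq : (size p <= dp.+1)%N -> (size q <= dq.+1)%N ->
  (0 < dq + dp)%N -> root p z -> root q z -> fresultant p q dp dq = 0.
Proof.
move=> sp sq N0 pz qz; apply/eqP; rewrite /fresultant -det_tr; apply/det0P.
pose N := (dq + dp)%N.
exists (\row_(j < dq + dp) z ^+ (N.-1 - j)).
  have h : (N.-1 < dq + dp)%N by rewrite prednK.
  by apply/eqP => /rowP/(_ (Ordinal h)); rewrite !mxE /= subnn expr0 => /eqP; rewrite oner_eq0.
apply/rowP => i; rewrite !mxE.
under eq_bigr do rewrite !mxE mulrC.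
have [id|di] := ltnP i dq.
  rewrite (sylvester_row_sum z sp) ?(eqP pz) ?mulr0 //.
  by rewrite ltn_add2r.
rewrite (sylvester_row_sum z sq) ?(eqP qz) ?mulr0 //.
by have := ltn_ord i; lia.
Qed.

End FormalResultant.

Lemma map_fresultant (A B : comNzRingType) (f : {rmorphism A -> B}) (p q : {poly A}) dp dq :
  f (fresultant p q dp dq) = fresultant (map_poly f p) (map_poly f q) dp dq.
Proof.
rewrite /fresultant -det_map_mx; congr (\det _); apply/matrixP => i j; rewrite !mxE.
by case: ifP => _; case: ifP => _; rewrite ?rmorph0 ?coef_map.
Qed.

Lemma coefM_top (A : comNzRingType) (p q : {poly A}) a b : (size p <= a.+1)%N ->
  (size q <= b.+1)%N -> (p * q)`_(a + b) = p`_a * q`_b.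
Proof.
move=> sp sq; rewrite coefM.
have ab : (a < (a + b).+1)%N by rewrite ltnS leq_addr.
rewrite (bigD1 (Ordinal ab)) //= addKn big1 ?addr0 // => i ia.
have [h|h] := ltnP i a; last first.
  rewrite nth_default ?mul0r // (leq_trans sp) // ltn_neqAle h andbT.
  by apply: contraNneq ia => e; apply/eqP/val_inj.
by rewrite [q`__]nth_default ?mulr0 // (leq_trans sq) //; lia.
Qed.

Lemma poly_nonroot (F : numDomainType) (p : {poly F}) : p != 0 -> exists z, p.[z] != 0.
Proof.
move=> p0; pose s : seq F := [seq n%:R | n <- iota 0 (size p)].
have us : uniq s by rewrite map_inj_uniq ?iota_uniq //; apply: (mulrIn (oner_neq0 F)).
case: (boolP (all (root p) s)) => [h|/allPn[z _ pz]]; last by exists z.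
by have := max_poly_roots p0 h us; rewrite size_map size_iota ltnn.
Qed.

Section ComplexDiscriminant.
Variable R : realType.
Local Notation C := R[i].
Local Notation toC := (real_complex R).

Definition discC d (p : {poly C}) : C := mmap toC (fun i : 'I_d.+1 => p`_i) (generic_disc R d).

(** [generic_disc] falls back to 0 when no quotient exists, so being nonzero certifies its defining
    equation. *)
Lemma generic_discE d : (0 < d)%N -> generic_disc R d != 0 ->
  'X_(@ord_max d) * generic_disc R d = (-1) ^+ ((d * d.-1) %/ 2) *
     fresultant (generic_poly R d) (generic_poly R d)^`() d d.-1.
Proof.
case: d => // d _; rewrite /generic_disc; case: pselect => [h _|_]; last by rewrite eqxx.
exact: (projT2 (cid h)).
Qed.

(** The defining equation carries the leading coefficient as a factor, which has to be cancelled;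
    hence the assumption that [p] has degree exactly [d]. *)
Lemma discC_top d (p : {poly C}) z : (0 < d)%N -> generic_disc R d != 0 ->
  (size p <= d.+1)%N -> p`_d != 0 -> root p z -> root p^`() z -> discC d p = 0.
Proof.
move=> d0 gd sp pd rp rp'; pose phi := mmap toC (fun i : 'I_d.+1 => p`_i).
have mapG : map_poly phi (generic_poly R d) = p.
  apply/polyP => i; rewrite coef_map coef_poly.
  case: ltnP => hi; last by rewrite raddf0 nth_default ?(leq_trans sp).
  by rewrite -[LHS]/(phi 'X_(inord i)) /phi mmapX mmap1U inordK.
have phiX : phi 'X_(@ord_max d) = p`_d by rewrite /phi mmapX mmap1U.
have phiM : {morph phi : x y / x * y} by exact: rmorphM.
have phiF : phi (fresultant (generic_poly R d) (generic_poly R d)^`() d d.-1) =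
    fresultant p p^`() d d.-1.
  by rewrite -mapG deriv_map; exact: map_fresultant.
have := congr1 phi (generic_discE d0 gd); rewrite !phiM phiX phiF.
rewrite (@fresultant_common_root _ p p^`() z) //; last 2 first.
- by rewrite prednK //; apply/leq_sizeP => j dj; rewrite coef_deriv nth_default ?mul0rn // (leq_trans sp).
- by rewrite addn_gt0 d0 orbT.
by move/eqP; rewrite mulr0 mulf_eq0 (negPf pd) => /eqP.
Qed.

(* Perturbing both factors makes the leading coefficient nonzero, where the Sylvester
   determinant applies. *)
Lemma discC_square d (L Q : {poly C}) : generic_disc R d.+2 != 0 -> (size L <= 2)%N ->
  (size Q <= d.+1)%N -> discC d.+2 (L ^+ 2 * Q) = 0.
Proof.
move=> gd sL sQ.
pose Lt : {poly {poly C}} := map_poly polyC L + 'X%:P * 'X.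
pose Qt : {poly {poly C}} := map_poly polyC Q + 'X%:P * 'X^d.
pose Pt := Lt ^+ 2 * Qt.
pose D : {poly C} := mmap (polyC \o toC) (fun i : 'I_d.+3 => Pt`_i) (generic_disc R d.+2).
have evL z : map_poly (horner_eval z) Lt = L + z *: 'X.
  rewrite rmorphD rmorphM /= map_polyC map_polyX -map_poly_comp /=.
  rewrite map_poly_id; last by move=> x _ /=; rewrite /horner_eval hornerC.
  by rewrite mul_polyC; congr (_ + _ *: _); rewrite /= /horner_eval hornerX.
have evQ z : map_poly (horner_eval z) Qt = Q + z *: 'X^d.
  rewrite rmorphD rmorphM /= map_polyC map_polyXn -map_poly_comp /=.
  rewrite map_poly_id; last by move=> x _ /=; rewrite /horner_eval hornerC.
  by rewrite mul_polyC; congr (_ + _ *: _); rewrite /= /horner_eval hornerX.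
pose pz z := (L + z *: 'X) ^+ 2 * (Q + z *: 'X^d).
have evP z : map_poly (horner_eval z) Pt = pz z.
  by rewrite rmorphM rmorphXn /= evL evQ.
have evD z : D.[z] = discC d.+2 (pz z).
  rewrite -[LHS]/(horner_eval z D) /D /discC /mmap rmorph_sum /=; apply: eq_bigr => a _.
  rewrite rmorphM /=; congr (_ * _); first by rewrite /horner_eval hornerC.
  rewrite /mmap1 rmorph_prod; apply: eq_bigr => i _.
  by rewrite rmorphXn /= -evP coef_map.
have sLz z : (size (L + z *: 'X)%R <= 2)%N.
  by rewrite (leq_trans (size_polyD _ _)) // geq_max sL (leq_trans (size_scale_leq _ _)) ?size_polyX.
have sQz z : (size (Q + z *: 'X^d)%R <= d.+1)%N.
  by rewrite (leq_trans (size_polyD _ _)) // geq_max sQ (leq_trans (size_scale_leq _ _)) ?size_polyXn.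
have sL2 z : (size ((L + z *: 'X) ^+ 2)%R <= 3)%N by apply: size_exp_le2.
have top z : (pz z)`_d.+2 = (L`_1 + z) ^+ 2 * (Q`_d + z).
  rewrite /pz -[d.+2]add2n coefM_top //; congr (_ * _).
    rewrite expr2 -[2%N]/(1 + 1)%N coefM_top // -expr2 coefD coefZ coefX mulr1 //.
  by rewrite coefD coefZ coefXn eqxx mulr1.
have sp z : (size (pz z) <= d.+3)%N.
  rewrite (leq_trans (size_polyMleq _ _)) //; have := sL2 z; have := sQz z.
  by move: (size _) (size _) => x y; lia.
have Dz z : D.[z] * ((L`_1 + z) ^+ 2 * (Q`_d + z)) = 0.
  have [->|t0] := eqVneq ((L`_1 + z) ^+ 2 * (Q`_d + z)) 0; first by rewrite mulr0.
  have l0 : L`_1 + z != 0 by apply: contraNneq t0 => ->; rewrite expr0n mul0r.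
  pose r := - (L`_0 / (L`_1 + z)).
  have rL : (L + z *: 'X).[r] = 0.
    have -> : (L + z *: 'X).[r] = L`_0 + (L`_1 + z) * r.
      rewrite hornerD hornerZ hornerX (horner_coef_wide r sL) !big_ord_recl big_ord0 /=.
      by rewrite /bump /= ?expr0 ?expr1; ring.
    by rewrite /r mulrN mulrC divfK // subrr.
  rewrite evD (@discC_top _ _ r) ?mul0r // ?top //.
    by rewrite rootE /pz hornerM horner_exp rL expr0n mul0r.
  rewrite rootE /pz expr2 -mulrA derivM hornerD !hornerM rL !mul0r mulr0 addr0 //.
(* [D] times the leading coefficient vanishes at every value of the perturbation parameter, and that
   coefficient is a nonzero polynomial in it. *)
have D0 : D = 0.
  apply/eqP; case: eqVneq => // D0; exfalso.
  pose W := D * (('X + (L`_1)%:P) ^+ 2 * ('X + (Q`_d)%:P)).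
  have W0 : W != 0.
    rewrite !mulf_neq0 ?expf_neq0 //; apply: monic_neq0; exact: monicXaddC.
  have [z /negP[]] := poly_nonroot W0.
  have -> : W.[z] = D.[z] * ((L`_1 + z) ^+ 2 * (Q`_d + z)).
    by rewrite /W expr2 !hornerM !hornerD hornerX !hornerC; ring.
  by rewrite Dz eqxx.
have := evD 0; rewrite D0 horner0 /pz !scale0r !addr0 => <-; by [].
Qed.

(** A double root of the transformed form is a square factor, and transforming back by [mobK] gives
    one of [p] as a form of degree [d]. This covers a double root of [p] at infinity, which shows in
    [p] only as a drop of degree. *)
Lemma mob_simple_roots d (a b : C) (p : {poly C}) : generic_disc R d != 0 ->
  (size p <= d.+1)%N -> p != 0 -> a ^+ 2 + b ^+ 2 != 0 -> discC d p != 0 ->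
  simple_roots (mob d a b p).
Proof.
move=> gd sp p0 s0 Dp z rz; apply/negP => /eqP rz'.
have [T ET] := factor_theorem _ _ rz.
have rT : root T z.
  move: rz'; rewrite ET derivM derivXsubC mulr1 hornerD hornerM hornerXsubC subrr mulr0 add0r.
  by move=> h; rewrite rootE h.
have [Q EQ] := factor_theorem _ _ rT.
have EG : mob d a b p = ('X - z%:P) ^+ 2 * Q by rewrite ET EQ expr2; ring.
have sd0 : (a ^+ 2 + b ^+ 2) ^+ d != 0 by rewrite expf_neq0.
have G0 : mob d a b p != 0.
  apply: contraNneq p0 => G0; have := mobK a b sp.
  have -> : mob d a b (mob d a b p) = 0.
    by rewrite G0; apply: big1 => k _; rewrite coef0 scale0r.
  by move=> /esym/eqP; rewrite scaler_eq0 (negPf sd0).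
have Q0 : Q != 0 by apply: contraNneq G0 => Q0; rewrite EG Q0 mulr0.
have sG := size_mob d a b p.
have sQ : ((size Q).+2 <= d.+1)%N.
  apply: leq_trans sG; rewrite EG size_monicM ?monic_exp ?monicXsubC //.
  by rewrite size_exp_XsubC.
have : (0 < size Q)%N by rewrite size_poly_gt0.
clear ET rz rz'; case: d gd sp Dp EG sd0 G0 sG sQ => [|[|d]] gd sp Dp EG sd0 G0 sG sQ sQ0; try lia.
have Ep : p = mob 1 a b ('X - z%:P) ^+ 2 * (((a ^+ 2 + b ^+ 2) ^+ d.+2)^-1 *: mob d a b Q).
  have := mobK a b sp; rewrite EG -[d.+2]/(2 + d)%N mob_mul ?size_exp_XsubC //.
  rewrite [mob 2 _ _ _]hom_exp ?size_XsubC // -/(mob 1 a b _) => E.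
  by rewrite -scalerAr E scalerA mulVf ?scale1r.
move/negP: Dp; apply; rewrite Ep discC_square //; first exact: size_mob.
by rewrite (leq_trans (size_scale_leq _ _)) // size_mob.
Qed.

End ComplexDiscriminant.

(** * Restriction to lines and orders of vanishing *)

Lemma mpoly_alg_ind (A : comNzRingType) n (P : {mpoly A[n]} -> Prop) :
  (forall c, P c%:MP) -> (forall i, P 'X_i) -> (forall p q, P p -> P q -> P (p + q)) ->
  (forall p q, P p -> P q -> P (p * q)) -> forall p, P p.
Proof.
move=> Pc PX PD PM; elim/mpolyind => [|c m p _ _ Pp]; first by rewrite -(mpolyC0 n A).
apply: PD => //; rewrite -mul_mpolyC; apply: (PM) => //; rewrite mpolyXE_id.
apply: (big_ind P) => [||i _]; [by rewrite -mpolyC1 | exact: PM |].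
by elim: (m i) => [|k IHk]; [rewrite expr0 -mpolyC1 | rewrite exprS; apply: (PM)].
Qed.

Lemma rmorph_mmap (A B B' : comNzRingType) n (f : {rmorphism A -> B}) (g : {rmorphism B -> B'})
   (h : 'I_n -> B) (p : {mpoly A[n]}) :
  g (mmap f h p) = mmap (g \o f) (fun i => g (h i)) p.
Proof.
rewrite /mmap rmorph_sum; apply: eq_bigr => m _; rewrite rmorphM; congr (_ * _).
by rewrite /mmap1 rmorph_prod; apply: eq_bigr => i _; rewrite rmorphXn.
Qed.

Lemma eq_mmap (A B : nzRingType) n (f f' : A -> B) (h h' : 'I_n -> B) (p : {mpoly A[n]}) :
  f =1 f' -> h =1 h' -> mmap f h p = mmap f' h' p.
Proof.
move=> ff' hh'; rewrite /mmap; apply: eq_bigr => m _; rewrite ff'; congr (_ * _).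
by apply: eq_bigr => i _; rewrite hh'.
Qed.

Section Lines.
Variable A : comNzRingType.

Definition line n (x v : 'I_n -> A) (f : {mpoly A[n]}) : {poly A} :=
  mmap (@polyC A) (fun i => (x i)%:P + v i *: 'X) f.

HB.instance Definition _ n (x v : 'I_n -> A) := GRing.isAdditive.Build {mpoly A[n]} {poly A}
  (line x v) (mmap_is_additive _ _).
HB.instance Definition _ n (x v : 'I_n -> A) := GRing.isMultiplicative.Build {mpoly A[n]} {poly A}
  (line x v) (mmap_is_multiplicative _ (@polyC A)).

Lemma lineC n (x v : 'I_n -> A) c : line x v c%:MP = c%:P.
Proof. exact: mmapC. Qed.

Lemma lineX n (x v : 'I_n -> A) i : line x v 'X_i = (x i)%:P + v i *: 'X.
Proof. by rewrite /line mmapX mmap1U. Qed.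

Lemma horner_line n (x v : 'I_n -> A) f t :
  (line x v f).[t] = f.@[fun i => x i + t * v i].
Proof.
rewrite -[LHS]/(horner_eval t _) /line rmorph_mmap; apply: eq_mmap => [c|i] /=.
  by rewrite /horner_eval hornerC.
by rewrite /horner_eval hornerD hornerC hornerZ hornerX mulrC.
Qed.

Definition transl n (x : 'I_n -> A) (f : {mpoly A[n]}) : {mpoly A[n]} :=
  mmap (@mpolyC n A) (fun i => 'X_i + (x i)%:MP) f.

Lemma line_transl n (x v : 'I_n -> A) f : line x v f = line (fun=> 0) v (transl x f).
Proof.
rewrite /transl rmorph_mmap; apply: eq_mmap => [c|i] /=; first by rewrite lineC.
by rewrite rmorphD /= lineX lineC add0r addrC.
Qed.

Lemma coef_line0 n (v : 'I_n -> A) g k :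
  (line (fun=> 0) v g)`_k = (\sum_(a <- msupp g | mdeg a == k) g@_a *: 'X_[a]).@[v].
Proof.
rewrite /line /mmap coef_sum raddf_sum /= [RHS]big_mkcond /=; apply: eq_bigr => a _.
have -> : mmap1 (fun i => 0%:P + v i *: 'X) a = (\prod_i v i ^+ a i) *: 'X^(mdeg a).
  rewrite /mmap1 mdegE -prodrXr -scaler_prod; apply: eq_bigr => i _.
  by rewrite add0r exprZn.
rewrite coefCM coefZ coefXn eq_sym mevalZ mevalX.
by case: eqVneq => _; rewrite ?mulr1 ?mulr0.
Qed.

End Lines.

Lemma base_inj n N (a b : 'I_n -> nat) : (forall i, a i < N)%N -> (forall i, b i < N)%N ->
  (\sum_(i < n) a i * N ^ i = \sum_(i < n) b i * N ^ i)%N -> a =1 b.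
Proof.
elim: n a b => [|n IHn] a b ha hb; first by move=> _ [].
rewrite !big_ord_recl !expn0 !muln1 => E.
have shift (c : 'I_n.+1 -> nat) : (\sum_(i < n) c (lift ord0 i) * N ^ lift ord0 i =
    N * \sum_(i < n) c (lift ord0 i) * N ^ i)%N.
  by rewrite big_distrr /=; apply: eq_bigr => i _; rewrite /bump add1n expnS; ring.
rewrite !shift in E.
have N0 : (0 < N)%N by apply: leq_trans (ha ord0).
have e0 : a ord0 = b ord0.
  have := congr1 (modn^~ N) E; rewrite ![(_ + N * _)%N]addnC ![(N * _)%N]mulnC !modnMDl.
  by rewrite !modn_small.
have e1 : (fun i : 'I_n => a (lift ord0 i)) =1 (fun i => b (lift ord0 i)).
  apply: IHn => [i|i|]; [exact: ha | exact: hb |].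
  by move/eqP: E; rewrite e0 eqn_add2l eqn_pmul2l // => /eqP.
by move=> i; have [j ->|->] := unliftP ord0 i; [apply: e1|].
Qed.

Section NonVanishing.
Variable F : numFieldType.

(* Kronecker substitution X_i := X^(N^i) reduces to one variable. *)
Lemma mpoly_nonroot n (f : {mpoly F[n]}) : f != 0 -> exists v, f.@[v] != 0.
Proof.
move=> f0; pose N := msize f.
pose kr (a : 'X_{1..n}) := (\sum_(i < n) a i * N ^ i)%N.
pose G : {poly F} := mmap (@polyC F) (fun i : 'I_n => 'X^(N ^ i)) f.
have EG : G = \sum_(a <- msupp f) f@_a *: 'X^(kr a).
  rewrite /G /mmap; apply: eq_bigr => a _; rewrite mul_polyC; congr (_ *: _).
  rewrite /mmap1 /kr -prodrXr; apply: eq_bigr => i _.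
  by rewrite -exprM mulnC.
have small a i : a \in msupp f -> (a i < N)%N.
  move=> af; apply: leq_ltn_trans (msize_mdeg_lt af).
  by rewrite mdegE (bigD1 i) //= leq_addr.
have [a af] : exists a, a \in msupp f.
  case E : (msupp f) => [|a s]; last by exists a; rewrite mem_head.
  by move: f0; rewrite -msupp_eq0 E.
have G0 : G != 0.
  apply/eqP => G0; have := af; rewrite mcoeff_msupp => /negP; apply.
  have := congr1 (fun p : {poly F} => p`_(kr a)) EG; rewrite G0 coef0 coef_sum.
  rewrite (bigD1_seq a) ?msupp_uniq //= coefZ coefXn eqxx mulr1 big_seq_cond big1 ?addr0.
    by move=> <-.
  move=> b /andP[bf ba]; rewrite coefZ coefXn; case: eqVneq => [E|_]; last by rewrite mulr0.
  exfalso; move/negP: ba; apply; apply/eqP/mnmP.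
  by apply: (@base_inj n N) => // i; apply: small.
have [z Gz] := poly_nonroot G0; exists (fun i => z ^+ (N ^ i)).
move: Gz; rewrite -[G.[z]]/(horner_eval z G) /G rmorph_mmap.
by rewrite (@eq_mmap _ _ _ _ idfun _ (fun i : 'I_n => z ^+ (N ^ i))) // => [c|i] /=;
  rewrite /horner_eval ?hornerC ?hornerXn.
Qed.

Lemma line_nonzero n (x : 'I_n -> F) (f : {mpoly F[n]}) : f != 0 -> exists v, line x v f != 0.
Proof.
move=> /mpoly_nonroot[y fy]; exists (fun i => y i - x i).
apply: contraNneq fy => l0; have := horner_line x (fun i => y i - x i) f 1.
rewrite l0 horner0 => ->; apply/eqP; apply: meval_eq => i; rewrite mul1r addrC subrK //.
Qed.

End NonVanishing.

Section Orders.
Variable F : numFieldType.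
Variable n : nat.
Implicit Types (f g : {mpoly F[n]}) (x v : 'I_n -> F) (a : 'X_{1..n}).

HB.instance Definition _ x := GRing.isAdditive.Build {mpoly F[n]} {mpoly F[n]}
  (transl x) (mmap_is_additive _ _).
HB.instance Definition _ x := GRing.isMultiplicative.Build {mpoly F[n]} {mpoly F[n]}
  (transl x) (mmap_is_multiplicative _ (@mpolyC n F)).

Lemma translC x c : transl x c%:MP = c%:MP. Proof. exact: mmapC. Qed.
Lemma translX x i : transl x 'X_i = 'X_i + (x i)%:MP. Proof. by rewrite /transl mmapX mmap1U. Qed.

Lemma mderiv_transl x f i : (transl x f)^`M(i) = transl x f^`M(i).
Proof.
elim/mpoly_alg_ind: f => [c|j|p q IHp IHq|p q IHp IHq].
- by rewrite translC !mderivC raddf0.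
- rewrite translX mderivD mderivC addr0 !mderivX mnm1E.
  case: eqVneq => [->|_]; last by rewrite !scale0r raddf0.
  rewrite !scale1r (_ : U_(i) - U_(i) = 0)%MM ?mpolyX0 ?rmorph1 //.
  by apply/mnmP => k; rewrite mnmBE mnm0E subnn.
- by rewrite rmorphD !mderivD IHp IHq rmorphD.
- by rewrite rmorphM !mderivM IHp IHq rmorphD !rmorphM.
Qed.

Lemma mderivm_transl x f a : (transl x f)^`M[a] = transl x f^`M[a].
Proof.
rewrite /mderivm; elim: (enum _) => //= i s ->.
by elim: (a i) => //= k ->; rewrite mderiv_transl.
Qed.

Lemma meval_transl0 x f : (transl x f).@[fun=> 0] = f.@[x].
Proof.
rewrite -[LHS]/(meval (fun=> 0) (transl x f)) /transl /meval rmorph_mmap; apply: eq_mmap => [c|i] /=.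
  exact: mevalC.
by rewrite -[LHS]/(meval _ _) mevalD mevalXU mevalC add0r.
Qed.

Lemma meval0_coef f : f.@[fun=> 0] = f@_0%MM.
Proof.
elim/mpoly_alg_ind: f => [c|i|p q IHp IHq|p q IHp IHq].
- by rewrite mevalC mcoeffC eqxx mulr1.
- by rewrite mevalXU mcoeffX mnm1_eq0.
- by rewrite mevalD IHp IHq mcoeffD.
- by rewrite mevalM IHp IHq; have [M _] := @mcoeff0_is_multiplicative n F; rewrite M.
Qed.

(** A derivative at [x] is the Taylor coefficient times factorials, which are invertible in
    characteristic 0. *)
Lemma mderivm_eq0 x f a : (f^`M[a].@[x] == 0) = ((transl x f)@_a == 0).
Proof.
rewrite -meval_transl0 -mderivm_transl meval0_coef mcoeff_mderivm addm0.
rewrite -mulr_natr mulf_eq0 pnatr_eq0 orbC -[X in X || _]negbK -lt0n prodn_gt0 // => i.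
by rewrite ffactnn fact_gt0.
Qed.

(** On the line in direction [v] the coefficient of [t^k] is the homogeneous part of degree [k] of
    the Taylor expansion, evaluated at [v]; by [mpoly_nonroot] it vanishes for all [v] only if that
    part is zero. *)
Lemma coef_line_eq0 x f k :
  (forall v, (line x v f)`_k = 0) <-> forall a, mdeg a = k -> (transl x f)@_a = 0.
Proof.
set g := transl x f.
pose h := \sum_(a <- msupp g | mdeg a == k) g@_a *: 'X_[a].
have hE v : (line x v f)`_k = h.@[v] by rewrite line_transl coef_line0.
have hc a : mdeg a = k -> h@_a = g@_a.
  move=> ak; rewrite raddf_sum /=.
  have [ga|ga] := boolP (a \in msupp g); last first.
    rewrite big1_seq; first by move: ga; rewrite mcoeff_msupp negbK => /eqP.
    move=> b /andP[_ bg]; rewrite mcoeffZ mcoeffX; case: eqVneq => [E|_]; last by rewrite mulr0.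
    by move: ga; rewrite -E bg.
  rewrite big_mkcond (bigD1_seq a) ?msupp_uniq //= ak eqxx mcoeffZ mcoeffX eqxx mulr1.
  rewrite big1 ?addr0 // => b ba; case: ifP => // _.
  by rewrite mcoeffZ mcoeffX (negPf ba) mulr0.
split=> [h0 a ak|g0 v].
  rewrite -hc //; have [->|/mpoly_nonroot[v]] := eqVneq h 0; first exact: mcoeff0.
  by rewrite -hE h0 eqxx.
rewrite hE /h big1 ?meval0 // => a /eqP ak; by rewrite g0 // scale0r.
Qed.

End Orders.

(** Trades partial derivatives for restrictions to lines, to which the one-parameter results
    apply. *)
Lemma has_ordP (R : realType) k (f : {mpoly R[k]}) x o : has_ord f x (Some o) <->
  (forall j v, (j < o)%N -> (line x v f)`_j = 0) /\ exists v, (line x v f)`_o != 0.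
Proof.
split=> [[[a [ao fa]] H]|[H [v vo]]].
  split=> [j v jo|].
    apply: (coef_line_eq0 x f j).2 => b bj; apply/eqP; rewrite -mderivm_eq0.
    by apply/eqP/H; rewrite bj.
  apply: contrapT => nv; move: fa; rewrite mderivm_eq0 => /eqP; apply.
  apply: (coef_line_eq0 x f o).1 => // v; apply/eqP; apply: contrapT => /negP vo.
  by apply: nv; exists v.
split=> [|a ao].
  apply: contrapT => na; move/eqP: vo; apply; apply: (coef_line_eq0 x f o).2 => a ao.
  apply/eqP; apply: contrapT => /negP ga; apply: na; exists a; split=> //.
  by rewrite mderivm_eq0.
apply/eqP; rewrite mderivm_eq0; apply/eqP.
by apply: (coef_line_eq0 x f (mdeg a)).1 => // w; apply: H.
Qed.

Lemma has_ord_None (R : realType) k (f : {mpoly R[k]}) x : f != 0 -> ~ has_ord f x None.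
Proof.
move=> f0 h; have [v /eqP] := line_nonzero x f0; apply.
apply/polyP => j; rewrite coef0; apply: (coef_line_eq0 x f j).2 => a _.
by apply/eqP; rewrite -mderivm_eq0; apply/eqP/h.
Qed.

(** * Continuous families of polynomials *)

Section PolyContinuity.
Variable R : realType.
Local Notation C := R[i].
Local Notation toC := (real_complex R).
Variables (T : Type) (F : set_system T) (q0 : T).
Context {FF : Filter F}.

(** The common bound on the sizes makes convergence of coefficients imply uniform convergence on
    discs. The filter is abstract because it is used both for points of [S] near [p] and for pairs
    of a point and a direction. *)
Definition cP (f : T -> {poly R}) := (exists N, forall q, (size (f q) <= N)%N) /\
  forall k, (fun q => (f q)`_k) @ F --> (f q0)`_k.

Lemma cP_cst p : cP (fun=> p).
Proof. by split; [exists (size p) | move=> k; exact: cvg_cst]. Qed.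

Lemma cPC (f : T -> R) : f @ F --> f q0 -> cP (fun q => (f q)%:P).
Proof.
move=> cf; split; first by exists 1%N => q; apply: size_polyC_leq1.
by case=> [|k]; under eq_fun do rewrite coefC /=; rewrite coefC //=; exact: cvg_cst.
Qed.

Lemma cPD f g : cP f -> cP g -> cP (fun q => f q + g q).
Proof.
move=> [[N HN] cf] [[N' HN'] cg]; split.
  exists (maxn N N') => q; rewrite (leq_trans (size_polyD _ _)) // geq_max.
  by rewrite !leq_max HN HN' orbT.
by move=> k; under eq_fun do rewrite coefD; rewrite coefD; apply: cvgD.
Qed.

Lemma cvg_sum_ord n (f : 'I_n -> T -> R) (l : 'I_n -> R) : (forall i, f i @ F --> l i) ->
  (fun q => \sum_(i < n) f i q) @ F --> \sum_(i < n) l i.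
Proof.
move=> H; elim: n f l H => [|n IHn] f l H.
  by under eq_fun do rewrite big_ord0; rewrite big_ord0; exact: cvg_cst.
under eq_fun do rewrite big_ord_recl; rewrite big_ord_recl; apply: cvgD => //.
exact: IHn.
Qed.

Lemma cPM f g : cP f -> cP g -> cP (fun q => f q * g q).
Proof.
move=> [[N HN] cf] [[N' HN'] cg]; split.
  exists (N + N')%N => q; rewrite (leq_trans (size_polyMleq _ _)) //.
  by rewrite (leq_trans (leq_pred _)) // leq_add.
move=> k; under eq_fun do rewrite coefM; rewrite coefM.
by apply: cvg_sum_ord => i; apply: cvgM.
Qed.

Lemma cP_sum n (f : 'I_n -> T -> {poly R}) : (forall i, cP (f i)) ->
  cP (fun q => \sum_(i < n) f i q).
Proof.
elim: n f => [|n IHn] f H.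
  by under eq_fun do rewrite big_ord0; exact: cP_cst.
by under eq_fun do rewrite big_ord_recl; apply: cPD => //; exact: IHn.
Qed.

Lemma cP_line n (x v : T -> 'I_n -> R) (f : {mpoly R[n]}) :
  (forall i, (fun q => x q i) @ F --> x q0 i) -> (forall i, (fun q => v q i) @ F --> v q0 i) ->
  cP (fun q => line (x q) (v q) f).
Proof.
move=> cx cv; elim/mpoly_alg_ind: f => [c|i|p q IHp IHq|p q IHp IHq].
- by under eq_fun do rewrite lineC; exact: cP_cst.
- under eq_fun do rewrite lineX -mul_polyC; apply: cPD; first exact: cPC.
  by apply: cPM; [exact: cPC | exact: cP_cst].
- by under eq_fun do rewrite rmorphD /=; exact: cPD.
- by under eq_fun do rewrite rmorphM /=; exact: cPM.
Qed.

Lemma cP_drop f n : cP f -> cP (fun q => drop_poly n (f q)).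
Proof.
move=> [[N HN] cf]; split.
  by exists N => q; rewrite (leq_trans _ (HN q)) // size_drop_poly leq_subr.
by move=> k; under eq_fun do rewrite coef_drop_poly; rewrite coef_drop_poly; exact: cf.
Qed.

Lemma cP_comp_Xn f n : (0 < n)%N -> cP f -> cP (fun q => f q \Po 'X^n).
Proof.
move=> n0 [[N HN] cf]; split.
  exists (N * n).+1%N => q; rewrite (leq_trans (size_comp_poly_leq _ _)) // ltnS size_polyXn /=.
  by rewrite leq_mul2r (leq_trans (leq_pred _) (HN q)) orbT.
move=> k; under eq_fun do rewrite coef_comp_poly_Xn //; rewrite coef_comp_poly_Xn //.
by case: ifP => _; [exact: cf | exact: cvg_cst].
Qed.

Lemma near_coef f k (e : R) : cP f -> 0 < e -> \forall q \near F, `|(f q)`_k - (f q0)`_k| < e.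
Proof.
move=> [_ cf] e0; have /cvgrPdist_lt/(_ e e0) := cf k.
by apply: filterS => q; rewrite distrC.
Qed.

Lemma near_horner f (b e : R) : cP f -> 0 < e ->
  \forall q \near F, forall t : C, cabs t <= b ->
    cabs ((map_poly toC (f q)).[t] - (map_poly toC (f q0)).[t]) <= e.
Proof.
move=> cf e0; have [[N HN] _] := cf.
pose b' := 1 + `|b|; have b1 : 1 <= b' by rewrite /b' lerDl.
have b'0 : 0 < b' ^+ N by rewrite exprn_gt0 // (lt_le_trans ltr01).
pose M := N.+1%:R * b' ^+ N; have M0 : 0 < M by rewrite mulr_gt0.
pose d := e / M; have d0 : 0 < d by rewrite divr_gt0.
have H n : \forall q \near F, forall k, (k < n)%N -> `|(f q)`_k - (f q0)`_k| < d.
  elim: n => [|n IHn]; first by apply: filterE.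
  have H1 := near_coef n cf d0.
  near=> q => k; rewrite ltnS leq_eqVlt => /orP[/eqP->|kn]; first by near: q.
  by move: k kn; near: q.
near=> q => t tb.
have Hq : forall k, (k < N)%N -> `|(f q)`_k - (f q0)`_k| < d by near: q; apply: H.
rewrite -hornerN -hornerD -raddfN -raddfD /=.
apply: (@le_trans _ _ (d * N%:R * b' ^+ N)).
  apply: horner_coef_bound => //.
  - rewrite (leq_trans (size_poly _ _)) // (leq_trans (size_polyD _ _)) // size_polyN.
    by rewrite geq_max !HN.
  - exact: ltW.
  - by rewrite /b' (le_trans tb) // (le_trans (ler_norm _)) // lerDr.
  - move=> k; rewrite coef_map cabs_real coefD coefN.
    have [kN|Nk] := ltnP k N; first exact/ltW/Hq.
    by rewrite !nth_default ?subr0 ?normr0 ?ltW // (leq_trans (HN _)).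
rewrite -mulrA /d -mulrA ler_piMr ?(ltW e0) // mulrC ler_pdivrMr // mul1r /M.
by rewrite ler_wpM2r ?(ltW b'0) // ler_nat.
Unshelve. all: by end_near.
Qed.

(* Here f q = t^e (u q + ...) with u nonzero at q0. *)
Lemma near_nonzero f e : cP f -> (f q0)`_e != 0 ->
  (\forall q \near F, forall k, (k < e)%N -> (f q)`_k = 0) ->
  (forall k, (k < e)%N -> (f q0)`_k = 0) ->
  exists2 eps : R, 0 < eps & \forall q \near F, forall t : C, 0 < cabs t <= eps ->
    (map_poly toC (f q)).[t] != 0.
Proof.
move=> cf fe low low0.
pose g q := drop_poly e (f q).
have cg : cP g by exact: cP_drop.
have fg (p : {poly R}) : (forall k, (k < e)%N -> p`_k = 0) -> p = drop_poly e p * 'X^e :> {poly R}.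
  move=> h; rewrite -[LHS](poly_take_drop e); rewrite -[RHS]add0r; congr (_ + _).
  by apply/polyP => k; rewrite coef_take_poly coef0; case: ifP => // /h.
pose c := `|(f q0)`_e|; have c0 : 0 < c by rewrite normr_gt0.
have g0 : (map_poly toC (g q0)).[0] = toC (f q0)`_e.
  by rewrite horner_coef0 coef_map coef_drop_poly.
have c40 : 0 < c / 4 by rewrite divr_gt0.
have [d d0 Hd] := poly_continuous (map_poly toC (g q0)) 0 c40.
exists (d / 2); first by rewrite divr_gt0.
have H := near_horner (d / 2) cg c40.
near=> q => t /andP[t0 td].
have lq : forall k, (k < e)%N -> (f q)`_k = 0 by near: q.
rewrite (fg _ lq) rmorphM /= map_polyXn hornerM hornerXn mulf_neq0 //; last first.
  by rewrite expf_neq0 // -cabs_gt0.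
have h1 : cabs ((map_poly toC (g q)).[t] - (map_poly toC (g q0)).[t]) <= c / 4.
  by apply: (near H q).
have h2 := Hd t; rewrite subr0 in h2.
rewrite -cabs_gt0 -/(g q).
have h3 : cabs t < d by lra.
have := h2 h3; rewrite g0.
have h4 := cabs_real (f q0)`_e.
have := cabsBl (toC (f q0)`_e) (map_poly toC (g q0)).[t].
have := cabsBl (map_poly toC (g q0)).[t] (map_poly toC (g q)).[t].
rewrite h4 [cabs (_ - (map_poly _ (g q)).[_])]cabsC [cabs (toC _ - _)]cabsC -/c.
by move: h1 c0; clear; lra.
Unshelve. all: by end_near.
Qed.

End PolyContinuity.

(** * Affine charts of the projective line *)

Section Charts.
Variable K : comNzRingType.
Implicit Types (a b x : K) (p : {poly K}).

(* Affine chart z -> (a - b (x + z) : b + a (x + z)) of the projective line *)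
Definition chart d a b x p : {poly K} :=
  bhom d ((a - b * x)%:P - b *: 'X) ((b + a * x)%:P + a *: 'X) p.

Lemma chart_comp d a b x p : chart d a b x p = mob d a b p \Po ('X + x%:P).
Proof.
rewrite /chart /mob /bhom raddf_sum /=; apply: eq_bigr => k _.
rewrite comp_polyZ comp_polyM !rmorphXn /= comp_polyB comp_polyD !comp_polyZ !comp_polyC.
rewrite comp_polyX !scalerDr -!mul_polyC !rmorphD rmorphN /= !rmorphM /=.
by rewrite opprD !addrA [_ - _ - b%:P * _]addrAC [_ + _ + a%:P * _]addrAC.
Qed.

Lemma chart0 d a b p : chart d a b 0 p = mob d a b p.
Proof. by rewrite chart_comp addr0 comp_polyXr. Qed.

Lemma size_chart d a b x p : (size (chart d a b x p) <= d.+1)%N.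
Proof.
rewrite /chart /bhom (leq_trans (size_sum _ _ _)) //; apply/bigmax_leqP => k _.
have kd : (k <= d)%N by rewrite -ltnS.
rewrite (leq_trans (size_scale_leq _ _)) // (leq_trans (size_polyMleq _ _)) //.
have := size_exp_le2 k (size_linN (a - b * x) b).
have := size_exp_le2 (d - k) (size_lin (b + a * x) a).
by move: (size _) (size _) => n n'; lia.
Qed.

End Charts.

Lemma map_chart (K L : comNzRingType) (f : {rmorphism K -> L}) d a b x (p : {poly K}) :
  map_poly f (chart d a b x p) = chart d (f a) (f b) (f x) (map_poly f p).
Proof.
rewrite /chart /bhom rmorph_sum /=; apply: eq_bigr => k _.
rewrite map_polyZ coef_map rmorphM !rmorphXn /= [map_poly f (_ - _)]rmorphB.
rewrite [map_poly f (_ + _)]rmorphD /= !map_polyZ !map_polyC map_polyX /=.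
have -> : f (a - b * x) = f a - f b * f x by rewrite rmorphB rmorphM.
by have -> : f (b + a * x) = f b + f a * f x by rewrite rmorphD rmorphM.
Qed.

Section PolyPolyContinuity.
Variable R : realType.
Variables (T : Type) (F : set_system T) (q0 : T).
Context {FF : Filter F}.
Local Notation cP := (cP F q0).

Definition cPP (G : T -> {poly {poly R}}) := forall l, cP (fun q => (G q)`_l).

Lemma cPP_cst G : cPP (fun=> G). Proof. by move=> l; exact: cP_cst. Qed.

Lemma cPPC f : cP f -> cPP (fun q => (f q)%:P).
Proof.
move=> cf [|l]; under eq_fun do rewrite coefC /=; [exact: cf | exact: cP_cst].
Qed.

Lemma cPPD f g : cPP f -> cPP g -> cPP (fun q => f q + g q).
Proof. by move=> cf cg l; under eq_fun do rewrite coefD; apply: cPD. Qed.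

Lemma cPPM f g : cPP f -> cPP g -> cPP (fun q => f q * g q).
Proof.
move=> cf cg l; under eq_fun do rewrite coefM; apply: cP_sum => i; exact: cPM.
Qed.

Lemma cPPX f n : cPP f -> cPP (fun q => f q ^+ n).
Proof.
move=> cf; elim: n => [|n IHn]; first exact: cPP_cst.
by under eq_fun do rewrite exprS; exact: cPPM.
Qed.

Lemma cPP_sum n (f : 'I_n -> T -> {poly {poly R}}) : (forall i, cPP (f i)) ->
  cPP (fun q => \sum_(i < n) f i q).
Proof.
by move=> H l; under eq_fun do rewrite coef_sum; apply: cP_sum => i; exact: H.
Qed.

Lemma cPP_chart d (a b : R) (x : T -> R) (G : T -> {poly {poly R}}) :
  x @ F --> x q0 -> cPP G -> cPP (fun q => chart d a%:P b%:P (x q)%:P (G q)).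
Proof.
move=> cx cG; rewrite /chart /bhom; apply: cPP_sum => k.
under eq_fun do rewrite -mul_polyC; apply: cPPM; first exact/cPPC/cG.
have cxP : cP (fun q => (x q)%:P) by exact: cPC.
apply: cPPM; apply: cPPX; apply: cPPD; try exact: cPP_cst; apply: cPPC.
- under eq_fun do rewrite -polyCM -polyCN -polyCD; apply: cPC.
  by apply: cvgB; [exact: cvg_cst | apply: cvgM => //; exact: cvg_cst].
- under eq_fun do rewrite -polyCM -polyCD; apply: cPC.
  by apply: cvgD; [exact: cvg_cst | apply: cvgM => //; exact: cvg_cst].
Qed.

Lemma near_lt n (Q : nat -> T -> Prop) : (forall i, (i < n)%N -> \forall q \near F, Q i q) ->
  \forall q \near F, forall i, (i < n)%N -> Q i q.
Proof.
elim: n => [|n IHn] H; first by apply: filterE.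
have H1 := H n (ltnSn n).
have H2 : \forall q \near F, forall i, (i < n)%N -> Q i q.
  by apply: IHn => i i_n; apply: H; rewrite ltnW.
near=> q => i; rewrite ltnS leq_eqVlt => /orP[/eqP->|i_n]; first by near: q.
by move: i i_n; near: q.
Unshelve. all: by end_near.
Qed.

End PolyPolyContinuity.

Section ComplexEvaluation.
Variable R : realType.
Local Notation C := R[i].
Local Notation toC := (real_complex R).

Definition evt (t : C) (p : {poly R}) : C := (map_poly toC p).[t].

Lemma evt_is_additive t : additive (evt t).
Proof. by move=> p q; rewrite /evt rmorphB hornerD hornerN. Qed.
HB.instance Definition _ t := GRing.isAdditive.Build {poly R} C (evt t) (evt_is_additive t).
Lemma evt_is_multiplicative t : multiplicative (evt t).
Proof.
by split=> [p q|]; rewrite /evt ?rmorphM ?hornerM // rmorph1 hornerC.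
Qed.
HB.instance Definition _ t := GRing.isMultiplicative.Build {poly R} C (evt t)
  (evt_is_multiplicative t).

Lemma evtC t c : evt t c%:P = toC c.
Proof. by rewrite /evt map_polyC hornerC. Qed.

Variable m : nat.
Implicit Types (s v : 'I_m -> R) (P : {poly {mpoly R[m]}}).

Definition lineP s v P : {poly {poly R}} := map_poly (line s v) P.

Lemma coef_line_0 s v f : (line s v f)`_0 = f.@[s].
Proof.
rewrite -horner_coef0 horner_line; apply: meval_eq => i; by rewrite mul0r addr0.
Qed.

Lemma discC_line d s v P t : discC d (map_poly (evt t) (lineP s v P)) = evt t (line s v (disc d P)).
Proof.
rewrite /disc -[RHS]/((evt t \o line s v) _) rmorph_mmap; apply: eq_mmap => [c|i] /=.
  by rewrite lineC evtC.
by rewrite !coef_map.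
Qed.

(** The chart is a polynomial in [z] over polynomials in [t]; fixing [t] first turns it into the
    chart of a complex form, where [mob_simple_roots] applies. *)
Lemma Fam_chart d a b x (G : {poly {poly R}}) t :
  Fam d.+1 (fun l => map_poly toC (chart d a b x G)`_l) t =
  chart d (evt t a) (evt t b) (evt t x) (map_poly (evt t) G).
Proof.
rewrite -map_chart; apply/polyP => l; rewrite coef_poly coef_map.
case: ltnP => // dl; rewrite nth_default ?raddf0 // (leq_trans (size_chart _ _ _ _ _)) //.
Qed.

Lemma simple_roots_comp (Q : {poly C}) (a x : C) : a != 0 -> simple_roots Q ->
  simple_roots (Q \Po (a *: 'X + x%:P)).
Proof.
move=> a0 sQ z; rewrite rootE horner_comp => /sQ h.
by rewrite deriv_comp hornerM horner_comp derivD derivZ derivX derivC addr0 hornerZ hornerC mulr1 mulf_neq0.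
Qed.

Lemma mup_map (p : {poly R}) x : p != 0 -> mup (toC x) (map_poly toC p) = mup x p.
Proof.
move=> p0; have q0 : map_poly toC p != 0 by rewrite map_poly_eq0.
have E k : (k <= mup (toC x) (map_poly toC p))%N = (k <= mup x p)%N.
  rewrite !mup_geq // -(dvdp_map toC) rmorphXn /= rmorphB /=.
  by rewrite map_polyX map_polyC.
by apply/eqP; rewrite eqn_leq -E leqnn E leqnn.
Qed.

End ComplexEvaluation.

Lemma coef0_chart (R : realType) m d (a b x : R) (s v : 'I_m -> R) (P : {poly {mpoly R[m]}}) :
  \poly_(l < d.+1) (chart d a%:P b%:P x%:P (lineP s v P))`_l`_0 =
  chart d a b x (map_poly (meval s) P).
Proof.
have -> : chart d a b x (map_poly (meval s) P) =
    map_poly (horner_eval 0) (chart d a%:P b%:P x%:P (lineP s v P)).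
  have h0 c : horner_eval (0 : R) c%:P = c by rewrite /horner_eval hornerC.
  rewrite map_chart /= !h0; congr (chart _ _ _ _ _).
  by apply/polyP => l; rewrite !coef_map /= /horner_eval horner_coef0 coef_line_0.
apply/polyP => l; rewrite coef_poly coef_map /= /horner_eval horner_coef0.
by case: ltnP => // dl; rewrite [_`_l]nth_default ?coef0 // (leq_trans (size_chart _ _ _ _ _)).
Qed.

(** * Non-splitting for real families *)

Section LocalFamilies.
Variable R : realType.
Local Notation C := R[i].
Local Notation toC := (real_complex R).
Variables (T : Type) (F : set_system T) (q0 : T).
Context {FF : Filter F}.
Hypothesis Fq0 : forall A : set T, F A -> A q0.

(** The root given by [nonsplitting] is the only one in a disc symmetric under conjugation, and
    [Q q] has real coefficients, so that root is real. *)
Lemma near_nonsplitting n (c : nat -> T -> {poly R}) (eps : R) :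
  let Q q : {poly R} := \poly_(l < n) (c l q)`_0 in
  (forall l, cP F q0 (c l)) -> 0 < eps ->
  (\forall q \near F, forall t : C, 0 < cabs t <= eps ->
     simple_roots (Fam n (fun l => map_poly toC (c l q)) t)) ->
  Q q0 != 0 -> root (Q q0) 0 ->
  exists2 rho0 : R, 0 < rho0 & forall rho, 0 < rho -> rho <= rho0 -> \forall q \near F,
    exists z : R, [/\ `|z| < rho, root (Q q) z, mup z (Q q) = mup 0 (Q q0) &
      forall w : C, cabs w <= rho -> root (map_poly toC (Q q)) w -> w = toC z].
Proof.
move=> Q cc eps0 simp Q0 r0.
have FamE q : Fam n (fun l => map_poly toC (c l q)) 0 = map_poly toC (Q q).
  apply/polyP => l; rewrite coef_map /= !coef_poly; case: ifP => _; last by rewrite rmorph0.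
  by rewrite horner_coef0 coef_map.
have simp0 := Fq0 simp.
have Q0' : Fam n (fun l => map_poly toC (c l q0)) 0 != 0 by rewrite FamE map_poly_eq0.
have r0' : root (Fam n (fun l => map_poly toC (c l q0)) 0) 0.
  by rewrite FamE -(rmorph0 toC) fmorph_root.
have [rho0 rho00 H] := nonsplitting eps0 simp0 Q0' r0'.
exists rho0 => // rho rho_gt0 rho_le.
have [eta eta0 He] := H rho rho_gt0 rho_le.
have close : \forall q \near F, forall l, (l < n)%N -> forall t : C, cabs t <= eps ->
    cabs ((map_poly toC (c l q)).[t] - (map_poly toC (c l q0)).[t]) <= eta.
  by apply: near_lt => l _; exact: near_horner.
near=> q.
have hs : forall t : C, 0 < cabs t <= eps ->
  simple_roots (Fam n (fun l => map_poly toC (c l q)) t) by near: q.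
have hc : forall l, (l < n)%N -> forall t : C, cabs t <= eps ->
    cabs ((map_poly toC (c l q)).[t] - (map_poly toC (c l q0)).[t]) <= eta by near: q.
have [|z [zr rz mz uz]] := He (fun l => map_poly toC (c l q)) _ hs.
  by move=> l t ln; exact: hc.
rewrite !FamE in rz mz uz.
(* A zero polynomial would make every point of the disc a root, against uniqueness. *)
have Qq0 : Q q != 0.
  apply/eqP => e0; have u w : cabs w <= rho -> w = z.
    by move=> wr; apply: uz => //; rewrite e0 map_poly0 root0.
  have := u (toC rho); rewrite cabs_real ger0_norm ?(ltW rho_gt0) // => /(_ (lexx _)) h1.
  have := u 0; rewrite cabs0 => /(_ (ltW rho_gt0)) h2.
  have : cabs (toC rho) = 0 by rewrite h1 -h2 cabs0.
  by rewrite cabs_real => /eqP; rewrite normr_eq0 gt_eqF.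
have zreal : z = toC (complex.Re z).
  have : conjc z = z.
    apply: uz; first by rewrite cabs_conj ltW.
    by rewrite -complex_root_conj -map_poly_comp; rewrite (@eq_map_poly _ _ _ toC) // => u; exact: conjc_real.
  by case: z {zr rz mz uz} => a b [/eqP]; rewrite eqNr => /eqP ->.
exists (complex.Re z); split.
- by move: zr; rewrite {1}zreal cabs_real.
- by move: rz; rewrite {1}zreal fmorph_root.
- by move: mz; rewrite {1}zreal mup_map // -(rmorph0 toC) mup_map.
- by move=> w wr rw; rewrite -zreal; exact: uz.
Unshelve. all: by end_near.
Qed.

Variables (m d : nat) (P : {poly {mpoly R[m]}}) (s v : T -> 'I_m -> R) (e : nat).
Hypothesis cs : forall i, (fun q => s q i) @ F --> s q0 i.
Hypothesis cv : forall i, (fun q => v q i) @ F --> v q0 i.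
Hypothesis szP : (size P <= d.+1)%N.
Hypothesis disc0 : disc d P != 0.
Hypothesis Dlow : \forall q \near F, forall k, (k < e)%N -> (line (s q) (v q) (disc d P))`_k = 0.
Hypothesis De : (line (s q0) (v q0) (disc d P))`_e != 0.
Hypothesis P0 : map_poly (meval (s q0)) P != 0.
Variables (a b : R).
Hypothesis ab0 : a ^+ 2 + b ^+ 2 != 0.

(** Off [t = 0] two things are needed: the discriminant on the line is nonzero, by [near_nonzero] at
    order [e], and the form itself is nonzero, by [near_nonzero] at order 0 for a coefficient that
    does not vanish over [q0]. *)
Lemma near_simple_mob : exists2 eps : R, 0 < eps & \forall q \near F, forall t : C,
  0 < cabs t <= eps ->
  simple_roots (mob d (toC a) (toC b) (map_poly (evt t) (lineP (s q) (v q) P))).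
Proof.
have [l Pl] : exists l, (map_poly (meval (s q0)) P)`_l != 0.
  by exists (size (map_poly (meval (s q0)) P)).-1; rewrite -lead_coefE lead_coef_eq0.
have [e1 e10 H1] := near_nonzero (cP_line (disc d P) cs cv) De Dlow (Fq0 Dlow).
have Pl0 : (line (s q0) (v q0) P`_l)`_0 != 0 by rewrite coef_line_0 -coef_map.
have low0 q k : (k < 0)%N -> (line (s q) (v q) P`_l)`_k = 0 by [].
have low : \forall q \near F, forall k, (k < 0)%N -> (line (s q) (v q) P`_l)`_k = 0.
  by apply: filterE => q; exact: low0.
have [e2 e20 H2] := near_nonzero (cP_line P`_l cs cv) Pl0 low (low0 q0).
have gd0 : generic_disc R d != 0.
  by apply: contraNneq disc0 => g0; rewrite /disc g0 raddf0.
exists (Num.min e1 e2); first by rewrite lt_min e10 e20.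
near=> q => t /andP[t0]; rewrite le_min => /andP[t1 t2].
have h1 : (map_poly toC (line (s q) (v q) (disc d P))).[t] != 0.
  by move: (t) t0 t1; near: q; apply: filterS H1 => q h t' ? ?; apply: h; apply/andP.
have h2 : (map_poly toC (line (s q) (v q) P`_l)).[t] != 0.
  by move: (t) t0 t2; near: q; apply: filterS H2 => q h t' ? ?; apply: h; apply/andP.
apply: mob_simple_roots => //.
- by rewrite (leq_trans (size_poly _ _)) // (leq_trans (size_poly _ _)).
- apply: contraNneq h2 => p0; have := congr1 (fun p : {poly C} => p`_l) p0.
  by rewrite !coef_map coef0 /= => h; apply/eqP; exact: h.
- by rewrite -!rmorphXn -rmorphD fmorph_eq0.
- by rewrite discC_line.
Unshelve. all: by end_near.
Qed.

Lemma near_root : root (mob d a b (map_poly (meval (s q0)) P)) 0 ->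
  exists2 rho0 : R, 0 < rho0 & forall rho, 0 < rho -> rho <= rho0 -> \forall q \near F,
    exists z : R, [/\ `|z| < rho, root (mob d a b (map_poly (meval (s q)) P)) z,
      mup z (mob d a b (map_poly (meval (s q)) P)) = mup 0 (mob d a b (map_poly (meval (s q0)) P)) &
      forall w : R, `|w| <= rho -> root (mob d a b (map_poly (meval (s q)) P)) w -> w = z].
Proof.
move=> r0; have [eps eps0 H] := near_simple_mob.
pose c l q := (chart d a%:P b%:P 0%:P (lineP (s q) (v q) P))`_l.
have cc l : cP F q0 (c l).
  apply: cPP_chart; first exact: cvg_cst.
  have lE k q : (lineP (s q) (v q) P)`_k = line (s q) (v q) P`_k by rewrite coef_map.
  by move=> k; under eq_fun do rewrite lE; exact: cP_line.
have QE q : \poly_(l < d.+1) (c l q)`_0 = mob d a b (map_poly (meval (s q)) P).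
  by rewrite coef0_chart chart0.
have := @near_nonsplitting d.+1 c eps cc eps0; rewrite QE.
case=> [||//|rho0 rho00 Hr].
- near=> q => t tt; rewrite Fam_chart !evtC rmorph0 chart0.
  by move: (t) tt; near: q.
- have := mobK a b (_ : (size (map_poly (meval (s q0)) P) <= d.+1)%N).
  move=> /(_ (leq_trans (size_poly _ _) szP)) K; apply: contraNneq P0 => m0.
  move: K; rewrite m0 /mob /bhom big1 => [|k _]; last by rewrite coef0 scale0r.
  by move/esym/eqP; rewrite scaler_eq0 expf_eq0 (negPf ab0) andbF.
exists rho0 => // rho r1 r2; have := Hr rho r1 r2; apply: filterS => q [z]; rewrite QE.
move=> [h1 h2 h3 h4]; exists z; split=> // w wr rw.
have [] : toC w = toC z by apply: h4; rewrite ?cabs_real ?fmorph_root.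
by [].
Unshelve. all: by end_near.
Qed.

End LocalFamilies.

(** * Newton polygons *)

Lemma coef_mup0 (K : fieldType) (p : {poly K}) : p != 0 ->
  p`_(mup 0 p) != 0 /\ forall l, (l < mup 0 p)%N -> p`_l = 0.
Proof.
move=> p0; have X0 : 'X - 0%:P = 'X :> {poly K} by rewrite subr0.
have low : forall l, (l < mup 0 p)%N -> p`_l = 0.
  move=> l lm; have : 'X^(mup 0 p) %| p by rewrite -X0 -mup_geq.
  by move/dvdpP => [q ->]; rewrite coefMXn lm.
split=> //; apply/negP => /eqP pm.
have : (mup 0 p < mup 0 p)%N.
  rewrite mup_geq // X0; apply/dvdpP; exists (drop_poly (mup 0 p).+1 p).
  rewrite -[LHS](poly_take_drop (mup 0 p).+1) -[RHS]add0r; congr (_ + _).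
  apply/polyP => k; rewrite coef_take_poly coef0; case: ifP => //.
  by rewrite ltnS leq_eqVlt => /orP[/eqP->|/low].
by rewrite ltnn.
Qed.

(** There are [M] distinct [M]-th roots of unity, and at most [j] of them are roots of
    ['X^j - 1]. *)
Lemma unity_root_pow (R : realType) (M j : nat) : (0 < j < M)%N ->
  exists2 w : R[i], w ^+ M = 1 & w ^+ j != 1.
Proof.
move=> /andP[j0 jM]; have M0 : (0 < M)%N by rewrite (leq_trans _ jM).
apply: contrapT => H.
have {}H w : w ^+ M = 1 -> w ^+ j = 1 :> R[i].
  by move=> wM; apply: contrapT => wj; apply: H; exists w => //; apply/eqP.
have [rs Ers] := closed_field_poly_normal ('X^M - 1 : {poly R[i]}).
have mon : lead_coef ('X^M - 1 : {poly R[i]}) = 1 by exact: lead_coefXnsubC.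
rewrite mon scale1r in Ers.
have srs : size rs = M.
  by have := congr1 (fun p : {poly R[i]} => size p) Ers; rewrite size_prod_XsubC size_XnsubC // => -[].
have urs : uniq rs.
  rewrite -separable.separable_prod_XsubC -Ers cyclotomic.separable_Xn_sub_1 // pnatr_eq0 -lt0n //.
have : (size rs < size ('X^j - 1 : {poly R[i]})%R)%N.
  apply: max_poly_roots urs.
    by rewrite -size_poly_eq0 size_XnsubC.
  apply/allP => w wrs; have : root ('X^M - 1) w by rewrite Ers root_prod_XsubC.
  rewrite !rootE !hornerD !hornerN !hornerXn !hornerC !subr_eq0 => /eqP wM; exact/eqP/H.
by rewrite srs size_XnsubC // ltnS leqNgt jM.
Qed.

Lemma simple_rootsZ (R : realType) (k : R[i]) (p : {poly R[i]}) : k != 0 ->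
  simple_roots (k *: p) -> simple_roots p.
Proof.
move=> k0 sp z rz; have := sp z; rewrite rootZ // => /(_ rz).
by rewrite derivZ hornerZ mulf_eq0 negb_or => /andP[].
Qed.

Section NewtonPolygon.
Variable R : realType.
Local Notation C := R[i].
Local Notation toC := (real_complex R).
Variables (T : Type) (F : set_system T) (q0 : T).
Context {FF : Filter F}.
Hypothesis Fq0 : forall A : set T, F A -> A q0.
Variables (d : nat) (b : nat -> T -> {poly R}) (eps : R).
Hypothesis bc : forall l, cP F q0 (b l).
Hypothesis bd : forall l q, (d < l)%N -> b l q = 0.
Hypothesis eps0 : 0 < eps.
Hypothesis bs : \forall q \near F, forall t : C, 0 < cabs t <= eps ->
  simple_roots (Fam d.+1 (fun l => map_poly toC (b l q)) t).
Hypothesis b00 : \forall q \near F, (b 0%N q)`_0 = 0.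
Hypothesis bnz : \forall q \near F, exists l, (b l q)`_0 != 0.

Let M := d`!.
Let M0 : (0 < M)%N. Proof. exact: fact_gt0. Qed.

(* The monomial t^k z^l has weight M k + j l: as j grows from 0 to M, the weight passes from
   M times the t-degree to M times the total degree. *)
Definition supp_min (j h : nat) q :=
  (forall l k, (b l q)`_k != 0 -> (h <= M * k + j * l)%N) /\
  exists l k, (b l q)`_k != 0 /\ h = (M * k + j * l)%N.

(** The coefficients, in the variable [r], of [r^(-h) G(r^M, r^j z)]. When [h] is the minimal
    weight, [drop_poly] divides exactly. *)
Let c j h l q := drop_poly h ((b l q \Po 'X^M) * 'X^(j * l)).

Let cE j h l k q : (M * k + j * l = h)%N -> (c j h l q)`_0 = (b l q)`_k.
Proof.
move=> <-; rewrite coef_drop_poly add0n coefMXn ltnNge leq_addl /= addnK.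
by rewrite coef_comp_poly_Xn // dvdn_mulr // mulKn.
Qed.

Let mon_nz j l q i : (((b l q \Po 'X^M) * 'X^(j * l))`_i != 0) ->
  exists2 k, (b l q)`_k != 0 & i = (M * k + j * l)%N.
Proof.
rewrite coefMXn; case: ltnP => [|ji]; first by rewrite eqxx.
rewrite coef_comp_poly_Xn //; case: ifP => [/dvdnP[k Ek]|]; last by rewrite eqxx.
rewrite Ek mulnK // => bk; exists k => //; by rewrite -[LHS](subnK ji) Ek mulnC.
Qed.

Let cE0 j h l q : (c j h l q)`_0 != 0 -> exists2 k, (b l q)`_k != 0 & (M * k + j * l = h)%N.
Proof. by rewrite coef_drop_poly add0n => /mon_nz[k bk ->]; exists k. Qed.

Let c_drop j h l q : supp_min j h q -> (b l q \Po 'X^M) * 'X^(j * l) = c j h l q * 'X^h.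
Proof.
move=> [low _]; rewrite -[LHS](poly_take_drop h) -[RHS]add0r; congr (_ + _).
apply/polyP => i; rewrite coef_take_poly coef0; case: ifP => // ih.
apply/eqP; apply: contraTT ih => /mon_nz[k /low hk ->]; by rewrite -leqNgt.
Qed.

Let Fam_c j h q r : supp_min j h q ->
  Fam d.+1 (fun l => map_poly toC (b l q)) (r ^+ M) \Po (r ^+ j *: 'X + 0%:P) =
  r ^+ h *: Fam d.+1 (fun l => map_poly toC (c j h l q)) r.
Proof.
move=> sm; rewrite addr0 /Fam !poly_def raddf_sum /= scaler_sumr; apply: eq_bigr => l _.
rewrite comp_polyZ comp_Xn_poly exprZn !scalerA; congr (_ *: _).
have := congr1 (fun p : {poly R} => (map_poly toC p).[r]) (c_drop l sm).
rewrite /= !rmorphM /= !map_polyXn !hornerM !hornerXn -exprM => E.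
rewrite [RHS]mulrC -E; congr (_ * _).
by rewrite map_comp_poly map_polyXn horner_comp hornerXn.
Qed.

(** [Q q] is the edge polynomial, the part of weight [h] with [t] set to 1, and it is also the new
    family at [r = 0]. The next minimal weight is [h] plus its order [m] at [z = 0]. Non-splitting
    fixes the multiplicity of its root near 0, and it remains to see that this root is 0 itself. *)
Lemma supp_min_step j h : (j < M)%N -> (\forall q \near F, supp_min j h q) ->
  exists h', \forall q \near F, supp_min j.+1 h' q.
Proof.
move=> jM H.
pose Q q : {poly R} := \poly_(l < d.+1) (c j h l q)`_0.
have QE q l : (Q q)`_l = (c j h l q)`_0.
  rewrite coef_poly; case: ltnP => // dl.
  by rewrite coef_drop_poly bd // comp_poly0 mul0r coef0.
have Qnz q : supp_min j h q -> Q q != 0.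
  move=> [_ [l [k [bk E]]]]; apply: contraNneq bk => Q0.
  by rewrite -(cE q (esym E)) -QE Q0 coef0.
have cc l : cP F q0 (c j h l).
  by apply: cP_drop; apply: cPM; [exact: cP_comp_Xn | exact: cP_cst].
have cs : \forall q \near F, forall r : C, 0 < cabs r <= Num.min 1 eps ->
    simple_roots (Fam d.+1 (fun l => map_poly toC (c j h l q)) r).
  near=> q => r /andP[r0]; rewrite le_min => /andP[r1 r2].
  have rn0 : r != 0 by rewrite -cabs_gt0.
  have sm : supp_min j h q by near: q.
  apply: (@simple_rootsZ _ (r ^+ h)); first by rewrite expf_neq0.
  rewrite -Fam_c //; apply: simple_roots_comp; first by rewrite expf_neq0.
  have : 0 < cabs (r ^+ M) <= eps.
    rewrite cabsX exprn_gt0 //= (le_trans _ r2) // -{2}[cabs r]expr1.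
    by rewrite ler_wiXn2l // ltW.
  by move: (r ^+ M); near: q.
have e0 : 0 < Num.min 1 eps by rewrite lt_min ltr01.
have sm0 := Fq0 H.
pose m := mup 0 (Q q0).
have mE : \forall q \near F, (Q q)`_m != 0 /\ forall l, (l < m)%N -> (Q q)`_l = 0.
  have [r0|r0] := boolP (root (Q q0) 0); last first.
    have [_ lowm] := coef_mup0 (Qnz _ sm0).
    have m0 : m = 0%N.
      apply/eqP; rewrite -leqn0 leqNgt; apply: contra r0 => /lowm.
      by rewrite rootE horner_coef0 => ->.
    rewrite m0; have Q00 : (Q q0)`_0 != 0 by rewrite -horner_coef0.
    have Q0p : 0 < `|(Q q0)`_0| by rewrite normr_gt0.
    have NC := near_coef 0 (cc 0%N) Q0p.
    near=> q; have lt : `|(c j h 0%N q)`_0 - (c j h 0%N q0)`_0| < `|(Q q0)`_0| by near: q; exact: NC.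
    rewrite -!QE in lt; split=> //.
    by apply: contraTneq lt => ->; rewrite sub0r normrN ltxx.
  have [rho0 rho00 Hr] := near_nonsplitting Fq0 cc e0 cs (Qnz _ sm0) r0.
  have := Hr _ rho00 (lexx _) => Hq.
  near=> q; have sm : supp_min j h q by near: q.
  have [z [zr rz mz uz]] : exists z : R, [/\ `|z| < rho0, root (Q q) z,
      mup z (Q q) = mup 0 (Q q0) &
      forall w : C, cabs w <= rho0 -> root (map_poly toC (Q q)) w -> w = toC z].
    by near: q; exact: Hq.
  suff z0 : z = 0 by rewrite /m -mz z0; apply: coef_mup0; exact: Qnz.
  (* For [j = 0] the edge polynomial is the form over [q] at [t = 0], which vanishes at 0 by
     [b00]. *)
  have [j0|j0] := posnP j.
    have rQ : root (map_poly toC (Q q)) 0.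
      rewrite -(rmorph0 toC) fmorph_root rootE horner_coef0 QE.
      have h0 : h = 0%N.
        have [l bl] : exists l, (b l q)`_0 != 0 by near: q.
        by have [low _] := sm; have := low _ _ bl; rewrite j0 muln0 mul0n leqn0 => /eqP.
      by rewrite (@cE j h 0%N 0%N) ?h0 ?muln0 //; apply/eqP; near: q.
    have := uz 0 _ rQ; rewrite cabs0 => /(_ (ltW rho00)) /esym/eqP.
    by rewrite fmorph_eq0 => /eqP.
  (* Since all its monomials have weight [h], [Q q] is multiplied by [w ^+ h] when [z] is turned by
     [w ^+ j]; a unique root near 0 that is preserved by a nontrivial rotation is 0. *)
  have [w wM wj] : exists2 w : C, w ^+ M = 1 & w ^+ j != 1 by apply: unity_root_pow; rewrite j0.
  have cw : cabs (w ^+ j) = 1.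
    have : cabs w ^+ M = 1 by rewrite -cabsX wM cabs1.
    move/eqP; rewrite pexpr_eq1 ?cabs_ge0 // => /eqP h1; by rewrite cabsX h1 expr1n.
  have Qw t : (map_poly toC (Q q)).[w ^+ j * t] = w ^+ h * (map_poly toC (Q q)).[t].
    have sQ : (size (map_poly toC (Q q)) <= d.+1)%N.
      by rewrite (leq_trans (size_poly _ _)) // size_poly.
    rewrite !(horner_coef_wide _ sQ) mulr_sumr; apply: eq_bigr => l _.
    rewrite coef_map QE /= exprMn mulrA [RHS]mulrA; congr (_ * _); rewrite mulrC.
    have [->|/cE0[k bk <-]] := eqVneq (c j h l q)`_0 0; first by rewrite rmorph0 !mulr0.
    by rewrite exprD exprM wM expr1n mul1r -exprM.
  have : w ^+ j * toC z = toC z.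
    apply: uz; first by rewrite cabsM cw mul1r cabs_real ltW.
    by rewrite rootE Qw mulf_eq0; apply/orP; right; rewrite -rootE fmorph_root.
  move/eqP; rewrite -subr_eq0 -[X in _ - X]mul1r -mulrBl mulf_eq0 subr_eq0 (negPf wj) /=.
  by rewrite fmorph_eq0 => /eqP.
exists (h + m)%N; near=> q.
have [low [l0 [k0 [bl0 El0]]]] : supp_min j h q by near: q.
have [Qm Ql] : (Q q)`_m != 0 /\ forall l, (l < m)%N -> (Q q)`_l = 0 by near: q.
move: Qm; rewrite QE => /cE0[km bm Em]; split; last first.
  by exists m, km; split=> //; rewrite -Em mulSn addnAC addnA.
move=> l k bk; have hk := low _ _ bk.
have [ml|lm] := leqP m l; first by rewrite mulSn addnA addnAC leq_add.
have neq : (M * k + j * l != h)%N.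
  by apply/eqP => E; have := Ql l lm; rewrite QE (cE q E) => /eqP; rewrite (negPf bk).
(* m - l divides M, hence also the positive gap M k + j l - h *)
have md : (m <= d)%N.
  by rewrite leqNgt; apply: contraNN bm => /bd ->; rewrite coef0.
have /dvdnP[u Eu] : (m - l %| M)%N by apply: dvdn_fact; rewrite subn_gt0 lm (leq_trans (leq_subr _ _)).
rewrite mulSn.
have [y Ey] : exists y, m = (l + y.+1)%N by exists (m - l).-1; lia.
have E1 : (m - l = y.+1)%N by lia.
rewrite E1 in Eu.
have lt : (h < M * k + j * l)%N by lia.
have : (y.+1 %| M * k + j * l - h)%N.
  have -> : (M * k + j * l - h = M * k - (M * km + j * y.+1))%N.
    by rewrite -Em Ey mulnDr; lia.
  have yM : (y.+1 %| M)%N by rewrite Eu dvdn_mull.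
  by apply: dvdn_sub; [|apply: dvdn_add]; [exact: dvdn_mulr .. | exact: dvdn_mull].
move/dvdn_leq; rewrite subn_gt0 lt => /(_ isT) hy; lia.
Unshelve. all: by end_near.
Qed.

(** The chain starts at weight 0, attained by [bnz], and ends at [j = M], where [M] divides every
    weight and the quotient is a total degree. *)
Lemma near_order : exists o, \forall q \near F,
  (forall l k, (b l q)`_k != 0 -> (o <= k + l)%N) /\
  exists l k, (b l q)`_k != 0 /\ o = (k + l)%N.
Proof.
have H j : (j <= M)%N -> exists h, \forall q \near F, supp_min j h q.
  elim: j => [_|j IHj jM].
    exists 0%N; apply: (@filterS _ _ FF _ _ _ bnz) => q [l bl]; split=> //.
    by exists l, 0%N; rewrite mul0n muln0.
  by have [h Hh] := IHj (ltnW jM); exact: (supp_min_step jM Hh).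
have [h Hh] := H M (leqnn M).
have [_ [l0 [k0 [_ E0]]]] := Fq0 Hh; exists (k0 + l0)%N; apply: (@filterS _ _ FF _ _ _ Hh) => q [low [l [k [bk E]]]].
have Eh : h = (M * (k0 + l0))%N by rewrite mulnDr.
split=> [l' k' /low|]; first by rewrite Eh -mulnDr leq_pmul2l.
by exists l, k; split=> //; apply/eqP; rewrite -(eqn_pmul2l M0) -Eh E mulnDr.
Qed.

End NewtonPolygon.

(** * Homogenization restricted to lines *)

Section Homogenize.
Variables (R : realType) (m : nat).
Implicit Types (s v : 'rV[R]_m) (P : {poly {mpoly R[m]}}).

Lemma pt3_lift s (u y : R) (i : 'I_m) : pt3 s u y (widen_ord (leqW (leqnSn m)) i) = s ord0 i.
Proof. by rewrite /pt3 insubT //= => h; congr (s _ _); apply: val_inj. Qed.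

Lemma pt3_xn s (u y : R) : pt3 s u y (idx_xn m) = u.
Proof. by rewrite /pt3 insubF ?ltnn // eqxx. Qed.

Lemma pt3_y s (u y : R) : pt3 s u y (idx_y m) = y.
Proof. by rewrite /pt3 insubF /= ?ltnNge ?leqnSn // -val_eqE /= gtn_eqF. Qed.

Lemma pt3_eta (w : 'I_m.+2 -> R) :
  w =1 pt3 (\row_j w (widen_ord (leqW (leqnSn m)) j)) (w (idx_xn m)) (w (idx_y m)).
Proof.
move=> i; rewrite /pt3; case: insubP => [j ij jE|]; last rewrite -leqNgt.
  by rewrite mxE; congr w; apply: val_inj.
have := ltn_ord i; rewrite ltnS leq_eqVlt => /orP[/eqP iE _|]; last first.
  rewrite ltnS => im mi; have -> : i = idx_xn m by apply: val_inj; apply/eqP; rewrite eqn_leq im.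
  by rewrite eqxx.
have -> : i = idx_y m by apply: val_inj.
by rewrite -val_eqE /= gtn_eqF.
Qed.

Lemma line_liftx s v (u y u' y' : R) (c : {mpoly R[m]}) :
  line (pt3 s u y) (pt3 v u' y') (liftx c) = line (coords s) (coords v) c.
Proof.
rewrite /liftx rmorph_mmap; apply: eq_mmap => [k|i] /=; first by rewrite lineC.
by rewrite lineX !pt3_lift.
Qed.

Lemma line_homogenize s v (u y u' y' : R) d P :
  line (pt3 s u y) (pt3 v u' y') (homogenize d P) =
  bhom d (u%:P + u' *: 'X : {poly R}^o) (y%:P + y' *: 'X : {poly R}^o) (lineP (coords s) (coords v) P).
Proof.
rewrite /homogenize /bhom rmorph_sum /=; apply: eq_bigr => k _.
by rewrite !rmorphM !rmorphXn /= !lineX !pt3_xn !pt3_y line_liftx -mulrA coef_map.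
Qed.

(** The direction in the last two coordinates is split into a radial part [l1], along the point
    itself, and a tangential part [m1], along [(- b, a)]. For nonzero [c] the radial part only
    contributes powers of [c + l1 t], invertible at [t = 0], so the order is governed by the
    chart. *)
Lemma line_homogenize_chart s v (a b x c l1 m1 : R) d P :
  line (pt3 s (c * (a - b * x)) (c * (b + a * x)))
       (pt3 v (l1 * (a - b * x) - m1 * b) (l1 * (b + a * x) + m1 * a)) (homogenize d P) =
  \sum_(l < d.+1) (chart d a%:P b%:P x%:P (lineP (coords s) (coords v) P))`_l *
    ((m1 *: 'X) ^+ l * (c%:P + l1 *: 'X) ^+ (d - l)).
Proof.
rewrite line_homogenize; set p := lineP _ _ P.
rewrite -[RHS]/(bhom d (m1 *: 'X : {poly R}^o) (c%:P + l1 *: 'X : {poly R}^o) (chart d _ _ _ p)).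
rewrite /chart hom_comp ?size_lin ?size_linN // !hom1E.
rewrite !coefD !coefN !coefZ !coefC !coefX /=.
have E (A A' B B' : {poly R}^o) : A = A' -> B = B' -> bhom d A B p = bhom d A' B' p by move=> -> ->.
have scE (k q : {poly R}) : k *: (q : {poly R}^o) = k * q by [].
apply: E; rewrite !scE -!mul_polyC;
  rewrite !(rmorphD, rmorphB, rmorphM, rmorph0, rmorph1) /=; ring.
Qed.

End Homogenize.

Lemma poly_small_roots (R : realType) (p : {poly R}) (eps : R) : 0 < eps ->
  (forall t, 0 < t < eps -> p.[t] = 0) -> p = 0.
Proof.
move=> e0 H; apply/eqP; apply: contrapT => /negP p0.
pose rs := [seq eps / i.+2%:R | i <- iota 0 (size p)].
have urs : uniq rs.
  rewrite map_inj_uniq ?iota_uniq // => i j /(mulfI (lt0r_neq0 e0)) /invr_inj /eqP.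
  by rewrite eqr_nat => /eqP[].
have ars : all (root p) rs.
  apply/allP => _ /mapP[i _ ->]; apply/eqP/H; rewrite divr_gt0 //=.
  by rewrite ltr_pdivrMr // ltr_pMr // ltr1n.
by have := max_poly_roots p0 ars urs; rewrite size_map size_iota ltnn.
Qed.

Lemma coefM_low (K : nzRingType) (p q : {poly K}) i j k :
  (forall n, (n < i)%N -> p`_n = 0) -> (forall n, (n < j)%N -> q`_n = 0) -> (k < i + j)%N ->
  (p * q)`_k = 0.
Proof.
move=> hp hq kij; rewrite coefM big1 // => n _.
have [ni|ni] := ltnP n i; first by rewrite hp ?mul0r.
by rewrite hq ?mulr0 // ltn_subLR ?(leq_trans kij) ?leq_add2r // -ltnS.
Qed.

Lemma mob_neq0 (K : fieldType) d (a b : K) (p : {poly K}) : (size p <= d.+1)%N ->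
  a ^+ 2 + b ^+ 2 != 0 -> p != 0 -> mob d a b p != 0.
Proof.
move=> sp ab0 p0; have K' := mobK a b sp; apply: contraNneq p0 => m0.
move: K'; rewrite m0 /mob /bhom big1 => [|k _]; last by rewrite coef0 scale0r.
by move/esym/eqP; rewrite scaler_eq0 expf_eq0 (negPf ab0) andbF.
Qed.

(** * The order along a root *)

Section OrderNearRoot.
Variables (R : realType) (m d : nat) (P : {poly {mpoly R[m]}}) (S : set 'rV[R]_m).
Variables (p : 'rV[R]_m) (e : nat) (a b : R) (x : 'rV[R]_m -> R).
Local Notation toC := (real_complex R).
Hypothesis szP : (size P <= d.+1)%N.
Hypothesis disc0 : disc d P != 0.
Hypothesis hN : forall s, S s -> evalx s P != 0.
Hypothesis hD : forall s, S s -> has_ord (disc d P) (coords s) (Some e).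
Hypothesis ab0 : a ^+ 2 + b ^+ 2 != 0.
Hypothesis Sp : S p.
Hypothesis xc : x @ within S (nbhs p) --> x p.
Hypothesis xr : \forall s \near within S (nbhs p), root (mob d a b (evalx s P)) (x s).

Let bb l (q : 'rV[R]_m * 'rV[R]_m) : {poly R} :=
  (chart d a%:P b%:P (x q.1)%:P (lineP (coords q.1) (coords q.2) P))`_l.

(** Both the point and the direction vary: the filter is a product, so the conclusion holds for a
    neighbourhood of directions at once. The direction [v0] is one in which the discriminant has
    order exactly [e] at [p]. *)
Lemma near_chart_order : exists o (v0 : 'rV[R]_m),
  \forall q \near filter_prod (within S (nbhs p)) (nbhs v0),
  (forall l k, (bb l q)`_k != 0 -> (o <= k + l)%N) /\
  exists l k, (bb l q)`_k != 0 /\ o = (k + l)%N.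
Proof.
have [_ [w0 w0P]] := (has_ordP _ _ _).1 (hD Sp).
pose v0 : 'rV[R]_m := \row_i w0 i.
have cv0 : coords v0 =1 w0 by move=> i; rewrite /coords mxE.
have {w0P}De : (line (coords p) (coords v0) (disc d P))`_e != 0.
  rewrite (_ : line _ _ _ = line (coords p) w0 (disc d P)) //.
  by apply: eq_mmap => // i; rewrite cv0.
pose F := filter_prod (within S (nbhs p)) (nbhs v0).
have FF : Filter F by exact: filter_prod_filter.
have Fq0 (A : set ('rV[R]_m * 'rV[R]_m)) : F A -> A (p, v0).
  move=> [[U V] /= [HU HV]]; apply; split => /=; last exact: nbhs_singleton HV.
  exact: (nbhs_singleton HU).
have nf (A : set 'rV[R]_m) : (\forall s \near within S (nbhs p), A s) -> \forall q \near F, A q.1.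
  by move=> h; exact: cvg_fst h.
have c1 i : (fun q => coords q.1 i) @ F --> coords (p, v0).1 i.
  apply: (@cvg_comp _ _ _ fst (fun s => coords s i) F (within S (nbhs p))); first exact: cvg_fst.
  by apply: cvg_within_filter; exact: coord_continuous.
have c2 i : (fun q => coords q.2 i) @ F --> coords (p, v0).2 i.
  apply: (@cvg_comp _ _ _ snd (fun s => coords s i) F (nbhs v0)); first exact: cvg_snd.
  exact: coord_continuous.
have cx : (fun q : 'rV[R]_m * 'rV[R]_m => x q.1) @ F --> x (p, v0).1.
  by apply: (@cvg_comp _ _ _ fst x F (within S (nbhs p))); first exact: cvg_fst.
have nS : \forall q \near F, S q.1 by apply: nf; exact: near_withinT.
have low : \forall q \near F, forall k, (k < e)%N -> (line (coords q.1) (coords q.2) (disc d P))`_k = 0.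
  apply: (@filterS _ _ FF _ _ _ nS) => q Sq k ke.
  by have [l _] := (has_ordP _ _ _).1 (hD Sq); exact: l.
have szE s : (size (evalx s P) <= d.+1)%N by rewrite (leq_trans (size_poly _ _)).
have [eps eps0 Hs] := near_simple_mob Fq0 c1 c2 szP disc0 low De (hN Sp) ab0.
have [|l q dl||||o Ho] := @near_order _ _ F (p, v0) FF Fq0 d bb eps _ _ eps0; last by exists o, v0.
- move=> l; apply: cPP_chart => // k.
  have lE q : (lineP (coords q.1) (coords q.2) P)`_k = line (coords q.1) (coords q.2) P`_k by rewrite coef_map.
  by under eq_fun do rewrite lE; exact: cP_line.
- by rewrite /bb nth_default // (leq_trans (size_chart _ _ _ _ _)).
- apply: (@filterS _ _ FF _ _ _ Hs) => q sq t tt; rewrite Fam_chart !evtC chart_comp.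
  by rewrite -['X]scale1r; apply: simple_roots_comp; [exact: oner_neq0 | exact: sq].
- have xr' := nf _ xr; apply: (@filterS _ _ FF _ _ _ xr') => q /= rq.
  have := congr1 (fun p : {poly R} => p`_0) (coef0_chart d a b (x q.1) (coords q.1) (coords q.2) P).
  rewrite coef_poly /= /bb => ->; rewrite chart_comp -horner_coef0 horner_comp hornerD hornerX hornerC add0r.
  exact/eqP.
- apply: (@filterS _ _ FF _ _ _ nS) => q Sq; apply: contrapT => H.
  have : mob d a b (evalx q.1 P) != 0 by apply: mob_neq0 => //; exact: hN.
  rewrite -(comp_polyXaddC_K (mob _ _ _ _) (x q.1)) -chart_comp.
  rewrite -(coef0_chart d a b (x q.1) (coords q.1) (coords q.2) P).
  rewrite (_ : \poly_(l < d.+1) _ = 0) ?comp_poly0 ?eqxx //.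
  apply/polyP => l; rewrite coef_poly coef0; case: ifP => // _.
  by apply: contrapT => h; apply: H; exists l; apply/eqP.
Qed.

(** The order is at most [n] because some tangential speed [m1] avoids the zeros of the degree [n]
    part. It is at least [n] because each lower coefficient is a polynomial in the direction that
    vanishes near [v0], hence everywhere. *)
Lemma near_has_ord_homogenize : exists o, \forall s \near within S (nbhs p), forall c : R, c != 0 ->
  has_ord (homogenize d P) (pt3 s (c * (a - b * x s)) (c * (b + a * x s))) (Some o).
Proof.
have [n [v0 Hn]] := near_chart_order.
case: Hn => -[U V] /= [HU HV] sub.
exists n; apply: filterS HU => s Us c c0.
have HV' v : V v -> (forall l k, (bb l (s, v))`_k != 0 -> (n <= k + l)%N) /\
  exists l k, (bb l (s, v))`_k != 0 /\ n = (k + l)%N by move=> Vv; exact: (sub (s, v)).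
pose A := a - b * x s; pose B := b + a * x s.
rewrite -/A -/B; apply/has_ordP; split=> [j w jo|]; last first.
  have [_ [l0 [k0 [bl0 ol]]]] := HV' _ (nbhs_singleton HV).
  (* With radial speed 0 the coefficient of [t^n] on the line is [N] evaluated at [m1]. *)
  pose N : {poly R} := \poly_(l < d.+1) ((if (n < l)%N then 0 else (bb l (s, v0))`_(n - l)) * c ^+ (d - l)).
  have N0 : N != 0.
    apply/eqP => /(congr1 (fun q : {poly R} => q`_l0)); rewrite coef0 coef_poly.
    have -> : (l0 < d.+1)%N.
      rewrite ltnNge; apply: contraNN bl0 => dl.
      by rewrite /bb [(chart _ _ _ _ _)`_l0]nth_default ?coef0 // (leq_trans (size_chart _ _ _ _ _)).
    rewrite ol ltnNge leq_addl /= addnK => /eqP.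
    by rewrite mulf_eq0 expf_eq0 (negPf c0) (negPf bl0) andbF.
  have [m1 m1N] := poly_nonroot N0.
  exists (pt3 v0 (0 * A - m1 * b) (0 * B + m1 * a)).
  rewrite line_homogenize_chart coef_sum; apply: contraNneq m1N => <-.
  rewrite horner_poly; apply/eqP/eq_bigr => l _.
  rewrite scale0r addr0 exprZn -!mul_polyC -polyC_exp.
  have -> : (m1 ^+ l)%:P * 'X^l * (c ^+ (d - l))%:P = (m1 ^+ l * c ^+ (d - l))%:P * 'X^l :> {poly R}.
    by rewrite rmorphM /= mulrAC.
  by rewrite mulrCA coefCM coefMXn -/(bb l (s, v0)); case: ltnP => _; ring.
pose H := homogenize d P; set pt := pt3 s _ _.
have [Gj GjE] : exists G : {mpoly R[m.+2]}, forall w, (line pt w H)`_j = G.@[w].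
  by eexists => w'; rewrite line_transl; exact: coef_line0.
have ext (w1 w2 : 'I_m.+2 -> R) : w1 =1 w2 -> Gj.@[w1] = Gj.@[w2] by move=> h; apply: meval_eq.
have GV v u y : V v -> Gj.@[pt3 v u y] = 0.
  move=> Vv; have [lo _] := HV' v Vv; rewrite -GjE.
  (* Coordinates of [(u, y)] in the basis [(A, B)], [(- b, a)], of determinant [a ^+ 2 + b ^+ 2]. *)
  pose l1 := (a * u + b * y) / (a ^+ 2 + b ^+ 2); pose m1 := (A * y - B * u) / (a ^+ 2 + b ^+ 2).
  have -> : u = l1 * A - m1 * b by rewrite /l1 /m1 /A /B; field.
  have -> : y = l1 * B + m1 * a by rewrite /l1 /m1 /A /B; field.
  rewrite line_homogenize_chart coef_sum big1 // => l _.
  apply: (@coefM_low _ _ _ (n - l)%N l).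
  - move=> k kl; apply/eqP; apply: contraTT kl => /lo h; rewrite -leqNgt; lia.
  - by move=> k kl; rewrite exprZn -scalerAl coefZ coefXnM kl mulr0.
  - by move: jo; clear; lia.
rewrite GjE.
(* On the segment from [w0] towards [w] the direction stays in [V] for small [t], so [L] has
   infinitely many roots. *)
pose w0 := pt3 v0 0 0; pose L := line w0 (fun i => w i - w0 i) Gj.
suff L0 : L = 0.
  have := horner_line w0 (fun i => w i - w0 i) Gj 1; rewrite -/L L0 horner0 => E.
  by rewrite [RHS]E; apply: ext => i; rewrite mul1r addrC subrK.
pose vw : 'rV[R]_m := \row_j w (widen_ord (leqW (leqnSn m)) j).
have cont : (fun t : R => v0 + t *: (vw - v0)) @ nbhs 0 --> v0.
  rewrite -[X in _ --> X]addr0 -(scale0r (vw - v0)).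
  by apply: cvgD; [exact: cvg_cst | apply: cvgZr_tmp; exact: cvg_id].
have /nbhs_ballP[eps /= eps0 Heps] := cont _ HV.
apply: (poly_small_roots eps0) => t /andP[t0 te]; rewrite horner_line.
rewrite (ext _ _ (@pt3_eta R m _)); apply: GV.
have -> : \row_j (w0 (widen_ord (leqW (leqnSn m)) j) + t * (w (widen_ord (leqW (leqnSn m)) j) -
    w0 (widen_ord (leqW (leqnSn m)) j))) = v0 + t *: (vw - v0).
  by apply/rowP => i; rewrite !mxE /w0 pt3_lift.
by apply: Heps; rewrite -ball_normE /= sub0r normrN gtr0_norm.
Qed.

End OrderNearRoot.

(** * Multiplicities of projective roots *)

Section ProjectiveMultiplicity.
Variables (R : realType) (m d : nat).
Implicit Types (s : 'rV[R]_m) (P : {poly {mpoly R[m]}}).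

Lemma evalx_homogE s P :
  evalx_homog d s P = bhom d ('X_(0 : 'I_2) : {mpoly R[2]}) ('X_(1 : 'I_2) : {mpoly R[2]}) (evalx s P).
Proof.
by rewrite /evalx_homog /bhom; apply: eq_bigr => k _; rewrite -mulrA mul_mpolyC coef_map.
Qed.

Definition subst2 (A B : {poly R}) (g : {mpoly R[2]}) : {poly R} :=
  mmap (@polyC R) (fun i : 'I_2 => if i == 0 then A else B) g.

HB.instance Definition _ A B := GRing.isAdditive.Build {mpoly R[2]} {poly R}
  (subst2 A B) (mmap_is_additive _ _).
HB.instance Definition _ A B := GRing.isMultiplicative.Build {mpoly R[2]} {poly R}
  (subst2 A B) (mmap_is_multiplicative _ (@polyC R)).

Lemma subst2X0 A B : subst2 A B 'X_0 = A. Proof. by rewrite /subst2 mmapX mmap1U. Qed.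
Lemma subst2X1 A B : subst2 A B 'X_1 = B. Proof. by rewrite /subst2 mmapX mmap1U. Qed.
Lemma subst2Z A B c g : subst2 A B (c *: g) = c *: subst2 A B g.
Proof. by rewrite -mul_mpolyC rmorphM /= /subst2 mmapC mul_polyC. Qed.

Lemma subst2_bhom A B p : subst2 A B (bhom d 'X_0 'X_1 p) = bhom d A B p.
Proof.
rewrite /bhom rmorph_sum; apply: eq_bigr => k _.
by rewrite /= subst2Z rmorphM !rmorphXn /= subst2X0 subst2X1.
Qed.

(** The power of ['X - x%:P] in the chart is carried back to a power of the linear form [l] by
    [mobK]. Conversely, inserting the chart turns [l] into a nonzero constant times ['X - x%:P], so
    no higher power divides. *)
Lemma proj_root_mult_mob s P (a b x c : R) : (size P <= d.+1)%N -> evalx s P != 0 ->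
  a ^+ 2 + b ^+ 2 != 0 -> c != 0 -> root (mob d a b (evalx s P)) x ->
  proj_root_mult (evalx_homog d s P) (c * (a - b * x)) (c * (b + a * x))
    (mup x (mob d a b (evalx s P))).
Proof.
move=> szP P0 ab0 c0 rx; set p := evalx s P; set q := mob d a b p; set mu := mup _ _.
have sp : (size p <= d.+1)%N by rewrite (leq_trans (size_poly _ _)).
have q0 : q != 0 by apply: mob_neq0.
have mu_dvd : ('X - x%:P) ^+ mu %| q by rewrite -mup_geq.
set u := c * _; set v := c * _.
have phi : subst2 (a%:P - b *: 'X) (b%:P + a *: 'X) (evalx_homog d s P) = q.
  by rewrite evalx_homogE subst2_bhom.
rewrite /proj_root_mult evalx_homogE -/p; split.
- have -> : (bhom d 'X_0 'X_1 p).@[fun i : 'I_2 => if i == 0 then u else v] = c ^+ d * q.[x].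
    rewrite /q horner_mob /bhom raddf_sum mulr_sumr; apply: eq_bigr => k _ /=.
    rewrite mevalZ mevalM !rmorphXn /= !mevalXU /= -[_ *: (_ : R^o)]/(_ * _) /u /v !exprMn.
    have -> : c ^+ d = c ^+ k * c ^+ (d - k) by rewrite -exprD subnKC // -ltnS.
    move: (c ^+ k) (c ^+ (d - k)) (_ ^+ k) (_ ^+ (d - k)) => e1 e2 e3 e4.
    rewrite [RHS]mulrCA; congr (_ * _); exact: mulrACA.
  by move: rx; rewrite rootE -/q => /eqP ->; rewrite mulr0.
- apply: contraNneq q0 => g0; rewrite -phi evalx_homogE -/p g0 raddf0 //.
- have [r Er] := dvdpP _ _ mu_dvd.
  have sq : (size q <= d.+1)%N by exact: size_mob.
  have r0 : r != 0 by apply: contraNneq q0 => r0; rewrite Er r0 mul0r.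
  have szq : size q = (size r + mu)%N.
    by rewrite Er size_Mmonic ?monic_exp ?monicXsubC // size_exp_XsubC addnS.
  have mud : (mu <= d)%N by move: szq sq r0; rewrite -size_poly_gt0; clear; lia.
  have sr : (size r <= (d - mu).+1)%N by move: szq sq; clear -mud; lia.
  have := mobK a b sp; rewrite -/q => K.
  pose l : {mpoly R[2]} := v *: 'X_0 - u *: 'X_1.
  pose U : {mpoly R[2]} := a *: 'X_1 - b *: 'X_0.
  pose V : {mpoly R[2]} := b *: 'X_1 + a *: 'X_0.
  have E1 : bhom d 'X_0 'X_1 (mob d a b q) = bhom d U V q :> {mpoly R[2]}.
    rewrite /mob hom_comp ?size_lin ?size_linN // !hom1E !coefD !coefN !coefZ !coefC !coefX /=.
    by rewrite !mulr0 !mulr1 subr0 addr0 sub0r add0r scaleNr.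
  have lin : bhom 1 U V ('X - x%:P) = (- c^-1) *: l.
    rewrite hom1E !coefD !coefN !coefC !coefX /= sub0r subr0 scale1r /l /U /V /u /v.
    rewrite [RHS]scalerBr !scalerA !mulNr !mulKf // -!mul_mpolyC.
    by rewrite !(rmorphN, rmorphD, rmorphB, rmorphM) /=; ring.
  have E2 : bhom d U V q = l ^+ mu * ((- c^-1) ^+ mu *: bhom (d - mu) U V r).
    have -> : bhom d U V q = bhom (mu + (d - mu)) U V (('X - x%:P) ^+ mu * r) by rewrite subnKC // Er mulrC.
    rewrite hom_mul; [|by rewrite size_exp_XsubC|exact: sr].
    rewrite hom_exp; last by rewrite size_XsubC.
    by rewrite lin exprZn -scalerAl -scalerAr.
  exists (((a ^+ 2 + b ^+ 2) ^+ d)^-1 *: ((- c^-1) ^+ mu *: bhom (d - mu) U V r)).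
  rewrite -scalerAr -/l -E2 -E1 K homZ scalerA mulVf ?scale1r // expf_neq0 //.
- move=> [h Eh].
  have := congr1 (subst2 (a%:P - b *: 'X) (b%:P + a *: 'X)) Eh.
  rewrite -evalx_homogE phi rmorphM rmorphXn /=.
  have -> : subst2 (a%:P - b *: 'X) (b%:P + a *: 'X) (v *: 'X_0 - u *: 'X_1) =
      (- (c * (a ^+ 2 + b ^+ 2)))%:P * ('X - x%:P).
    rewrite rmorphB /= !subst2Z subst2X0 subst2X1 /u /v -!mul_polyC.
    by rewrite !(rmorphN, rmorphD, rmorphB, rmorphM, rmorphXn) /=; ring.
  rewrite exprMn => E; have : (mu < mu)%N.
    rewrite /mu -/q mup_geq //; apply/dvdpP.
    by eexists; rewrite {1}E mulrC mulrA [_ * (_%:P ^+ _)]mulrC.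
  by rewrite ltnn.
Qed.

End ProjectiveMultiplicity.

(** * Projective roots as points of the unit circle *)

Section CirclePoints.
Variable R : realType.
Local Notation C := R[i].
Local Notation toC := (real_complex R).
Implicit Types u v a b c x y z : R.

(* The embedding (u : v) |-> (u + i v) / (u - i v) of the projective line as the unit circle. *)
Definition cpt u v : C := Complex u v / Complex u (- v).

Lemma Complex_eq0 u v : (Complex u v == 0) = ((u == 0) && (v == 0)).
Proof. by rewrite eq_complex. Qed.

Lemma sqr_sum_eq0 u v : (u ^+ 2 + v ^+ 2 == 0) = ((u == 0) && (v == 0)).
Proof. by rewrite paddr_eq0 ?sqr_ge0 // !sqrf_eq0. Qed.

Lemma Complex_neq0 u v : u ^+ 2 + v ^+ 2 != 0 -> Complex u v != 0.
Proof. by rewrite sqr_sum_eq0 Complex_eq0. Qed.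

Lemma Complex_conj_neq0 u v : u ^+ 2 + v ^+ 2 != 0 -> Complex u (- v) != 0.
Proof. by rewrite sqr_sum_eq0 Complex_eq0 oppr_eq0. Qed.

Lemma Complex1_neq0 z : Complex 1 z != 0.
Proof. by rewrite Complex_eq0 oner_eq0. Qed.

Lemma cabs_Complex u v : cabs (Complex u v) ^+ 2 = u ^+ 2 + v ^+ 2.
Proof. by rewrite sqr_cabs. Qed.

Lemma cabs_Complex_conj u v : cabs (Complex u (- v)) = cabs (Complex u v).
Proof. by rewrite -(cabs_conj (Complex u v)). Qed.

Lemma cabs_cpt u v : u ^+ 2 + v ^+ 2 != 0 -> cabs (cpt u v) = 1.
Proof.
move=> uv0; rewrite /cpt cabsM cabsV cabs_Complex_conj divff // cabs_eq0; exact: Complex_neq0.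
Qed.

Lemma Complex_chart a b c z : Complex (c * (a - b * z)) (c * (b + a * z)) =
  toC c * (Complex a b * Complex 1 z) :> C.
Proof. by apply/eqP; rewrite eq_complex /=; apply/andP; split; apply/eqP; ring. Qed.

Lemma cpt_chart a b c z : c != 0 ->
  cpt (c * (a - b * z)) (c * (b + a * z)) = cpt a b * cpt 1 z.
Proof.
move=> c0; rewrite /cpt Complex_chart.
have -> : Complex (c * (a - b * z)) (- (c * (b + a * z))) =
    toC c * (Complex a (- b) * Complex 1 (- z)).
  by rewrite -Complex_chart; congr Complex; ring.
by rewrite -mulf_div divff ?mul1r ?fmorph_eq0 // mulf_div.
Qed.

Lemma chart_norm a b c z : (c * (a - b * z)) ^+ 2 + (c * (b + a * z)) ^+ 2 =
  c ^+ 2 * ((a ^+ 2 + b ^+ 2) * (1 + z ^+ 2)).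
Proof. by ring. Qed.

Lemma chart_norm_neq0 a b c z : a ^+ 2 + b ^+ 2 != 0 -> c != 0 ->
  (c * (a - b * z)) ^+ 2 + (c * (b + a * z)) ^+ 2 != 0.
Proof.
move=> ab0 c0; rewrite chart_norm !mulf_neq0 ?expf_neq0 //.
by rewrite gt_eqF // ltr_pwDl // sqr_ge0.
Qed.

Lemma cabs_Complex1_ge1 z : 1 <= cabs (Complex 1 z).
Proof.
rewrite -(@ler_pXn2r _ 2) ?nnegrE ?cabs_ge0 ?ler01 //.
by rewrite cabs_Complex expr1n lerDl sqr_ge0.
Qed.

(** With [cpt 1 z = (1 + i z) / (1 - i z)] the difference to 1 is [2 i z / (1 - i z)], and [cpt a b]
    has modulus 1. *)
Lemma cpt_dist a b z : a ^+ 2 + b ^+ 2 != 0 ->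
  cabs (cpt a b * cpt 1 z - cpt a b) * cabs (Complex 1 z) = 2 * `|z|.
Proof.
move=> ab0; rewrite -{2}[cpt a b]mulr1 -mulrBr cabsM (cabs_cpt ab0) mul1r.
rewrite -(cabs_Complex_conj 1 z) -cabsM mulrBl mul1r /cpt divfK ?Complex_conj_neq0 //; last first.
  by rewrite gt_eqF // expr1n ltr_pwDl // sqr_ge0.
have -> : Complex 1 z - Complex 1 (- z) = toC (2 * z) * Complex 0 1.
  by apply/eqP; rewrite eq_complex /=; apply/andP; split; apply/eqP; ring.
rewrite cabsM cabs_real normrM (ger0_norm (ler0n _ 2)) -[RHS]mulr1; congr (_ * _).
apply/eqP; rewrite -(@pexpr_eq1 _ _ 2) ?cabs_ge0 //.
by rewrite cabs_Complex expr0n expr1n add0r.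
Qed.

Lemma cpt_dist_le a b z : a ^+ 2 + b ^+ 2 != 0 -> cabs (cpt a b * cpt 1 z - cpt a b) <= 2 * `|z|.
Proof.
move=> ab0; rewrite -(cpt_dist z ab0) ler_peMr ?cabs_ge0 //; exact: cabs_Complex1_ge1.
Qed.

(** The modulus of [1 + i z] is at most [1 + |z|], and [e <= 1] absorbs this factor in
    [cpt_dist]. *)
Lemma cpt_dist_lt a b z (e : R) : a ^+ 2 + b ^+ 2 != 0 -> e <= 1 ->
  cabs (cpt a b * cpt 1 z - cpt a b) < e -> `|z| < e.
Proof.
move=> ab0 e1 h; have := cpt_dist z ab0.
have hz : cabs (Complex 1 z) <= 1 + `|z|.
  have -> : Complex 1 z = 1 + Complex 0 1 * toC z.
    by apply/eqP; rewrite eq_complex /=; apply/andP; split; apply/eqP; ring.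
  rewrite (le_trans (cabsD _ _)) // cabs1 cabsM cabs_real lerD2l.
  have -> : cabs (Complex 0 1) = 1 :> R.
    apply/eqP; rewrite -(@pexpr_eq1 _ _ 2) ?cabs_ge0 //.
    by rewrite cabs_Complex expr0n expr1n add0r.
  by rewrite mul1r.
have h1 := cabs_Complex1_ge1 z; have h2 := cabs_ge0 (cpt a b * cpt 1 z - cpt a b).
move: (cabs _) (cabs _) (normr_ge0 z) hz h1 h2 h e1 => x y; move: `|z| => w.
by clear; nra.
Qed.

(** Distance 2 on the unit circle excludes only the antipode of [cpt a b], which is the point at
    infinity of the chart, where [(u, v)] is orthogonal to [(a, b)]. *)
Lemma chart_exists a b u v : a ^+ 2 + b ^+ 2 != 0 -> u ^+ 2 + v ^+ 2 != 0 ->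
  cabs (cpt u v - cpt a b) < 2 -> exists c z, [/\ c != 0, u = c * (a - b * z) & v = c * (b + a * z)].
Proof.
move=> ab0 uv0; have [E|n0 _] := eqVneq (a * u + b * v) 0; last first.
  exists ((a * u + b * v) / (a ^+ 2 + b ^+ 2)), ((a * v - b * u) / (a * u + b * v)); split.
  - by rewrite mulf_neq0 ?invr_eq0.
  - by field; rewrite n0.
  - by field; rewrite n0.
have {E} : exists k, u = - (k * b) /\ v = k * a.
  have h1 : u * (a ^+ 2 + b ^+ 2) = - ((a * v - b * u) * b) + (a * u + b * v) * a by ring.
  have h2 : v * (a ^+ 2 + b ^+ 2) = (a * v - b * u) * a + (a * u + b * v) * b by ring.
  rewrite E !mul0r !addr0 in h1 h2.
  exists ((a * v - b * u) / (a ^+ 2 + b ^+ 2)).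
  by split; apply: (mulIf ab0); rewrite ?h1 ?h2 1?mulNr mulrAC divfK // mulrAC divfK.
move=> [k [uE vE]]; have k0 : k != 0.
  by apply: contraNneq uv0 => k0; rewrite uE vE k0 !mul0r oppr0 expr0n addr0.
have -> : cpt u v = - cpt a b.
  rewrite /cpt.
  have -> : Complex u v = (toC k * Complex 0 1) * Complex a b.
    by rewrite uE vE; apply/eqP; rewrite eq_complex /=; apply/andP; split; apply/eqP; ring.
  have -> : Complex u (- v) = - (toC k * Complex 0 1) * Complex a (- b).
    by rewrite uE vE; apply/eqP; rewrite eq_complex /=; apply/andP; split; apply/eqP; ring.
  rewrite -mulf_div invrN mulrN divff ?mulN1r // mulf_neq0 ?fmorph_eq0 //.
  by rewrite Complex_eq0 oner_eq0 andbF.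
have -> : - cpt a b - cpt a b = toC (- 2) * cpt a b by rewrite rmorphN rmorph_nat mulNr mulr_natl mulr2n opprD.
by rewrite cabsM (cabs_cpt ab0) mulr1 cabs_real normrN ger0_norm ?ltxx.
Qed.

Lemma cpt_eq a b u v : a ^+ 2 + b ^+ 2 != 0 -> u ^+ 2 + v ^+ 2 != 0 ->
  cpt u v = cpt a b <-> exists c, [/\ c != 0, u = c * a & v = c * b].
Proof.
move=> ab0 uv0; split=> [E|[c [c0 -> ->]]]; last first.
  have := cpt_chart a b 0 c0; rewrite !mulr0 subr0 addr0 => ->.
  by rewrite /cpt oppr0 divff ?mulr1 // Complex1_neq0.
have [|c [z [c0 uE vE]]] := chart_exists ab0 uv0; first by rewrite E subrr cabs0.
exists c; have := cpt_dist z ab0; rewrite -(cpt_chart a b z c0) -uE -vE E subrr cabs0 mul0r.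
move/esym/eqP; rewrite mulf_eq0 pnatr_eq0 /= normr_eq0 => /eqP z0.
by split=> //; rewrite ?uE ?vE z0 mulr0 ?subr0 ?addr0.
Qed.

End CirclePoints.

Lemma itv_dist_lt (R : realType) (d u v x z : R) :
  x - d < u -> v < x + d -> u <= z -> z <= v -> `|z - x| < d.
Proof. by move=> *; rewrite ltr_norml; apply/andP; split; lra. Qed.

(** * The projective roots form a covering *)

Section Fibres.
Variables (R : realType) (m d : nat) (P : {poly {mpoly R[m]}}) (S : set 'rV[R]_m) (e : nat).
Local Notation C := R[i].
Local Notation toC := (real_complex R).
Hypothesis szP : (size P <= d.+1)%N.
Hypothesis disc0 : disc d P != 0.
Hypothesis hN : forall s, S s -> evalx s P != 0.
Hypothesis hD : forall s, S s -> has_ord (disc d P) (coords s) (Some e).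
Implicit Types (s p q : 'rV[R]_m) (w : C).

Definition pfibre s w := exists u v : R, [/\ u ^+ 2 + v ^+ 2 != 0,
  bhom d (u : R^o) (v : R^o) (evalx s P) = 0 & w = cpt u v].

Lemma bhom_scale (f : {poly R}) (c u v : R) :
  bhom d (c * u : R^o) (c * v : R^o) f = c ^+ d * bhom d (u : R^o) (v : R^o) f.
Proof.
rewrite /bhom mulr_sumr; apply: eq_bigr => k _.
have -> : c ^+ d = c ^+ k * c ^+ (d - k) by rewrite -exprD subnKC // -ltnS.
rewrite -![_ *: (_ : R^o)]/(_ * _) !exprMn [RHS]mulrCA; congr (_ * _); exact: mulrACA.
Qed.

Lemma fib_chart s w (a b : R) : a ^+ 2 + b ^+ 2 != 0 -> cabs (w - cpt a b) < 2 -> pfibre s w ->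
  exists2 z, w = cpt a b * cpt 1 z & root (mob d a b (evalx s P)) z.
Proof.
move=> ab0 wab [u [v [uv0 g0 wE]]]; rewrite wE in wab *.
have [c [z [c0 uE vE]]] := chart_exists ab0 uv0 wab.
exists z; first by rewrite uE vE cpt_chart.
move: g0; rewrite uE vE bhom_scale => /eqP; rewrite mulf_eq0 expf_eq0 (negPf c0) andbF /=.
by rewrite rootE horner_mob.
Qed.

Lemma root_fib s (a b z : R) : a ^+ 2 + b ^+ 2 != 0 -> root (mob d a b (evalx s P)) z ->
  pfibre s (cpt a b * cpt 1 z).
Proof.
move=> ab0 rz; exists (1 * (a - b * z)), (1 * (b + a * z)); split.
- by apply: chart_norm_neq0; rewrite ?oner_neq0.
- by rewrite !mul1r -horner_mob; apply/eqP.
- by rewrite cpt_chart ?oner_neq0.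
Qed.

Section AtPoint.
Variable p : 'rV[R]_m.
Hypothesis Sp : S p.

Let F := within S (nbhs p).
Let Fp (A : set 'rV[R]_m) : F A -> A p. Proof. by move=> h; exact: (nbhs_singleton h). Qed.
Let cF i : (fun s => coords s i) @ F --> coords p i.
Proof. by apply: cvg_within_filter; exact: coord_continuous. Qed.

(** The conclusion concerns [t = 0] and does not see the direction, so one direction [v0] suited to
    [p] serves all [s]. *)
Lemma near_root_mob (a b : R) : a ^+ 2 + b ^+ 2 != 0 -> root (mob d a b (evalx p P)) 0 ->
  exists2 rho0 : R, 0 < rho0 & forall rho, 0 < rho -> rho <= rho0 -> \forall s \near F,
    exists z : R, [/\ `|z| < rho, root (mob d a b (evalx s P)) z,
      mup z (mob d a b (evalx s P)) = mup 0 (mob d a b (evalx p P)) &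
      forall w : R, `|w| <= rho -> root (mob d a b (evalx s P)) w -> w = z].
Proof.
move=> ab0 r0; have [low [v0 De]] := (has_ordP _ _ _).1 (hD Sp).
have cv i : (fun=> v0 i) @ F --> v0 i by exact: cvg_cst.
have Dlow : \forall s \near F, forall k, (k < e)%N -> (line (coords s) v0 (disc d P))`_k = 0.
  have := near_withinT S (nbhs_filter p); apply: filterS => s Ss k ke.
  by have [l _] := (has_ordP _ _ _).1 (hD Ss); exact: l.
exact: (@near_root _ _ F p _ Fp _ _ _ (@coords R m) (fun=> v0) e cF cv szP disc0 Dlow De (hN Sp) a b ab0 r0).
Qed.

Lemma near_no_root_mob (a b : R) : ~~ root (mob d a b (evalx p P)) 0 ->
  exists2 rho : R, 0 < rho & \forall s \near F, forall z : R, `|z| <= rho ->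
    ~~ root (mob d a b (evalx s P)) z.
Proof.
move=> r0; pose f s := mob d a b (evalx s P).
have fE s l : (f s)`_l = \sum_(k < d.+1) (evalx s P)`_k *
    ((a%:P - b *: 'X) ^+ k * (b%:P + a *: 'X) ^+ (d - k))`_l.
  by rewrite /f /mob /bhom coef_sum; apply: eq_bigr => k _; rewrite coefZ.
have cf : cP F p f.
  split; first by exists d.+1 => s; exact: size_mob.
  move=> l; under eq_fun do rewrite fE; rewrite fE; apply: cvg_sum_ord => k.
  apply: cvgM; last exact: cvg_cst.
  have eE s : (evalx s P)`_k = (line (coords s) (fun=> 0) P`_k)`_0 by rewrite coef_line_0 coef_map.
  under eq_fun do rewrite eE; rewrite eE.
  have cv (i : 'I_m) : (fun=> 0 : R) @ F --> (0 : R) by exact: cvg_cst.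
  have [_ h] := @cP_line _ _ F p _ m (@coords R m) (fun=> (fun=> 0)) P`_k cF cv; exact: h.
have f0 : (f p)`_0 != 0 by rewrite -horner_coef0.
(* At order 0 [near_nonzero] leaves out [t = 0], which is treated by [near_coef]. *)
have [eps eps0 He] : exists2 eps : R, 0 < eps & \forall q \near F, forall t : C,
    0 < cabs t <= eps -> (map_poly toC (f q)).[t] != 0.
  by apply: (near_nonzero cf f0) => //; apply: filterE.
exists eps => //.
have f0p : 0 < `|(f p)`_0| by rewrite normr_gt0.
have H0 := near_coef 0 cf f0p.
near=> s => z zr; have [->|z0] := eqVneq z 0.
  rewrite rootE horner_coef0 -/(f s).
  have : `|(f s)`_0 - (f p)`_0| < `|(f p)`_0| by near: s; exact: H0.
  by apply: contraTneq => ->; rewrite sub0r normrN ltxx.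
have h : forall t : C, 0 < cabs t <= eps -> (map_poly toC (f s)).[t] != 0 by near: s.
have := h (toC z); rewrite cabs_real normr_gt0 z0 zr => /(_ isT).
by rewrite -rootE fmorph_root.
Unshelve. all: by end_near.
Qed.

(** Even covering inside a disc whose centre need not be a root over [p]; discs around non-roots
    stay empty. This allows the circle to be covered by finitely many such discs. *)
Definition good (x : C * R) := 0 < x.2 /\ forall eps, 0 < eps -> eps <= x.2 -> \forall s \near F,
  [/\ forall w, pfibre s w -> cabs (w - x.1) < x.2 -> pfibre p x.1 /\ cabs (w - x.1) < eps,
      pfibre p x.1 -> exists2 w, pfibre s w & cabs (w - x.1) < eps &
      forall w w', pfibre s w -> pfibre s w' -> cabs (w - x.1) < x.2 -> cabs (w' - x.1) < x.2 -> w = w'].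

Lemma good_exists (a b : R) : a ^+ 2 + b ^+ 2 != 0 -> exists rho, good (cpt a b, rho).
Proof.
move=> ab0; have near2 (w : C) (r : R) : r <= 1 -> cabs (w - cpt a b) < r -> cabs (w - cpt a b) < 2.
  by move=> r1 /lt_le_trans; apply; rewrite (le_trans r1) // ler1n.
have [r0|r0] := boolP (root (mob d a b (evalx p P)) 0).
  have [rho0 rho00 H] := near_root_mob ab0 r0.
  have fp : pfibre p (cpt a b).
    have := root_fib ab0 r0; rewrite (_ : cpt 1 0 = 1) ?mulr1 //.
    by rewrite /cpt oppr0 divff // Complex1_neq0.
  pose rho := Num.min 1 rho0; have rho_gt0 : 0 < rho by rewrite lt_min ltr01.
  have rho1 : rho <= 1 by rewrite ge_min lexx.
  have rho_le : rho <= rho0 by rewrite ge_min lexx orbT.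
  exists rho; split=> // eps eps0 eps_le /=.
  have eps2 : 0 < eps / 2 by rewrite divr_gt0.
  have eps2l : eps / 2 <= rho by rewrite (le_trans _ eps_le) // ler_pdivrMr // ler_peMr ?ler1n // ltW.
  have H1 := H _ rho_gt0 rho_le; have H2 := H _ eps2 (le_trans eps2l rho_le).
  near=> s.
  have [z [zr rz _ uz]] : exists z : R, [/\ `|z| < rho, root (mob d a b (evalx s P)) z,
      mup z (mob d a b (evalx s P)) = mup 0 (mob d a b (evalx p P)) &
      forall w : R, `|w| <= rho -> root (mob d a b (evalx s P)) w -> w = z] by near: s; exact: H1.
  have [y [ye ry _ _]] : exists z : R, [/\ `|z| < eps / 2, root (mob d a b (evalx s P)) z,
      mup z (mob d a b (evalx s P)) = mup 0 (mob d a b (evalx p P)) &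
      forall w : R, `|w| <= eps / 2 -> root (mob d a b (evalx s P)) w -> w = z] by near: s; exact: H2.
  have yz : y = z by apply: uz => //; rewrite ltW // (lt_le_trans ye).
  have near_e : cabs (cpt a b * cpt 1 z - cpt a b) < eps.
    by rewrite (le_lt_trans (cpt_dist_le z ab0)) // -yz mulrC -ltr_pdivlMr.
  have uw w : pfibre s w -> cabs (w - cpt a b) < rho -> w = cpt a b * cpt 1 z.
    move=> fw wr; have [t wE rt] := fib_chart ab0 (near2 _ _ rho1 wr) fw.
    rewrite wE in wr *; have tr := cpt_dist_lt ab0 rho1 wr.
    by rewrite (uz t) // ltW.
  split=> [w fw wr|_|w w' fw fw' wr wr'].
  - by rewrite (uw w fw wr).
  - by exists (cpt a b * cpt 1 z) => //; apply: root_fib.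
  - by rewrite (uw w) // (uw w').
have [rho0 rho00 H] := near_no_root_mob r0.
pose rho := Num.min 1 rho0; have rho_gt0 : 0 < rho by rewrite lt_min ltr01.
have rho1 : rho <= 1 by rewrite ge_min lexx.
have rho_le : rho <= rho0 by rewrite ge_min lexx orbT.
exists rho; split=> // eps eps0 eps_le /=; near=> s.
have no : forall z : R, `|z| <= rho0 -> ~~ root (mob d a b (evalx s P)) z by near: s; exact: H.
have no' w : pfibre s w -> cabs (w - cpt a b) < rho -> False.
  move=> fw wr; have [t wE rt] := fib_chart ab0 (near2 _ _ rho1 wr) fw.
  rewrite wE in wr; have tr := cpt_dist_lt ab0 rho1 wr.
  by have := no t; rewrite rt (le_trans (ltW tr)) // => /(_ isT).
split=> [w fw /(no' w fw)|fp|w w' fw _ /(no' w fw)] //.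
have [|t wE rt] := @fib_chart p (cpt a b) a b ab0 _ fp; first by rewrite subrr cabs0.
have := cpt_dist t ab0; rewrite -wE subrr cabs0 mul0r => /esym/eqP.
rewrite mulf_eq0 pnatr_eq0 /= normr_eq0 => /eqP t0.
by rewrite t0 (negPf r0) in rt.
Unshelve. all: by end_near.
Qed.

(** The condition holds at [s = p] itself; with [eps] equal to the distance of [w] to the centre it
    would be contradictory. *)
Lemma good_at x w : good x -> pfibre p w -> cabs (w - x.1) < x.2 -> w = x.1.
Proof.
move=> [x0 H] fw wx; apply: contrapT => wn.
have c0 : 0 < cabs (w - x.1) by rewrite cabs_gt0 subr_eq0; apply/eqP.
have [h _ _] := Fp (H _ c0 (ltW wx)).
by have [_] := h _ fw wx; rewrite ltxx.
Qed.

Lemma cpt_lip (y z : R) : cabs (cpt 1 z - cpt 1 y) <= 2 * `|z - y|.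
Proof.
have E : (cpt 1 z - cpt 1 y) * (Complex 1 (- z) * Complex 1 (- y)) = toC (2 * (z - y)) * Complex 0 1.
  rewrite mulrBl {1}/cpt /cpt mulrA divfK ?Complex1_neq0 // [Complex 1 (- z) * _]mulrC mulrA divfK ?Complex1_neq0 //.
  by apply/eqP; rewrite eq_complex /=; apply/andP; split; apply/eqP; ring.
have c01 : cabs (Complex 0 1) = 1 :> R.
  apply/eqP; rewrite -(@pexpr_eq1 _ _ 2) ?cabs_ge0 //.
  by rewrite cabs_Complex expr0n expr1n add0r.
have := congr1 (@cabs R) E; rewrite !cabsM c01 mulr1 cabs_real normrM ger0_norm // => <-.
rewrite ler_peMr ?cabs_ge0 // mulr_ege1 //; exact: cabs_Complex1_ge1.
Qed.

(** Compactness of an arc, through [cousin]. The halved radius makes up for the Lipschitz constant 2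
    of [cpt_lip]. *)
Lemma good_cover (a b : R) : a ^+ 2 + b ^+ 2 != 0 -> exists l : seq (C * R),
  (forall x, x \in l -> good x) /\
  forall z, -1 <= z <= 1 -> exists2 x, x \in l & cabs (cpt a b * cpt 1 z - x.1) < x.2.
Proof.
move=> ab0; apply: (@cousin R (fun u v => exists l : seq (C * R),
  (forall x, x \in l -> good x) /\
  forall z, u <= z <= v -> exists2 x, x \in l & cabs (cpt a b * cpt 1 z - x.1) < x.2)).
- exact: le_trans (lerN10 R) ler01.
- move=> x _; have [|rho Hg] := @good_exists (1 * (a - b * x)) (1 * (b + a * x)).
    by apply: chart_norm_neq0; rewrite ?oner_neq0.
  rewrite cpt_chart ?oner_neq0 // in Hg; have [/= rho0 _] := Hg.
  exists (rho / 2); first by rewrite divr_gt0.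
  move=> u v _ ux xv _ xu vx; exists [:: (cpt a b * cpt 1 x, rho)]; split=> [y|z /andP[uz zv]].
    by rewrite inE => /eqP ->.
  exists (cpt a b * cpt 1 x, rho); rewrite ?mem_head //=.
  rewrite -mulrBr cabsM cabs_cpt // mul1r (le_lt_trans (cpt_lip x z)) // mulrC -ltr_pdivlMr //.
  exact: itv_dist_lt xu vx uz zv.
- move=> u v w _ _ _ _ [l1 [g1 c1]] [l2 [g2 c2]]; exists (l1 ++ l2); split=> [x|z /andP[uz zw]].
    by rewrite mem_cat => /orP[/g1|/g2].
  have [zv|vz] := leP z v.
    by have [|x xl ?] := c1 z; [rewrite uz | exists x => //; rewrite mem_cat xl].
  by have [|x xl ?] := c2 z; [rewrite zw ltW | exists x => //; rewrite mem_cat xl orbT].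
Qed.

(** The arcs [|z| <= 1] around [(1 : 0)] and [(0 : 1)] cover the circle, according to which of [|u|]
    and [|v|] is larger. *)
Lemma good_cover_circle : exists l : seq (C * R), (forall x, x \in l -> good x) /\
  forall s w, pfibre s w -> exists2 x, x \in l & cabs (w - x.1) < x.2.
Proof.
have n1 : 1 ^+ 2 + 0 ^+ 2 != 0 :> R by rewrite expr1n expr0n addr0 oner_eq0.
have n2 : 0 ^+ 2 + 1 ^+ 2 != 0 :> R by rewrite expr1n expr0n add0r oner_eq0.
have [l1 [g1 c1]] := good_cover n1; have [l2 [g2 c2]] := good_cover n2.
exists (l1 ++ l2); split=> [x|s _ [u [v [uv0 _ ->]]]].
  by rewrite mem_cat => /orP[/g1|/g2].
have [vu|uv] := leP `|v| `|u|.
  have u0 : u != 0.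
    apply: contraNneq uv0 => u0; move: vu; rewrite u0 normr0 normr_le0 => /eqP ->.
    by rewrite expr0n addr0.
  have [|x xl hx] := c1 (v / u).
    by rewrite -ler_norml normrM normfV ler_pdivrMr ?normr_gt0 // mul1r.
  exists x; first by rewrite mem_cat xl.
  by move: hx; rewrite -(cpt_chart _ _ _ u0) mul0r mul1r subr0 add0r mulr1 mulrCA divff // mulr1.
have v0 : v != 0 by rewrite -normr_gt0 (le_lt_trans _ uv).
have [|x xl hx] := c2 (- u / v).
  by rewrite -ler_norml normrM normfV ler_pdivrMr ?normr_gt0 // normrN mul1r ltW.
exists x; first by rewrite mem_cat xl orbT.
move: hx; rewrite -(cpt_chart _ _ _ v0) mul0r mul1r sub0r addr0 mulr1 mulNr opprK mulrCA divff //.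
by rewrite mulr1.
Qed.

Lemma fib_finite : exists l : seq C, forall w, pfibre p w -> w \in l.
Proof.
have [l [gl cl]] := good_cover_circle; exists [seq x.1 | x <- l] => w fw.
have [x xl hx] := cl p w fw; rewrite (good_at (gl x xl) fw hx).
by apply/mapP; exists x.
Qed.

(** The radius [s] is bounded by all radii of the finite cover. A disc of the cover that contains a
    root over [p] is centred at it by [good_at], so statements about discs become statements about
    fibres. *)
Lemma cov_at_fib : cov_at pfibre S p.
Proof.
have [l [gl cl]] := good_cover_circle.
have [s s0 sl] : exists2 s : R, 0 < s & forall x, x \in l -> s <= x.2.
  elim: l gl {cl} => [|x l IHl] gl; first by exists 1.
  have [|s s0 sl] := IHl; first by move=> y yl; apply: gl; rewrite inE yl orbT.
  have [x0 _] := gl x (mem_head _ _).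
  exists (Num.min s x.2); first by rewrite lt_min s0.
  by move=> y; rewrite inE ge_min => /orP[/eqP->|/sl ->] //; rewrite lexx orbT.
exists s => // eps eps0 eps_s.
have near_l (l' : seq (C * R)) : (forall x, x \in l' -> x \in l) -> \forall q \near F, forall x, x \in l' ->
    [/\ forall w, pfibre q w -> cabs (w - x.1) < x.2 -> pfibre p x.1 /\ cabs (w - x.1) < eps,
      pfibre p x.1 -> exists2 w, pfibre q w & cabs (w - x.1) < eps &
      forall w w', pfibre q w -> pfibre q w' -> cabs (w - x.1) < x.2 -> cabs (w' - x.1) < x.2 -> w = w'].
  elim: l' => [|x l' IHl'] sub; first by apply: filterE.
  have xl : x \in l by apply: sub; rewrite mem_head.
  have [_ /(_ eps eps0 (le_trans eps_s (sl x xl))) H1] := gl x xl.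
  have H2 : \forall q \near F, forall x, x \in l' ->
    [/\ forall w, pfibre q w -> cabs (w - x.1) < x.2 -> pfibre p x.1 /\ cabs (w - x.1) < eps,
      pfibre p x.1 -> exists2 w, pfibre q w & cabs (w - x.1) < eps &
      forall w w', pfibre q w -> pfibre q w' -> cabs (w - x.1) < x.2 -> cabs (w' - x.1) < x.2 -> w = w'].
    by apply: IHl' => y yl; apply: sub; rewrite inE yl orbT.
  near=> q => y; rewrite inE => /orP[/eqP ->|yl']; first by near: q.
  by move: y yl'; near: q.
have H := near_l l (fun _ h => h).
suff : \forall q \near F, [/\ forall z, pfibre p z -> exists2 w, pfibre q w & cabs (w - z) < eps,
     forall w, pfibre q w -> exists2 z, pfibre p z & cabs (w - z) < eps &
     forall z w w', pfibre p z -> pfibre q w -> pfibre q w' -> cabs (w - z) < s -> cabs (w' - z) < s -> w = w'] by [].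
apply: filterS H => q H; split=> [z fz|w fw|z w w' fz fw fw' wz w'z].
- have [x xl hx] := cl p z fz; have zx := good_at (gl x xl) fz hx.
  by have [_ h _] := H x xl; rewrite zx; apply: h; rewrite -zx.
- have [x xl hx] := cl q w fw; have [h _ _] := H x xl.
  by have [? ?] := h w fw hx; exists x.1.
- have [x xl hx] := cl p z fz; have zx := good_at (gl x xl) fz hx.
  have [_ _ h] := H x xl; apply: h => //; rewrite -zx; apply: lt_le_trans (sl x xl); [exact: wz | exact: w'z].
Unshelve. all: by end_near.
Qed.

End AtPoint.
End Fibres.

(** * Multiplicity and order along a section *)

Section SectionInvariants.
Variables (R : realType) (m d : nat) (P : {poly {mpoly R[m]}}) (S : set 'rV[R]_m) (e : nat).
Local Notation C := R[i].
Hypothesis szP : (size P <= d.+1)%N.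
Hypothesis disc0 : disc d P != 0.
Hypothesis hN : forall s, S s -> evalx s P != 0.
Hypothesis hD : forall s, S s -> has_ord (disc d P) (coords s) (Some e).
Implicit Types (s p q : 'rV[R]_m) (w : C).

Lemma sec_chart (f : 'rV[R]_m -> C) p : S p -> sec (pfibre d P) S f ->
  exists (a b : R) (x : 'rV[R]_m -> R), [/\ a ^+ 2 + b ^+ 2 != 0, x p = 0,
    x @ within S (nbhs p) --> x p & \forall s \near within S (nbhs p),
      f s = cpt a b * cpt 1 (x s) /\ root (mob d a b (evalx s P)) (x s)].
Proof.
move=> Sp sf; have [fp cfp] := sf p Sp; have [a [b [ab0 _ fE]]] := fp.
have c10 : cpt 1 0 = 1 :> C by rewrite /cpt oppr0 divff // Complex1_neq0.
pose Q s := [set z : R | f s = cpt a b * cpt 1 z /\ root (mob d a b (evalx s P)) z].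
(* Away from [p], where no coordinate need exist, the value defaults to 0. *)
pose x s := xget 0 (Q s).
have xP : \forall s \near within S (nbhs p), Q s (x s).
  apply: filterS (cfp _ (ltr0Sn R 1)) => s h Ss.
  have [fs _] := sf s Ss; have := h Ss; rewrite fE => lt2.
  have [z zE rz] := fib_chart ab0 lt2 fs.
  by rewrite /x; case: xgetP => [y _ //|/(_ z)]; case.
have Qx0 : Q p 0.
  have [z zE rz] : exists2 z, f p = cpt a b * cpt 1 z & root (mob d a b (evalx p P)) z.
    by apply: fib_chart => //; rewrite fE subrr cabs0.
  have := cpt_dist z ab0; rewrite -zE fE subrr cabs0 mul0r => /esym/eqP.
  rewrite mulf_eq0 pnatr_eq0 /= normr_eq0 => /eqP z0.
  by split; rewrite ?c10 ?mulr1 // -z0.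
have small s (r : R) : Q s (x s) -> r <= 1 -> cabs (f s - f p) < r -> `|x s| < r.
  by move=> [fs _] r1; rewrite fs fE; exact: cpt_dist_lt.
have xp0 : x p = 0.
  have Qp : Q p (x p) by exact: (nbhs_singleton xP).
  apply: contrapT => /eqP xn; have := @small p (Num.min 1 `|x p|) Qp.
  rewrite ge_min lexx subrr cabs0 lt_min ltr01 normr_gt0 xn => /(_ isT isT).
  by rewrite lt_min ltxx andbF.
exists a, b, x; split=> //.
apply/cvgrPdist_lt => r r0; rewrite xp0.
have r10 : 0 < Num.min 1 r by rewrite lt_min ltr01.
have H := cfp _ r10; near=> s.
have Qs : Q s (x s) by near: s.
rewrite sub0r normrN.
have : `|x s| < Num.min 1 r.
  apply: small => //; first by rewrite ge_min lexx.
  by near: s; exact: H.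
by rewrite lt_min => /andP[].
Unshelve. all: by end_near.
Qed.

Definition fib_type mu o s w := forall u v, u ^+ 2 + v ^+ 2 != 0 -> cpt u v = w ->
  proj_root_mult (evalx_homog d s P) u v mu /\ has_ord (homogenize d P) (pt3 s u v) (Some o).

Lemma sec_type (f : 'rV[R]_m -> C) p : S p -> sec (pfibre d P) S f ->
  exists mu o, (0 < mu)%N /\ \forall s \near within S (nbhs p), fib_type mu o s (f s).
Proof.
move=> Sp sf; have [a [b [x [ab0 xp0 cx nx]]]] := sec_chart Sp sf.
have [_ rp] : f p = cpt a b * cpt 1 (x p) /\ root (mob d a b (evalx p P)) (x p).
  exact: (nbhs_singleton nx).
have nr : \forall s \near within S (nbhs p), root (mob d a b (evalx s P)) (x s).
  by apply: filterS nx => s [].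
have [n Hn] := near_has_ord_homogenize szP disc0 hN hD ab0 Sp cx nr.
rewrite xp0 in rp.
have [rho rho0 H] := near_root_mob szP disc0 hN hD Sp ab0 rp.
have {}H := H _ rho0 (lexx _).
exists (mup 0 (mob d a b (evalx p P))), n; split.
  rewrite mup_geq; last by apply: mob_neq0; rewrite ?hN // (leq_trans (size_poly _ _)).
  by rewrite expr1 dvdp_XsubCl.
have xs : \forall s \near within S (nbhs p), `|x s| < rho.
  have /cvgrPdist_lt/(_ _ rho0) := cx; rewrite xp0; apply: filterS => s.
  by rewrite sub0r normrN.
have nS := near_withinT S (nbhs_filter p).
near=> s.
have Ss : S s by near: s.
have [fE rs] : f s = cpt a b * cpt 1 (x s) /\ root (mob d a b (evalx s P)) (x s) by near: s.
have xr : `|x s| < rho by near: s.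
have [z [zr rz mz uz]] : exists z : R, [/\ `|z| < rho, root (mob d a b (evalx s P)) z,
      mup z (mob d a b (evalx s P)) = mup 0 (mob d a b (evalx p P)) &
      forall w : R, `|w| <= rho -> root (mob d a b (evalx s P)) w -> w = z] by near: s; exact: H.
have xz : x s = z by apply: uz => //; exact: ltW.
have Hs : forall c : R, c != 0 ->
  has_ord (homogenize d P) (pt3 s (c * (a - b * x s)) (c * (b + a * x s))) (Some n) by near: s; exact: Hn.
move=> u v uv0 uvE.
have n1 := @oner_neq0 R.
have AB0 := chart_norm_neq0 (x s) ab0 n1.
have [|c [c0 uE vE]] := (cpt_eq AB0 uv0).1; first by rewrite cpt_chart // uvE.
rewrite !mul1r in uE vE; rewrite uE vE; split; last exact: Hs.
by rewrite -mz -xz; apply: proj_root_mult_mob => //; exact: hN.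
Unshelve. all: by end_near.
Qed.

Lemma proj_root_mult_unique (g : {mpoly R[2]}) (u v : R) mu mu' :
  proj_root_mult g u v mu -> proj_root_mult g u v mu' -> mu = mu'.
Proof.
move=> [_ _ h1 h2] [_ _ h3 h4].
have dvd (l : {mpoly R[2]}) i j : (i <= j)%N -> mpdvd (l ^+ j) g -> mpdvd (l ^+ i) g.
  by move=> ij [c ->]; exists (l ^+ (j - i) * c); rewrite mulrA -exprD subnKC.
apply/eqP; rewrite eqn_leq; apply/andP; split; rewrite leqNgt; apply/negP => lt.
  by apply: h4; exact: dvd h1.
by apply: h2; exact: dvd h3.
Qed.

Lemma has_ord_unique k (g : {mpoly R[k]}) (x : 'I_k -> R) o o' :
  has_ord g x (Some o) -> has_ord g x (Some o') -> o = o'.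
Proof.
move=> [[a [ao ga]] h] [[a' [ao' ga']] h'].
apply/eqP; rewrite eqn_leq; apply/andP; split; rewrite leqNgt; apply/negP => lt.
  by move: ga'; rewrite h ?eqxx // ao'.
by move: ga; rewrite h' ?eqxx // ao.
Qed.

(** The pair of invariants is locally constant by [sec_type]; uniqueness of multiplicity and order
    lets the pair found at [p0] be compared with the local one at any other point, and paths in [S]
    do the rest. *)
Lemma sec_type_global (f : 'rV[R]_m -> C) p0 : pconn R S -> S p0 -> sec (pfibre d P) S f ->
  exists mu o, (0 < mu)%N /\ forall s, S s -> fib_type mu o s (f s).
Proof.
move=> cS Sp0 sf; have [mu [n [mu0 H0]]] := sec_type Sp0 sf.
exists mu, n; split=> // s Ss; have [g [wg g0 g1]] := cS p0 s Sp0 Ss.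
have Hp0 : fib_type mu n p0 (f p0) by exact: (nbhs_singleton H0).
have loc p : S p -> \forall q \near p, S q -> (fib_type mu n q (f q) <-> fib_type mu n p (f p)).
  move=> Sp; have [mu' [n' [_ H]]] := sec_type Sp sf.
  have uniq q : S q -> fib_type mu n q (f q) -> fib_type mu' n' q (f q) -> mu = mu' /\ n = n'.
    move=> Sq h h'; have [[u [v [uv0 _ /esym fE]]] _] := sf q Sq.
    have [m1 o1] := h u v uv0 fE; have [m2 o2] := h' u v uv0 fE.
    by split; [exact: proj_root_mult_unique m1 m2 | exact: has_ord_unique o1 o2].
  have Hp : fib_type mu' n' p (f p) by exact: (nbhs_singleton H).
  apply: filterS2 H (near_withinT S (nbhs_filter p)) => q Hq Sq; split=> h.
    by have [-> ->] := uniq q Sq h Hq.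
  by have [-> ->] := uniq p Sp h Hp.
have := loc_const_path (f := fun s => fib_type mu n s (f s)) loc wg.
by rewrite g0 g1 => h; apply/h.
Qed.

End SectionInvariants.

(** * Lifting of homotopies *)

Section Lifting.
Variables (R : realType) (m : nat) (S : set 'rV[R]_m).
Local Notation C := R[i].
Variable E : 'rV[R]_m -> C -> Prop.
Hypothesis cE : forall p, S p -> cov_at E S p.
Hypothesis scS : simply_connected S.
Hypothesis lpc : forall p N, S p -> nbhs p N -> exists2 N', nbhs p N' &
  forall q, S q -> N' q -> exists g : R -> 'rV[R]_m, [/\ wpath (S `&` N) g, g 0 = p & g 1 = q].
Implicit Types (p q r : 'rV[R]_m) (w z : C) (g : R -> 'rV[R]_m) (f : R -> C).

Local Notation I01 := (`[0, 1]%classic : set R).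

Let i0 : I01 0. Proof. by rewrite itv01 lexx ler01. Qed.
Let i1 : I01 1. Proof. by rewrite itv01 lexx ler01. Qed.

Definition lift g f := sec (fun t => E (g t)) I01 f.

Let I01E : (@unit_itv R) = I01.
Proof. by apply/seteqP; split=> x; rewrite itv01. Qed.

Lemma path_inP g : path_in S g <-> wpath S g.
Proof.
split=> -[cg Sg].
  split=> t t01; last exact: Sg.
  by have := (subspace_continuousP _ _).1 cg t t01; rewrite I01E.
split=> [|t t01]; last exact: Sg.
by apply/subspace_continuousP => t t01; rewrite I01E; exact: cg.
Qed.

Lemma wpath_comp g (h : R -> R) : (forall t, I01 t -> I01 (h t)) -> continuous h ->
  forall t, I01 t -> (forall t, I01 t -> g @ within I01 (nbhs t) --> g t) ->
  (g \o h) @ within I01 (nbhs t) --> g (h t).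
Proof.
move=> hI ch t t01 cg A /(cg _ (hI t t01)) H.
have H' : \forall s \near t, I01 (h s) -> A (g (h s)) := ch t _ H.
suff : \forall s \near t, I01 s -> A (g (h s)) by [].
by apply: filterS H' => s hs s01; apply: hs; exact: hI.
Qed.

Lemma wpath_cst p : S p -> wpath S (fun _ : R => p).
Proof. by move=> Sp; split=> // t _; exact: cvg_cst. Qed.

Lemma wpath_rev g : wpath S g -> wpath S (fun t => g (1 - t)).
Proof.
move=> [cg Sg]; have hI t : I01 t -> I01 (1 - t) by rewrite !itv01 => /andP[? ?]; apply/andP; lra.
split=> t t01; last by apply: Sg; rewrite -itv01; apply: hI; rewrite itv01.
apply: (@wpath_comp g (fun t => 1 - t)) => //.
by move=> x; apply: cvgB; [exact: cvg_cst | exact: cvg_id].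
Qed.

Lemma contC_comp f (h : R -> R) t : (forall t, I01 t -> I01 (h t)) -> continuous h ->
  contC I01 f (h t) -> contC I01 (fun t => f (h t)) t.
Proof.
move=> hI ch cf eps eps0; have H' : \forall s \near t, I01 (h s) -> cabs (f (h s) - f (h t)) < eps := ch t _ (cf eps eps0).
by apply: filterS H' => s hs s01; apply: hs; exact: hI.
Qed.

Lemma lift_rev g f : lift g f -> lift (fun t => g (1 - t)) (fun t => f (1 - t)).
Proof.
have hI t : I01 t -> I01 (1 - t) by rewrite !itv01 => /andP[? ?]; apply/andP; lra.
move=> lf t t01; have [Ef cf] := lf _ (hI t t01); split=> //.
apply: (contC_comp hI) cf => x; apply: cvgB; [exact: cvg_cst | exact: cvg_id].
Qed.

(* The concatenation is written as a sum so that its continuity needs no case analysis. *)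
Let h1 (t : R) : R := Num.min 1 (2 * t).
Let h2 (t : R) : R := Num.max 0 (2 * t - 1).

Let h1I t : I01 t -> I01 (h1 t).
Proof.
rewrite !itv01 /h1 => /andP[t0 t1]; rewrite le_min ler01 mulr_ge0 ?ler0n //=.
by rewrite ge_min lexx.
Qed.

Let h2I t : I01 t -> I01 (h2 t).
Proof.
rewrite !itv01 /h2 => /andP[t0 t1]; rewrite le_max lexx /= ge_max ler01 /=; lra.
Qed.

Let h1c : continuous h1.
Proof.
move=> x; suff : {for x, continuous ((fun _ : R => 1 : R^o) \min (fun t : R => 2 * t : R^o))} by [].
apply: continuous_min; first exact: cvg_cst.
by apply: cvgM; [exact: cvg_cst | exact: cvg_id].
Qed.

Let h2c : continuous h2.
Proof.
move=> x; suff : {for x, continuous ((fun _ : R => 0 : R^o) \max (fun t : R => 2 * t - 1 : R^o))} by [].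
apply: continuous_max; first exact: cvg_cst.
by apply: cvgB; [apply: cvgM; [exact: cvg_cst | exact: cvg_id] | exact: cvg_cst].
Qed.

Let cases t : I01 t -> (h2 t = 0) \/ (h1 t = 1).
Proof.
move=> _; have [h|h] := leP (2 * t) 1.
  by left; rewrite /h2 max_l // subr_le0.
by right; rewrite /h1 min_l // ltW.
Qed.

Definition concat (V : zmodType) (g1 g2 : R -> V) (c : V) (t : R) := g1 (h1 t) + g2 (h2 t) - c.

Let cat_cases (V : zmodType) (g1 g2 : R -> V) c t : g1 1 = c -> g2 0 = c -> I01 t ->
  (h2 t = 0 /\ concat g1 g2 c t = g1 (h1 t)) \/ (h1 t = 1 /\ concat g1 g2 c t = g2 (h2 t)).
Proof.
move=> e1 e2 /cases[h|h]; [left | right]; split=> //; rewrite /concat h.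
  by rewrite e2 addrK.
by rewrite e1 addrC addKr.
Qed.

Lemma wpath_cat g1 g2 r : wpath S g1 -> wpath S g2 -> g1 1 = r -> g2 0 = r ->
  wpath S (concat g1 g2 r).
Proof.
move=> [c1 S1] [c2 S2] e1 e2; split=> t t01; last first.
  have t01' : I01 t by rewrite itv01.
  have [[_ ->]|[_ ->]] := cat_cases e1 e2 t01'; first by apply: S1; rewrite -itv01; exact: h1I.
  by apply: S2; rewrite -itv01; exact: h2I.
have t01' : I01 t by rewrite itv01.
have c1' t' : I01 t' -> g1 @ within I01 (nbhs t') --> g1 t' by rewrite itv01; exact: c1.
have c2' t' : I01 t' -> g2 @ within I01 (nbhs t') --> g2 t' by rewrite itv01; exact: c2.
apply: cvgB; last exact: cvg_cst.
by apply: cvgD; [exact: (wpath_comp h1I) | exact: (wpath_comp h2I)].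
Qed.

Lemma contC_add (X : set R) f1 f2 t : contC X f1 t -> contC X f2 t -> contC X (fun t => f1 t + f2 t) t.
Proof.
move=> H1 H2 eps eps0; have e2 : 0 < eps / 2 by rewrite divr_gt0.
apply: filterS2 (H1 _ e2) (H2 _ e2) => s k1 k2 Xs; have {}k1 := k1 Xs; have {}k2 := k2 Xs.
rewrite opprD addrACA (le_lt_trans (cabsD _ _)) //.
by rewrite [eps](splitr eps) ltrD.
Qed.

Lemma lift_cat g1 g2 f1 f2 r z : lift g1 f1 -> lift g2 f2 -> g1 1 = r -> g2 0 = r ->
  f1 1 = z -> f2 0 = z -> lift (concat g1 g2 r) (concat f1 f2 z).
Proof.
move=> l1 l2 e1 e2 e3 e4 t t01; split.
  have [[k ->]|[k ->]] := cat_cases e1 e2 t01.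
    by rewrite /concat k e4 addrK; have [] := l1 _ (h1I t01).
  by rewrite /concat k e3 addrC addKr; have [] := l2 _ (h2I t01).
have [_ c1] := l1 _ (h1I t01); have [_ c2] := l2 _ (h2I t01).
have := contC_add (contC_comp h1I h1c c1) (contC_comp h2I h2c c2).
move=> H eps eps0; apply: filterS (H eps eps0) => s hs s01.
by rewrite /concat opprB subrKA; exact: hs.
Qed.

Lemma cov_path g : wpath S g -> forall t, I01 t -> cov_at (fun t => E (g t)) I01 t.
Proof.
move=> [cg Sg] t t01; apply: (@cov_at_pull R _ _ E S I01 g).
- by move=> s; rewrite itv01; exact: Sg.
- by move: t01; rewrite itv01; exact: cg.
- by apply: cE; apply: Sg; rewrite -itv01.
Qed.

Lemma pconn_itv : pconn R I01.
Proof.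
move=> p q; rewrite !itv01 => p01 q01; exists (fun t : R => p + t * (q - p)); split.
- split=> t t01; last by rewrite itv01; exact: convex_between.
  apply: cvg_within_filter; apply: cvgD; first exact: cvg_cst.
  by apply: cvgM; [exact: cvg_id | exact: cvg_cst].
- by rewrite mul0r addr0.
- by rewrite mul1r addrC subrK.
Qed.

Lemma lift_unique g f f' s t : wpath S g -> lift g f -> lift g f' -> I01 s -> I01 t ->
  f s = f' s -> f t = f' t.
Proof. by move=> wg; apply: sec_unique; [exact: cov_path | exact: pconn_itv]. Qed.

Let sq : set (R * R) := rect 0 1 0 1.

Let sqE (x : R * R) : sq x <-> I01 x.1 /\ I01 x.2.
Proof. by rewrite !itv01. Qed.

Lemma sec_line (E' : R * R -> C -> Prop) f (h : R -> R * R) : (forall t, I01 t -> sq (h t)) ->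
  continuous h -> forall F, sec E' sq F -> (forall t, f t = F (h t)) ->
  sec (fun t => E' (h t)) I01 f.
Proof.
move=> hI ch F sF fE t t01; have [EF cF] := sF _ (hI t t01); split; first by rewrite fE.
move=> eps eps0.
have H : \forall s \near t, sq (h s) -> cabs (F (h s) - F (h t)) < eps := ch t _ (cF eps eps0).
by apply: filterS H => s hs s01; rewrite !fE; apply: hs; exact: hI.
Qed.

Lemma triv_square (H : R * R -> 'rV[R]_m) :
  (forall x, sq x -> H @ within sq (nbhs x) --> H x) -> (forall x, sq x -> S (H x)) ->
  triv (fun x => E (H x)) sq.
Proof.
move=> cH SH; apply: triv_rect; rewrite ?ler01 // => p sp.
by apply: (@cov_at_pull R _ _ E S sq H) => //; [exact: cH | apply: cE; exact: SH].
Qed.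

Let cpair1 (c : R) : continuous (fun t : R => (t, c)).
Proof. by move=> x; exact: (cvg_pair (G := nbhs x) (H := nbhs c) cvg_id (cvg_cst c)). Qed.

Let cpair2 (c : R) : continuous (fun t : R => (c, t)).
Proof. by move=> x; exact: (cvg_pair (G := nbhs c) (H := nbhs x) (cvg_cst c) cvg_id). Qed.

(** One-dimensional lifting from the square: the map ignores its second coordinate, and the lift is
    restricted to the lower edge. *)
Lemma lift_exists g w : wpath S g -> E (g 0) w -> exists2 f, lift g f & f 0 = w.
Proof.
move=> [cg Sg] Ew.
have [|||F sF F0] := @triv_square (fun x => g x.1) _ _ (0, 0) w _ Ew.
- move=> x [x1 _] A /(cg _ x1) H.
  suff : \forall s \near x, sq s -> A (g s.1) by [].
  have cfst : (fun s : R * R => s.1) @ x --> x.1 by exact: cvg_fst.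
  have H' : \forall s \near x, I01 s.1 -> A (g s.1) := cfst _ H.
  by apply: filterS H' => s hs /sqE[s1 _]; exact: hs.
- by move=> p [p1 _]; exact: Sg.
- by split; rewrite /= lexx ler01.
exists (fun t => F (t, 0)) => //.
have hI t : I01 t -> sq (t, 0) by move=> t01; apply/sqE.
exact: (sec_line hI (@cpair1 0) sF).
Qed.

Lemma lift_const q f s t : S q -> lift (fun=> q) f -> I01 s -> I01 t -> f s = f t.
Proof.
move=> Sq lf s01 t01; have [Ef _] := lf s s01.
have lc : lift (fun=> q) (fun=> f s).
  by move=> x _; split=> // eps eps0; apply: filterE => y _; rewrite subrr cabs0.
by rewrite (lift_unique (wpath_cst Sq) lf lc s01 t01).
Qed.

(* Lift a null homotopy: the lift is constant on the three edges mapped to the base point. *)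
Lemma lift_loop g f : wpath S g -> lift g f -> g 0 = g 1 -> f 1 = f 0.
Proof.
move=> wg lf g01; have [_ loop] := scS.
have [H [cH SH Hg Hc]] := loop g ((path_inP g).2 wg) g01.
have S0 : S (g 0) by have [_ Sg] := wg; apply: Sg; rewrite lexx ler01.
have sqU : @unit_sq R = sq by [].
have EH0 : E (H (0, 0)) (f 0).
  by have [-> _] := Hg 0 i0; have [] := lf 0 i0.
have [|||F sF F0] := @triv_square H _ _ (0, 0) (f 0) _ EH0.
- by move=> p sp; have := (subspace_continuousP _ _).1 cH p sp.
- exact: SH.
- by split; rewrite /= lexx ler01.
have edge (h : R -> R * R) (g' : R -> 'rV[R]_m) : (forall t, I01 t -> sq (h t)) -> continuous h ->
    (forall t, I01 t -> H (h t) = g' t) -> lift g' (F \o h).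
  move=> hI ch hg t t01; have [] := sec_line hI ch sF (f := F \o h) (fun=> erefl) t01.
  by rewrite hg.
have sq1 c : I01 c -> forall t, I01 t -> sq (t, c) by move=> c01 t t01; apply/sqE.
have sq2 c : I01 c -> forall t, I01 t -> sq (c, t) by move=> c01 t t01; apply/sqE.
have b0 : lift g (fun t => F (t, 0)).
  apply: (edge _ _ (sq1 0 i0) (@cpair1 0)) => t t01; by have [] := Hg t t01.
have b1 : lift (fun=> g 0) (fun t => F (t, 1)).
  apply: (edge _ _ (sq1 1 i1) (@cpair1 1)) => t t01; by have [] := Hg t t01.
have l0 : lift (fun=> g 0) (fun t => F (0, t)).
  apply: (edge _ _ (sq2 0 i0) (@cpair2 0)) => t t01; by have [] := Hc t t01.
have l1 : lift (fun=> g 0) (fun t => F (1, t)).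
  apply: (edge _ _ (sq2 1 i1) (@cpair2 1)) => t t01; by have [] := Hc t t01.
rewrite -(lift_unique wg b0 lf i0 i1 F0) -F0.
rewrite (lift_const S0 l1 i0 i1) -(lift_const S0 b1 i0 i1).
by rewrite (lift_const S0 l0 i0 i1).
Qed.

Definition joined q w r z := exists g f, [/\ wpath S g, lift g f, g 0 = q, g 1 = r & f 0 = w /\ f 1 = z].

Lemma joined_sym q w r z : joined q w r z -> joined r z q w.
Proof.
move=> [g [f [wg lf g0 g1 [f0 f1]]]]; exists (fun t => g (1 - t)), (fun t => f (1 - t)).
by split; rewrite ?subr0 ?subrr //; [exact: wpath_rev | exact: lift_rev].
Qed.

Lemma joined_trans r z q w r' z' : joined q w r z -> joined r z r' z' -> joined q w r' z'.
Proof.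
move=> [g [f [wg lf g0 g1 [f0 f1]]]] [g' [f' [wg' lf' g'0 g'1 [f'0 f'1]]]].
have h10 : h1 0 = 0 by rewrite /h1 mulr0 min_r // ler01.
have h20 : h2 0 = 0 by rewrite /h2 mulr0 sub0r max_l // lerN10.
have h11 : h1 1 = 1 by rewrite /h1 mulr1 min_l // ler1n.
have h21 : h2 1 = 1 by rewrite /h2 mulr1 (_ : 2 - 1 = 1) ?max_r ?ler01 //; ring.
exists (concat g g' r), (concat f f' z); split.
- exact: wpath_cat.
- exact: lift_cat.
- by rewrite /concat h10 h20 g'0 addrK.
- by rewrite /concat h11 h21 g1 addrC addKr.
- by rewrite /concat h10 h20 h11 h21 f1 f'0 addrK addrC addKr.
Qed.

Lemma joined_fun q w r z z' : joined q w r z -> joined q w r z' -> z = z'.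
Proof.
move=> /joined_sym h /(joined_trans h)[g [f [wg lf g0 g1 [<- <-]]]].
by rewrite (lift_loop wg lf) // g0 g1.
Qed.

Lemma joined_exists q w r : S q -> S r -> E q w -> exists z, joined q w r z.
Proof.
move=> Sq Sr Ew; have [g [/path_inP wg g0 g1]] := scS.1 q r Sq Sr.
have [|f lf f0] := @lift_exists g w wg; first by rewrite g0.
by exists (f 1), g, f.
Qed.

(** The section is transport from [q], well defined by [joined_fun]. Near [r] it agrees with a local
    section [h], because [lpc] provides paths from [r] that stay in [N], and along them [h] itself
    gives the lift. *)
Theorem triv_simply_connected : triv E S.
Proof.
move=> q w Sq Ew; pose F r := xget 0 [set z | joined q w r z].
have FP r : S r -> joined q w r (F r).
  by move=> Sr; have [z jz] := joined_exists Sq Sr Ew; rewrite /F; case: xgetP => [y _ //|/(_ z)].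
exists F; last first.
  apply: (joined_fun (FP q Sq)); have lc : lift (fun=> q) (fun=> w).
    by move=> x _; split=> // eps eps0; apply: filterE => y _; rewrite subrr cabs0.
  by exists (fun=> q), (fun=> w); split=> //; exact: wpath_cst.
move=> r Sr; have [g [f [wg lf g0 g1 [f0 f1]]]] := FP r Sr.
have Er : E r (F r) by have [] := lf 1 i1; rewrite g1 f1.
split=> //; have [N nN tN] := triv_local cE Sr.
have Nr : N r := nbhs_singleton nN.
have [h sh hr] : exists2 h, sec E (S `&` N) h & h r = F r.
  by apply: (tN (S `&` N)) => // x [].
have [N' nN' pN'] := lpc Sr nN.
have Fh r' : S r' -> N' r' -> F r' = h r'.
  move=> Sr' Nr'; apply: (joined_fun (FP r' Sr')); apply: (joined_trans (FP r Sr)).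
  have [k [[ck Sk] k0 k1]] := pN' r' Sr' Nr'.
  exists k, (h \o k); split=> //=; rewrite ?k0 ?k1 //.
    by split=> // x /Sk[].
  move=> t; rewrite itv01 => t01; have [Eh ch] := sh _ (Sk t t01); split=> // eps eps0.
  have H : \forall s \near t, I01 s -> (S `&` N) (k s) -> cabs (h (k s) - h (k t)) < eps := ck t t01 _ (ch eps eps0).
  by apply: filterS H => s hs s01; apply: hs => //; apply: Sk; rewrite -itv01.
have [_ ch] := sh r (conj Sr Nr); move=> eps eps0.
apply: filterS3 (ch eps eps0) nN nN' => s hs Ns N's Ss.
by rewrite Fh // -hr; exact: hs.
Qed.

End Lifting.

(** * Analytic submanifolds *)

Section AnalyticContinuity.
Variables (R : realType) (m : nat).

(** A nonconstant monomial has at least one factor, so shrinking all coordinates by [t] shrinks it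
    at least by [t]; a constant one does not change. *)
Lemma monom_at_bound (al : 'X_{1..m}) (z : 'rV[R]_m) (t s : R) : 0 <= t <= 1 -> 0 <= s ->
  (forall i, `|z ord0 i| <= t * s) ->
  `|monom_at al z - monom_at al 0| <= t * monom_at al (const_mx s).
Proof.
move=> /andP[t0 t1] s0 zs.
have [al0|[i ai]] : (forall i, al i = 0%N) \/ exists i, (0 < al i)%N.
  have [/forallP h|/forallPn[i ai]] := boolP [forall i, al i == 0%N].
    by left=> i; apply/eqP.
  by right; exists i; rewrite lt0n.
- have E (y : 'rV[R]_m) : monom_at al y = 1 by rewrite /monom_at big1 // => i _; rewrite al0 expr0.
  by rewrite !E subrr normr0 mulr1.
have -> : monom_at al (0 : 'rV[R]_m) = 0.
  by rewrite /monom_at (bigD1 i) //= mxE expr0n gtn_eqF // mul0r.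
rewrite subr0 /monom_at normr_prod.
apply: (@le_trans _ _ (\prod_(i < m) (t * s) ^+ al i)).
  by apply: ler_prod => j _; rewrite normrX exprn_ge0 //= lerXn2r ?nnegrE ?mulr_ge0.
under eq_bigr do rewrite exprMn.
rewrite big_split /= prodrXr; under [X in _ <= _ * X]eq_bigr do rewrite mxE.
rewrite ler_wpM2r ?prodr_ge0 // => [j _|]; first by rewrite exprn_ge0.
have : (0 < \sum_(j < m) al j)%N by rewrite (bigD1 i) //= ltn_addr.
case: (\sum_(j < m) al j)%N => // k _.
by rewrite exprS ler_piMr // exprn_ile1.
Qed.

(** The absolutely convergent sum at the corner [a + const_mx s] bounds the increments of all
    partial sums by [t * M], hence those of [f]. *)
Lemma analytic_continuous (f : 'rV[R]_m -> R) a : analytic_at f a -> f @ a --> f a.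
Proof.
move=> [c [r [r0 H]]]; pose s := r / 2; have s0 : 0 < s by rewrite divr_gt0.
have sr : s < r by rewrite /s ltr_pdivrMr // ltr_pMr // ltr1n.
have bc (y : 'rV[R]_m) : (forall i, `|a ord0 i - y ord0 i| < r) -> ball a r y.
  by move=> h; split=> // i j; rewrite ord1 -ball_normE; exact: h.
have [|[M HM] _] := H (a + const_mx s).
  by apply: bc => i; rewrite !mxE opprD addNKr normrN gtr0_norm.
rewrite addrC addKr in HM.
have est (t : R) (y : 'rV[R]_m) : 0 <= t <= 1 -> (forall i, `|y ord0 i - a ord0 i| <= t * s) ->
    `|f y - f a| <= t * M.
  move=> /andP[t0 t1] ya.
  have ba : ball a r a by apply: bc => i; rewrite subrr normr0.
  have bY : ball a r y.
    apply: bc => i; rewrite distrC (le_lt_trans (ya i)) // (le_lt_trans _ sr) //.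
    by rewrite ler_piMl // ltW.
  have [_ cy] := H y bY; have [_ ca] := H a ba; rewrite subrr in ca.
  pose ps z N := \sum_(al : 'X_{1..m < N}) c al * monom_at al z.
  apply: (@cvgr_to_le nat \oo _ R (fun N => `|ps (y - a) N - ps 0 N|) _ (t * M)).
    by exact: (cvg_norm (cvgB cy ca)).
  apply: nearW => N; rewrite /ps.
  rewrite -sumrB (le_trans (ler_norm_sum _ _ _)) //.
  apply: le_trans (ler_wpM2l t0 (HM N)); rewrite mulr_sumr; apply: ler_sum => al _.
  rewrite -mulrBr !normrM mulrCA ler_wpM2l //.
  have t01 : 0 <= t <= 1 by rewrite t0.
  have yi i : `|(y - a) ord0 i| <= t * s by rewrite !mxE.
  apply: le_trans (monom_at_bound al t01 (ltW s0) yi) _.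
  by rewrite ler_wpM2l // ler_norm.
apply/(@cvgrPdist_lt _ _ _ (nbhs a) (nbhs_filter a)) => eps eps0.
pose M1 := `|M| + 1; have M10 : 0 < M1 by rewrite ltr_wpDl.
have MM1 : M < M1 by rewrite (le_lt_trans (ler_norm M)) // ltrDl.
pose t := Num.min 1 (eps / M1).
have t0 : 0 < t by rewrite lt_min ltr01 divr_gt0.
have t1 : t <= 1 by rewrite ge_min lexx.
near=> y.
rewrite distrC (le_lt_trans (est t y _ _)) ?(ltW t0) //.
  move=> i; rewrite distrC ltW //.
  have hb : ball a (t * s) y by near: y; apply: nbhsx_ballx; rewrite mulr_gt0.
  by have [_ /(_ ord0 i)] := hb; rewrite -ball_normE.
rewrite (lt_le_trans (_ : _ < t * M1)) ?ltr_pM2l // -ler_pdivlMr //.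
by rewrite ge_min lexx orbT.
Unshelve. all: by end_near.
Qed.
End AnalyticContinuity.

Lemma cvg_rV (R : realType) (m : nat) (T : Type) (F : set_system T) (h : T -> 'rV[R]_m) (l : 'rV[R]_m) :
  Filter F -> (forall i, (fun t => h t ord0 i) @ F --> l ord0 i) -> h @ F --> l.
Proof.
move=> FF H; apply/cvg_ballP => eps eps0.
have : \forall t \near F, forall i : 'I_m, ball (l ord0 i) eps (h t ord0 i).
  by apply: filter_forall => i; have /cvg_ballP := H i; apply.
by apply: filterS => t ht; split=> // i j; rewrite ord1; exact: ht.
Qed.

(** Overwriting the coordinates outside [J] by the functions [g] maps a ball around [p] into [S] and
    fixes its points in [S]; the path is the image of a segment. The ball is so small that its image
    stays in [N] and in [U], where the graph describes [S]. *)
Lemma analytic_submanifold_lpc (R : realType) (m : nat) (S : set 'rV[R]_m) p (N : set 'rV[R]_m) :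
  analytic_submanifold S -> S p -> nbhs p N -> exists2 N', nbhs p N' &
  forall q, S q -> N' q -> exists g : R -> 'rV[R]_m, [/\ wpath (S `&` N) g, g 0 = p & g 1 = q].
Proof.
move=> aS Sp nN; have [J [U [g [oU Up ag gJ SU]]]] := aS p Sp.
pose G (x : 'rV[R]_m) : 'rV[R]_m := \row_i (if i \in J then x ord0 i else g i x).
have SUG x : S x -> U x -> G x = x.
  move=> Sx Ux; have : (S `&` U) x by [].
  rewrite SU => -[_ h]; apply/rowP => i; rewrite mxE; case: ifP => // /negbT iJ.
  by rewrite h.
have GS x : U x -> U (G x) -> S (G x).
  move=> Ux UG; suff : (S `&` U) (G x) by case.
  rewrite SU; split=> // j jJ; rewrite mxE (negPf jJ); apply: gJ => i iJ.
  by rewrite mxE iJ.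
have cG x : U x -> G @ x --> G x.
  move=> Ux; apply: (cvg_rV (nbhs_filter x)) => i; under eq_fun do rewrite mxE; rewrite mxE.
  by case: ifP => _; [exact: coord_continuous | apply: analytic_continuous; exact: ag].
have nU : nbhs p U by exact: open_nbhs_nbhs.
have [d /= d0 Hd] : exists2 d : R, 0 < d & ball p d `<=` U `&` (G @^-1` (N `&` U)).
  have : nbhs p (U `&` (G @^-1` (N `&` U))).
    apply: filterI => //; apply: (cG p Up); rewrite (SUG p Sp Up); exact: filterI.
  by move/nbhs_ballP => [d /= d0 Hd]; exists d.
exists (ball p d); first exact: nbhsx_ballx.
move=> q Sq bq; have [Uq _] := Hd q bq.
pose L (t : R) := p + t *: (q - p).
have bL t : 0 <= t <= 1 -> ball p d (L t).
  move=> /andP[t0 t1]; split=> // i j; rewrite !mxE -ball_normE /ball_ /= opprD addNKr normrN normrM (ger0_norm t0).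
  have [_ /(_ i j)] := bq; rewrite -ball_normE /ball_ /= distrC; apply: le_lt_trans.
  by rewrite ler_piMl.
have cL t : L @ t --> L t.
  by apply: cvgD; [exact: cvg_cst | apply: cvgZr_tmp; exact: cvg_id].
exists (G \o L); split.
- split=> t t01; have [UL [NL ULG]] := Hd _ (bL t t01).
    apply: cvg_within_filter; apply: (@cvg_comp _ _ _ L G _ (nbhs (L t))); [exact: cL | exact: cG].
  by split=> //; exact: GS.
- by rewrite /= /L scale0r addr0 SUG.
- by rewrite /= /L scale1r addrC subrK SUG.
Qed.

(** * Delineation *)

Section ProjectiveLine.
Variable R : realType.
Local Notation C := R[i].

Lemma nz2P (u v : R) : nz2 (u, v) <-> u ^+ 2 + v ^+ 2 != 0.
Proof. by rewrite /nz2 /= sqr_sum_eq0 xpair_eqE. Qed.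

Definition mkR2 (u v : R) (h : u ^+ 2 + v ^+ 2 != 0) : R2nz R := exist _ (u, v) (mem_set ((nz2P u v).2 h)).

Lemma R2nz_neq0 (z : R2nz R) : (\val z).1 ^+ 2 + (\val z).2 ^+ 2 != 0.
Proof. by have := set_mem (valP z); case: (\val z) => u v /nz2P. Qed.

Let one_nz : 1 ^+ 2 + 0 ^+ 2 != 0 :> R.
Proof. by rewrite expr1n expr0n addr0 oner_eq0. Qed.

(** Inverse of the embedding [cpt]; complex numbers off the circle get the arbitrary class
    [(1 : 0)]. *)
Definition circle_rp (w : C) : RP1 R :=
  \pi_(RP1 R) (xget (mkR2 one_nz) [set z : R2nz R | cpt (\val z).1 (\val z).2 = w]).

Lemma repr_of_fun (p p' : RP1 R) u v : Defs.repr_of p u v -> Defs.repr_of p' u v -> p = p'.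
Proof.
move=> [z [zE <-]] [z' [z'E <-]]; congr (\pi_(RP1 R) _); apply: val_inj.
by rewrite /= zE z'E.
Qed.

Lemma repr_of_neq0 (p : RP1 R) u v : Defs.repr_of p u v -> u ^+ 2 + v ^+ 2 != 0.
Proof. by move=> [z [zE _]]; have := R2nz_neq0 z; rewrite zE. Qed.

Lemma repr_of_exists (p : RP1 R) : exists u v, Defs.repr_of p u v.
Proof.
exists (\val (repr p)).1, (\val (repr p)).2, (repr p); split; last exact: reprK.
by case: (\val _).
Qed.

Lemma repr_of_circle (u0 v0 u v : R) : u0 ^+ 2 + v0 ^+ 2 != 0 ->
  Defs.repr_of (circle_rp (cpt u0 v0)) u v <-> u ^+ 2 + v ^+ 2 != 0 /\ cpt u v = cpt u0 v0.
Proof.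
move=> uv0; rewrite /circle_rp.
set z := xget _ _; have zE : cpt (\val z).1 (\val z).2 = cpt u0 v0.
  by rewrite /z; case: xgetP => [y _ //|/(_ (mkR2 uv0))]; case.
have z0 := R2nz_neq0 z; split=> [[y [yE]] /(eqmodP (proportional_equiv R)) /asboolP [c [c0 yz]]|[uvn E]].
  have uvn : u ^+ 2 + v ^+ 2 != 0 by have := R2nz_neq0 y; rewrite yE.
  split=> //; rewrite -zE; apply/(cpt_eq z0 uvn); exists c.
  by move: yz; rewrite yE => -[-> ->].
exists (mkR2 uvn); split=> //; apply/(eqmodP (proportional_equiv R))/asboolP.
have [c [c0 uE vE]] : exists c, [/\ c != 0, u = c * (\val z).1 & v = c * (\val z).2].
  by apply/(cpt_eq z0 uvn); rewrite zE.
by exists c; split=> //=; rewrite -uE -vE.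
Qed.

Lemma cvg_R2nz (T : Type) (F : set_system T) (h : T -> R2nz R) (z : R2nz R) : Filter F ->
  (fun t => \val (h t)) @ F --> \val z -> h @ F --> z.
Proof.
move=> FF H U [V [/= [W oW <-]] /= Wz] /filterS; apply; apply: H.
exact: open_nbhs_nbhs.
Qed.

End ProjectiveLine.

Section Delineation.
Variables (R : realType) (m d : nat) (P : {poly {mpoly R[m]}}) (S : set 'rV[R]_m) (e : nat).
Local Notation C := R[i].
Hypothesis szP : (size P <= d.+1)%N.
Hypothesis disc0 : disc d P != 0.
Hypothesis hN : forall s, S s -> evalx s P != 0.
Hypothesis hD : forall s, S s -> has_ord (disc d P) (coords s) (Some e).
Hypothesis aS : analytic_submanifold S.
Hypothesis scS : simply_connected S.

Let cE p (Sp : S p) : cov_at (pfibre d P) S p := cov_at_fib szP disc0 hN hD Sp.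

Lemma pconn_simply_connected : pconn R S.
Proof.
move=> p q Sp Sq; have [g [wg g0 g1]] := scS.1 p q Sp Sq.
by exists g; split=> //; apply/path_inP.
Qed.

Let trivS : triv (pfibre d P) S.
Proof. by apply: triv_simply_connected => // p N Sp nN; exact: analytic_submanifold_lpc. Qed.

(** Continuity into a quotient is shown by a local lift: in the chart of [sec_chart] the section
    comes from a continuous map to nonzero vectors, followed by the projection. *)
Lemma sec_continuous_RP1 (f : 'rV[R]_m -> C) : sec (pfibre d P) S f ->
  {within S, continuous (fun s => circle_rp (f s))}.
Proof.
move=> sf; apply/subspace_continuousP => p Sp.
have [a [b [x [ab0 xp0 cx nx]]]] := sec_chart Sp sf.
pose A s := 1 * (a - b * x s); pose B s := 1 * (b + a * x s).
have AB0 s : A s ^+ 2 + B s ^+ 2 != 0 by apply: chart_norm_neq0; rewrite ?oner_neq0.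
pose h s : R2nz R := mkR2 (AB0 s).
have hE s : f s = cpt a b * cpt 1 (x s) -> circle_rp (f s) = \pi_(RP1 R) (h s).
  move=> fE; apply: (@repr_of_fun _ _ _ (A s) (B s)); last by exists (h s).
  have -> : f s = cpt (A s) (B s) by rewrite cpt_chart ?oner_neq0.
  by apply/repr_of_circle.
have ch : h @ within S (nbhs p) --> h p.
  apply: cvg_R2nz; rewrite /=.
  apply: (cvg_pair (G := nbhs (A p)) (H := nbhs (B p))); rewrite /A /B.
    by apply: cvgM; [exact: cvg_cst | apply: cvgB; [exact: cvg_cst | apply: cvgM => //; exact: cvg_cst]].
  by apply: cvgM; [exact: cvg_cst | apply: cvgD; [exact: cvg_cst | apply: cvgM => //; exact: cvg_cst]].
have [fp _] := nbhs_singleton nx Sp.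
suff : (fun s => circle_rp (f s)) @ within S (nbhs p) --> (\pi_(RP1 R) (h p) : RP1 R).
  by rewrite -(hE p fp).
move=> U nU0; have nU := ch _ (pi_continuous nU0).
suff : \forall s \near within S (nbhs p), U (circle_rp (f s)) by [].
by apply: filterS2 nx nU => s [fs _] Us; rewrite (hE s fs).
Qed.

Lemma meval_homogenize s (u v : R) : (homogenize d P).@[pt3 s u v] = bhom d (u : R^o) (v : R^o) (evalx s P).
Proof.
rewrite /homogenize /bhom raddf_sum /=; apply: eq_bigr => k _.
rewrite !mevalM !rmorphXn /= !mevalXU pt3_xn pt3_y -mulrA coef_map; congr (_ * _).
rewrite -[LHS]/(meval _ _) /liftx rmorph_mmap /= /meval; apply: eq_mmap => [c|i] /=.
  exact: mevalC.
by rewrite -[LHS]/(meval _ _) mevalXU pt3_lift.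
Qed.

Lemma fib_repr s (p : RP1 R) (u v : R) : Defs.repr_of p u v ->
  (homogenize d P).@[pt3 s u v] = 0 <-> pfibre d P s (cpt u v).
Proof.
move=> /repr_of_neq0 uv0; rewrite meval_homogenize; split=> [g0|[u' [v' [uv'0 g0 E]]]].
  by exists u, v.
have [c [c0 -> ->]] := (cpt_eq uv'0 uv0).1 E.
by rewrite bhom_scale g0 mulr0.
Qed.

(** The points of the finite fibre over [p0] index the sections: each point of the total space lies
    on a section, which is determined by its value at [p0]. *)
Lemma delineation_of_sections (p0 : 'rV[R]_m) : S p0 -> exists (k : nat) (F : 'I_k -> 'rV[R]_m -> C),
  [/\ forall l, sec (pfibre d P) S (F l),
      forall x z, S x -> pfibre d P x z -> exists l, F l x = z &
      forall x l l', S x -> F l x = F l' x -> l = l'].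
Proof.
move=> Sp0; have [ws0 fw0] := fib_finite szP disc0 hN hD Sp0.
(* [fib_finite] only provides a list containing the fibre; it is cut down here so that distinct
   indices give distinct sections. *)
pose ws := [seq w <- undup ws0 | `[< pfibre d P p0 w >]].
have wsP w : (w \in ws) <-> pfibre d P p0 w.
  rewrite mem_filter mem_undup; split=> [/andP[/asboolP]//|fw].
  by rewrite fw0 // andbT; apply/asboolP.
have uws : uniq ws by rewrite filter_uniq // undup_uniq.
have /choice[f fP] : forall w, exists f : 'rV[R]_m -> C, w \in ws -> sec (pfibre d P) S f /\ f p0 = w.
  move=> w; have [/wsP fw|wn] := boolP (w \in ws); last by exists (fun=> 0).
  by have [f sf fE] := trivS Sp0 fw; exists f.
pose F (l : 'I_(size ws)) := f (nth 0 ws l).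
have FP l : sec (pfibre d P) S (F l) /\ F l p0 = nth 0 ws l by apply: fP; rewrite mem_nth.
exists (size ws), F; split=> [l|x z Sx fz|x l l' Sx E]; first by have [] := FP l.
  have [h sh hx] := trivS Sx fz.
  have /(nthP 0)[l lw lE] : h p0 \in ws by apply/wsP; have [] := sh _ Sp0.
  exists (Ordinal lw); have [sF FE] := FP (Ordinal lw).
  by rewrite -hx; apply: (sec_unique cE pconn_simply_connected sF sh Sp0 Sx); rewrite FE.
have [sF FE] := FP l; have [sF' FE'] := FP l'.
have := sec_unique cE pconn_simply_connected sF sF' Sx Sp0 E; rewrite FE FE' => /eqP.
by rewrite nth_uniq // => /eqP/ord_inj.
Qed.

End Delineation.

Theorem mainTheorem9 (R : realType) (m : nat) (S : set 'rV[R]_m)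
    (P : {poly {mpoly R[m]}}) :
  analytic_submanifold S ->
  simply_connected S ->
  never_nullifies P S ->
  disc (size P).-1 P != 0 ->
  order_invariant (disc (size P).-1 P) (@coords R m @` S) ->
  exists (k : nat) (theta : 'I_k -> 'rV[R]_m -> RP1 R),
    proj_delineable_with P S theta /\
    (forall l : 'I_k, order_invariant_on_section P S (theta l)).
Proof.
move=> aS scS hN disc0 [n0 ho].
have [[p0 Sp0]|S0] := pselect (exists p, S p); last first.
  have noS x : S x -> False by move=> Sx; apply: S0; exists x.
  (* Over the empty set the family with no sections works. *)
  exists 0%N, (fun _ _ => circle_rp 0); split; last by case.
  by split; [case | move=> x p /noS | move=> x l l' /noS | case].
have hoS s : S s -> has_ord (disc (size P).-1 P) (coords s) n0 by move=> Ss; apply: ho; exists s.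
(* Order [None] would make all derivatives vanish at a point of [S], against the discriminant being
   nonzero. *)
case: n0 hoS {ho} => [e hD|hD]; last by have [] := has_ord_None disc0 (hD _ Sp0).
have szP : (size P <= (size P).-1.+1)%N := leqSpred (size P).
have [k [F [sF F_fib F_inj]]] := delineation_of_sections szP disc0 hN hD aS scS Sp0.
have type l := sec_type_global szP disc0 hN hD (pconn_simply_connected scS) Sp0 (sF l).
have fibF l x : S x -> exists u0 v0, u0 ^+ 2 + v0 ^+ 2 != 0 /\ F l x = cpt u0 v0.
  by move=> Sx; have [[u [v [uv0 _ E]]] _] := sF l x Sx; exists u, v.
have reprF l x u v : S x -> Defs.repr_of (circle_rp (F l x)) u v <-> u ^+ 2 + v ^+ 2 != 0 /\ cpt u v = F l x.
  by move=> Sx; have [u0 [v0 [uv0 ->]]] := fibF l x Sx; exact: repr_of_circle.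
exists k, (fun l x => circle_rp (F l x)); split; first split.
- by move=> l; exact: (sec_continuous_RP1 (sF l)).
- move=> x p Sx; split=> [H|[l <-] u v /(reprF l x u v Sx)[uv0 E]].
    have [u [v puv]] := repr_of_exists p.
    have [l lE] := F_fib x _ Sx ((fib_repr _ _ _ puv).1 (H u v puv)).
    exists l; apply: (@repr_of_fun _ _ _ u v) => //; apply/reprF => //.
    by split; [exact: repr_of_neq0 puv | rewrite lE].
  have r : Defs.repr_of (circle_rp (F l x)) u v by apply/reprF.
  by apply/(fib_repr _ _ _ r); rewrite E; have [] := sF l x Sx.
- move=> x l l' Sx E; apply: (F_inj x) => //; have [u [v r]] := repr_of_exists (circle_rp (F l x)).
  have [_ <-] := (reprF l x u v Sx).1 r; rewrite E in r.
  by have [_ <-] := (reprF l' x u v Sx).1 r.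
- move=> l; have [mu [n [mu0 H]]] := type l; exists mu; split=> // x Sx u v /(reprF l x u v Sx)[uv0 E].
  by have [] := H x Sx u v uv0 E.
- move=> l; have [mu [n [mu0 H]]] := type l; exists (Some n) => x Sx u v /(reprF l x u v Sx)[uv0 E].
  by have [] := H x Sx u v uv0 E.
Qed.
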